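(* Up to projective equivalence (under $\mathrm{P\Gamma L}(15,2)$) there are exactly thirty-five $5$-dimensional pseudo-ovals $\mathcal O$ in $\mathrm{PG}(14,2)$ for which the translation plane $\pi(\mathcal O,X)$ is Desarguesian for some $X\in\mathcal O$, and each of them is elementary.
   Context: An $n$-dimensional pseudo-oval in $\mathrm{PG}(3n-1,q)$ is a set $\mathcal O$ of $q^n+1$ projective $(n-1)$-dimensional subspaces any three of which span $\mathrm{PG}(3n-1,q)$; here $n=5$, $q=2$. For each $X\in\mathcal O$ there is a unique $(2n-1)$-dimensional subspace $T(X)\supseteq X$ meeting no other element of $\mathcal O$. For a $(2n-1)$-dimensional subspace $S$ skew to $X$, the subspaces $\langle X,Y\rangle\cap S$ ($Y\in\mathcal O\setminus\{X\}$) together with $T(X)\cap S$ form an $(n-1)$-spread of $S$, and $\pi(\mathcal O,X)$ is the translation plane of order $q^n$ obtained from it by the André/Bruck–Bose construction; it is Desarguesian if isomorphic to $\mathrm{PG}(2,q^n)$. A pseudo-oval is elementary if it arises from an oval of $\mathrm{PG}(2,q^n)$ (q^n+1 points, no three collinear) via an identification of $\mathrm{GF}(q)^{3n}$ with $\mathrm{GF}(q^n)^3$ as $\mathrm{GF}(q)$-vector spaces, points of $\mathrm{PG}(2,q^n)$ becoming $(n-1)$-dimensional subspaces of $\mathrm{PG}(3n-1,q)$. *)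

(* Defs.v *)
From HB Require Import structures.
From mathcomp Require Import all_boot all_order all_algebra.
Set Implicit Arguments. Unset Strict Implicit. Unset Printing Implicit Defensive.
Import GRing.Theory.
Local Open Scope ring_scope.

(* Vectors of V = GF(2)^15 are row vectors 'rV['F_2]_15.  A subspace of V is
   represented canonically by a square matrix A with <<A>>%MS = A (its row
   space).  Projective (n-1)-spaces = n-dimensional vector subspaces. *)
Notation F2 := 'F_2.
Notation vec15 := 'rV[F2]_15.
Notation sub15 := 'M[F2]_15.

Definition canon15 (A : sub15) : Prop := <<A>>%MS = A.

(* 5-dimensional pseudo-oval in PG(14,2): a set of q^n+1 = 33 projective
   4-dimensional subspaces (5-dim vector subspaces), any three of which span. *)
Definition pseudo_oval (O : {set sub15}) : Prop :=
  (forall X, X \in O -> canon15 X /\ \rank X = 5%N) /\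
  #|O| = 33%N /\
  (forall X Y Z, X \in O -> Y \in O -> Z \in O ->
     X != Y -> Y != Z -> X != Z -> \rank (X + Y + Z)%MS = 15%N).

(* Projective equivalence under PGammaL(15,2) = GL(15,2) (GF(2) has trivial
   automorphism group and trivial scalars). *)
Definition proj_equiv (O1 O2 : {set sub15}) : Prop :=
  exists A : sub15, A \in unitmx /\ O2 = [set <<X *m A>>%MS | X in O1].

Definition tangent_space (O : {set sub15}) (X T : sub15) : Prop :=
  \rank T = 10%N /\ (X <= T)%MS /\
  (forall Y, Y \in O -> Y != X -> \rank (T :&: Y)%MS = 0%N).

Definition induced_spread (O : {set sub15}) (X T S : sub15) : {set sub15} :=
  [set <<((X + Y) :&: S)%MS>>%MS | Y in O :\ X] :|: [set <<(T :&: S)%MS>>%MS].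

(* André / Bruck–Bose translation plane (projective completion) of a spread
   sp of S: affine points are vectors of S, points at infinity are the spread
   elements; lines are the cosets v + W (W in sp) completed by W, and the line
   at infinity. *)
Definition ptype := (vec15 + sub15)%type.

Definition tp_points (S : sub15) (sp : {set sub15}) : {set ptype} :=
  [set p : ptype | match p with inl v => (v <= S)%MS | inr W => W \in sp end].

Definition tp_affine_line (S : sub15) (v : vec15) (W : sub15) : {set ptype} :=
  [set p : ptype | match p with
                   | inl u => (u <= S)%MS && (u - v <= W)%MS
                   | inr W' => W' == W end].

Definition tp_line_at_infinity (sp : {set sub15}) : {set ptype} :=
  [set p : ptype | match p with inl _ => false | inr W => W \in sp end].

Definition tp_lines (S : sub15) (sp : {set sub15}) : {set {set ptype}} :=
  [set tp_affine_line S v W | v in [set v : vec15 | (v <= S)%MS], W in sp]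
  :|: [set tp_line_at_infinity sp].

Definition PG2_points (K : finFieldType) : {set 'M[K]_3} :=
  [set p : 'M[K]_3 | (<<p>>%MS == p) && (\rank p == 1%N)].

Definition PG2_lines (K : finFieldType) : {set {set 'M[K]_3}} :=
  [set [set p in PG2_points K | (p <= L)%MS]
     | L in [set L : 'M[K]_3 | (<<L>>%MS == L) && (\rank L == 2%N)]].

Definition incidence_iso (P Q : finType) (PS : {set P}) (LP : {set {set P}})
    (QS : {set Q}) (LQ : {set {set Q}}) : Prop :=
  exists f : P -> Q,
    {in PS &, injective f} /\ f @: PS = QS /\ [set f @: l | l : {set P} in LP] = LQ.

Definition desarguesian_at (O : {set sub15}) (X : sub15) : Prop :=
  exists T S : sub15,
    tangent_space O X T /\ \rank S = 10%N /\ \rank (X :&: S)%MS = 0%N /\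
    exists K : finFieldType, #|K| = 32%N /\
      incidence_iso (tp_points S (induced_spread O X T S))
                    (tp_lines S (induced_spread O X T S))
                    (PG2_points K) (PG2_lines K).

Definition oval (K : finFieldType) (Ov : {set 'M[K]_3}) : Prop :=
  Ov \subset PG2_points K /\ #|Ov| = 33%N /\
  (forall p1 p2 p3, p1 \in Ov -> p2 \in Ov -> p3 \in Ov ->
     p1 != p2 -> p2 != p3 -> p1 != p3 -> \rank (p1 + p2 + p3)%MS = 3%N).

(* Elementary pseudo-oval: obtained from an oval of PG(2,32) via a
   GF(2)-linear (= additive) bijection GF(2)^15 -> GF(32)^3; the point p
   becomes the subspace { v | phi v in p }. *)
Definition elementary (O : {set sub15}) : Prop :=
  exists K : finFieldType, #|K| = 32%N /\
  exists phi : vec15 -> 'rV[K]_3,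
    {morph phi : x y / x + y} /\ bijective phi /\
    exists Ov : {set 'M[K]_3}, oval Ov /\
      (forall X, X \in O -> exists2 p, p \in Ov &
          forall v : vec15, (v <= X)%MS = (phi v <= p)%MS) /\
      (forall p, p \in Ov -> exists2 X, X \in O &
          forall v : vec15, (v <= X)%MS = (phi v <= p)%MS).

(* Main.v *)
(* Split V = X + S.  A Desarguesian spread of S gives coordinates over GF(32) in which the elements
   of the pseudo-oval other than X are {(F_m(s), s, m s)}, m in GF(32), with F_m additive.  Passing
   to adjoints for the trace form, the span condition says that for every a <> 0 the graph of
   m |-> F_m^*(a) has no three collinear points.  Such a graph has a nucleus, depending additively
   on a; removing it leaves an additive family (h_a) of o-polynomials.

   If h is an o-polynomial of GF(32), the slopes at each point of its graph are a permutation of the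
   field, and their power sums give polynomial identities between the coefficients of h.  These cut
   the search for o-polynomials down to a feasible size and leave 35 classes up to translation,
   scaling, inversion and the Frobenius map.  If f and h are o-polynomials with f + h an
   o-polynomial, the polarised identities are linear in h for fixed f; solving them over GF(2) for
   each non-monomial class, and inspecting the monomial ones directly, shows that h is proportional
   to f as soon as h(1) / f(1) is one of the powers g, ..., g^4 of a primitive element g.  Hence
   h_a = k(a) h_1, which makes the pseudo-oval elementary.

   Conversely a projective equivalence of two elementary pseudo-ovals is semilinear over GF(32) and
   fixes the nucleus, so it induces one of the above moves on the o-polynomials, and a computation
   separates the 35 classes. *)
From Stdlib Require Import Ring.
From HB Require Import structures.
From mathcomp Require Import all_boot all_order all_algebra all_fingroup.
From mathcomp Require Import mxabelem finfield.
Require Import Defs.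
Set Implicit Arguments. Unset Strict Implicit. Unset Printing Implicit Defensive.
Import GRing.Theory.
Local Open Scope ring_scope.

(** * The field GF(32) *)

(** The power sums that are used have exponents 1, 3 = 1 + 2 and 5 = 1 + 4. Squares and fourth
    powers are additive, so every identity obtained is a sum of products of a conjugate of one
    coefficient with another coefficient. This biadditivity serves twice. Once the square roots of
    the odd-indexed coefficients are fixed (index u standing for x^(2u)), the identities of exponent
    3 are linear in the remaining ones; and the polarised identities of a pair f, h are additive in
    h. For a monomial f the polarised system leaves up to seven of the fifteen coefficients of h
    free, hence the separate treatment by a list of all functions equivalent to monomials. That list
    suffices, because a family with a member in another class can be based at that member instead.
    The ratios g, ..., g^4 are enough because together with 1 they form a basis of GF(32) over
    GF(2), while a |-> h_a(1) is an additive bijection: the multiples of h_1 by a basis already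
    generate the family. *)

Inductive gf32 : predArgType :=
| g0 | g1 | g2 | g3 | g4 | g5 | g6 | g7 | g8 | g9 | g10 | g11 | g12 | g13 | g14 | g15 | g16 | g17
| g18 | g19 | g20 | g21 | g22 | g23 | g24 | g25 | g26 | g27 | g28 | g29 | g30 | g31.

Definition gf_enum : seq gf32 := [::
g0; g1; g2; g3; g4; g5; g6; g7; g8; g9; g10; g11; g12; g13; g14; g15; g16; g17; g18; g19; g20; g21;
g22; g23; g24; g25; g26; g27; g28; g29; g30; g31].

(** The number of an element is the binary code of a polynomial in z = [g2], where z^5 = z^2 + 1;
    addition is therefore bitwise exclusive or. Full tables make each operation a plain match under
    [vm_compute]. *)
Definition fadd (a b : gf32) : gf32 := match a with
|g0=>b
|g1=>match b with |g0=>g1 |g1=>g0 |g2=>g3 |g3=>g2 |g4=>g5 |g5=>g4 |g6=>g7 |g7=>g6 |g8=>g9 |g9=>g8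
|g10=>g11 |g11=>g10 |g12=>g13 |g13=>g12 |g14=>g15 |g15=>g14 |g16=>g17 |g17=>g16 |g18=>g19 |g19=>g18
|g20=>g21 |g21=>g20 |g22=>g23 |g23=>g22 |g24=>g25 |g25=>g24 |g26=>g27 |g27=>g26 |g28=>g29 |g29=>g28
|g30=>g31 |g31=>g30 end
|g2=>match b with |g0=>g2 |g1=>g3 |g2=>g0 |g3=>g1 |g4=>g6 |g5=>g7 |g6=>g4 |g7=>g5 |g8=>g10 |g9=>g11
|g10=>g8 |g11=>g9 |g12=>g14 |g13=>g15 |g14=>g12 |g15=>g13 |g16=>g18 |g17=>g19 |g18=>g16 |g19=>g17
|g20=>g22 |g21=>g23 |g22=>g20 |g23=>g21 |g24=>g26 |g25=>g27 |g26=>g24 |g27=>g25 |g28=>g30 |g29=>g31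
|g30=>g28 |g31=>g29 end
|g3=>match b with |g0=>g3 |g1=>g2 |g2=>g1 |g3=>g0 |g4=>g7 |g5=>g6 |g6=>g5 |g7=>g4 |g8=>g11 |g9=>g10
|g10=>g9 |g11=>g8 |g12=>g15 |g13=>g14 |g14=>g13 |g15=>g12 |g16=>g19 |g17=>g18 |g18=>g17 |g19=>g16
|g20=>g23 |g21=>g22 |g22=>g21 |g23=>g20 |g24=>g27 |g25=>g26 |g26=>g25 |g27=>g24 |g28=>g31 |g29=>g30
|g30=>g29 |g31=>g28 end
|g4=>match b with |g0=>g4 |g1=>g5 |g2=>g6 |g3=>g7 |g4=>g0 |g5=>g1 |g6=>g2 |g7=>g3 |g8=>g12 |g9=>g13
|g10=>g14 |g11=>g15 |g12=>g8 |g13=>g9 |g14=>g10 |g15=>g11 |g16=>g20 |g17=>g21 |g18=>g22 |g19=>g23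
|g20=>g16 |g21=>g17 |g22=>g18 |g23=>g19 |g24=>g28 |g25=>g29 |g26=>g30 |g27=>g31 |g28=>g24 |g29=>g25
|g30=>g26 |g31=>g27 end
|g5=>match b with |g0=>g5 |g1=>g4 |g2=>g7 |g3=>g6 |g4=>g1 |g5=>g0 |g6=>g3 |g7=>g2 |g8=>g13 |g9=>g12
|g10=>g15 |g11=>g14 |g12=>g9 |g13=>g8 |g14=>g11 |g15=>g10 |g16=>g21 |g17=>g20 |g18=>g23 |g19=>g22
|g20=>g17 |g21=>g16 |g22=>g19 |g23=>g18 |g24=>g29 |g25=>g28 |g26=>g31 |g27=>g30 |g28=>g25 |g29=>g24
|g30=>g27 |g31=>g26 end
|g6=>match b with |g0=>g6 |g1=>g7 |g2=>g4 |g3=>g5 |g4=>g2 |g5=>g3 |g6=>g0 |g7=>g1 |g8=>g14 |g9=>g15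
|g10=>g12 |g11=>g13 |g12=>g10 |g13=>g11 |g14=>g8 |g15=>g9 |g16=>g22 |g17=>g23 |g18=>g20 |g19=>g21
|g20=>g18 |g21=>g19 |g22=>g16 |g23=>g17 |g24=>g30 |g25=>g31 |g26=>g28 |g27=>g29 |g28=>g26 |g29=>g27
|g30=>g24 |g31=>g25 end
|g7=>match b with |g0=>g7 |g1=>g6 |g2=>g5 |g3=>g4 |g4=>g3 |g5=>g2 |g6=>g1 |g7=>g0 |g8=>g15 |g9=>g14
|g10=>g13 |g11=>g12 |g12=>g11 |g13=>g10 |g14=>g9 |g15=>g8 |g16=>g23 |g17=>g22 |g18=>g21 |g19=>g20
|g20=>g19 |g21=>g18 |g22=>g17 |g23=>g16 |g24=>g31 |g25=>g30 |g26=>g29 |g27=>g28 |g28=>g27 |g29=>g26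
|g30=>g25 |g31=>g24 end
|g8=>match b with |g0=>g8 |g1=>g9 |g2=>g10 |g3=>g11 |g4=>g12 |g5=>g13 |g6=>g14 |g7=>g15 |g8=>g0
|g9=>g1 |g10=>g2 |g11=>g3 |g12=>g4 |g13=>g5 |g14=>g6 |g15=>g7 |g16=>g24 |g17=>g25 |g18=>g26
|g19=>g27 |g20=>g28 |g21=>g29 |g22=>g30 |g23=>g31 |g24=>g16 |g25=>g17 |g26=>g18 |g27=>g19 |g28=>g20
|g29=>g21 |g30=>g22 |g31=>g23 end
|g9=>match b with |g0=>g9 |g1=>g8 |g2=>g11 |g3=>g10 |g4=>g13 |g5=>g12 |g6=>g15 |g7=>g14 |g8=>g1
|g9=>g0 |g10=>g3 |g11=>g2 |g12=>g5 |g13=>g4 |g14=>g7 |g15=>g6 |g16=>g25 |g17=>g24 |g18=>g27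
|g19=>g26 |g20=>g29 |g21=>g28 |g22=>g31 |g23=>g30 |g24=>g17 |g25=>g16 |g26=>g19 |g27=>g18 |g28=>g21
|g29=>g20 |g30=>g23 |g31=>g22 end
|g10=>match b with |g0=>g10 |g1=>g11 |g2=>g8 |g3=>g9 |g4=>g14 |g5=>g15 |g6=>g12 |g7=>g13 |g8=>g2
|g9=>g3 |g10=>g0 |g11=>g1 |g12=>g6 |g13=>g7 |g14=>g4 |g15=>g5 |g16=>g26 |g17=>g27 |g18=>g24
|g19=>g25 |g20=>g30 |g21=>g31 |g22=>g28 |g23=>g29 |g24=>g18 |g25=>g19 |g26=>g16 |g27=>g17 |g28=>g22
|g29=>g23 |g30=>g20 |g31=>g21 end
|g11=>match b with |g0=>g11 |g1=>g10 |g2=>g9 |g3=>g8 |g4=>g15 |g5=>g14 |g6=>g13 |g7=>g12 |g8=>g3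
|g9=>g2 |g10=>g1 |g11=>g0 |g12=>g7 |g13=>g6 |g14=>g5 |g15=>g4 |g16=>g27 |g17=>g26 |g18=>g25
|g19=>g24 |g20=>g31 |g21=>g30 |g22=>g29 |g23=>g28 |g24=>g19 |g25=>g18 |g26=>g17 |g27=>g16 |g28=>g23
|g29=>g22 |g30=>g21 |g31=>g20 end
|g12=>match b with |g0=>g12 |g1=>g13 |g2=>g14 |g3=>g15 |g4=>g8 |g5=>g9 |g6=>g10 |g7=>g11 |g8=>g4
|g9=>g5 |g10=>g6 |g11=>g7 |g12=>g0 |g13=>g1 |g14=>g2 |g15=>g3 |g16=>g28 |g17=>g29 |g18=>g30
|g19=>g31 |g20=>g24 |g21=>g25 |g22=>g26 |g23=>g27 |g24=>g20 |g25=>g21 |g26=>g22 |g27=>g23 |g28=>g16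
|g29=>g17 |g30=>g18 |g31=>g19 end
|g13=>match b with |g0=>g13 |g1=>g12 |g2=>g15 |g3=>g14 |g4=>g9 |g5=>g8 |g6=>g11 |g7=>g10 |g8=>g5
|g9=>g4 |g10=>g7 |g11=>g6 |g12=>g1 |g13=>g0 |g14=>g3 |g15=>g2 |g16=>g29 |g17=>g28 |g18=>g31
|g19=>g30 |g20=>g25 |g21=>g24 |g22=>g27 |g23=>g26 |g24=>g21 |g25=>g20 |g26=>g23 |g27=>g22 |g28=>g17
|g29=>g16 |g30=>g19 |g31=>g18 end
|g14=>match b with |g0=>g14 |g1=>g15 |g2=>g12 |g3=>g13 |g4=>g10 |g5=>g11 |g6=>g8 |g7=>g9 |g8=>g6
|g9=>g7 |g10=>g4 |g11=>g5 |g12=>g2 |g13=>g3 |g14=>g0 |g15=>g1 |g16=>g30 |g17=>g31 |g18=>g28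
|g19=>g29 |g20=>g26 |g21=>g27 |g22=>g24 |g23=>g25 |g24=>g22 |g25=>g23 |g26=>g20 |g27=>g21 |g28=>g18
|g29=>g19 |g30=>g16 |g31=>g17 end
|g15=>match b with |g0=>g15 |g1=>g14 |g2=>g13 |g3=>g12 |g4=>g11 |g5=>g10 |g6=>g9 |g7=>g8 |g8=>g7
|g9=>g6 |g10=>g5 |g11=>g4 |g12=>g3 |g13=>g2 |g14=>g1 |g15=>g0 |g16=>g31 |g17=>g30 |g18=>g29
|g19=>g28 |g20=>g27 |g21=>g26 |g22=>g25 |g23=>g24 |g24=>g23 |g25=>g22 |g26=>g21 |g27=>g20 |g28=>g19
|g29=>g18 |g30=>g17 |g31=>g16 end
|g16=>match b with |g0=>g16 |g1=>g17 |g2=>g18 |g3=>g19 |g4=>g20 |g5=>g21 |g6=>g22 |g7=>g23 |g8=>g24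
|g9=>g25 |g10=>g26 |g11=>g27 |g12=>g28 |g13=>g29 |g14=>g30 |g15=>g31 |g16=>g0 |g17=>g1 |g18=>g2
|g19=>g3 |g20=>g4 |g21=>g5 |g22=>g6 |g23=>g7 |g24=>g8 |g25=>g9 |g26=>g10 |g27=>g11 |g28=>g12
|g29=>g13 |g30=>g14 |g31=>g15 end
|g17=>match b with |g0=>g17 |g1=>g16 |g2=>g19 |g3=>g18 |g4=>g21 |g5=>g20 |g6=>g23 |g7=>g22 |g8=>g25
|g9=>g24 |g10=>g27 |g11=>g26 |g12=>g29 |g13=>g28 |g14=>g31 |g15=>g30 |g16=>g1 |g17=>g0 |g18=>g3
|g19=>g2 |g20=>g5 |g21=>g4 |g22=>g7 |g23=>g6 |g24=>g9 |g25=>g8 |g26=>g11 |g27=>g10 |g28=>g13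
|g29=>g12 |g30=>g15 |g31=>g14 end
|g18=>match b with |g0=>g18 |g1=>g19 |g2=>g16 |g3=>g17 |g4=>g22 |g5=>g23 |g6=>g20 |g7=>g21 |g8=>g26
|g9=>g27 |g10=>g24 |g11=>g25 |g12=>g30 |g13=>g31 |g14=>g28 |g15=>g29 |g16=>g2 |g17=>g3 |g18=>g0
|g19=>g1 |g20=>g6 |g21=>g7 |g22=>g4 |g23=>g5 |g24=>g10 |g25=>g11 |g26=>g8 |g27=>g9 |g28=>g14
|g29=>g15 |g30=>g12 |g31=>g13 end
|g19=>match b with |g0=>g19 |g1=>g18 |g2=>g17 |g3=>g16 |g4=>g23 |g5=>g22 |g6=>g21 |g7=>g20 |g8=>g27
|g9=>g26 |g10=>g25 |g11=>g24 |g12=>g31 |g13=>g30 |g14=>g29 |g15=>g28 |g16=>g3 |g17=>g2 |g18=>g1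
|g19=>g0 |g20=>g7 |g21=>g6 |g22=>g5 |g23=>g4 |g24=>g11 |g25=>g10 |g26=>g9 |g27=>g8 |g28=>g15
|g29=>g14 |g30=>g13 |g31=>g12 end
|g20=>match b with |g0=>g20 |g1=>g21 |g2=>g22 |g3=>g23 |g4=>g16 |g5=>g17 |g6=>g18 |g7=>g19 |g8=>g28
|g9=>g29 |g10=>g30 |g11=>g31 |g12=>g24 |g13=>g25 |g14=>g26 |g15=>g27 |g16=>g4 |g17=>g5 |g18=>g6
|g19=>g7 |g20=>g0 |g21=>g1 |g22=>g2 |g23=>g3 |g24=>g12 |g25=>g13 |g26=>g14 |g27=>g15 |g28=>g8
|g29=>g9 |g30=>g10 |g31=>g11 end
|g21=>match b with |g0=>g21 |g1=>g20 |g2=>g23 |g3=>g22 |g4=>g17 |g5=>g16 |g6=>g19 |g7=>g18 |g8=>g29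
|g9=>g28 |g10=>g31 |g11=>g30 |g12=>g25 |g13=>g24 |g14=>g27 |g15=>g26 |g16=>g5 |g17=>g4 |g18=>g7
|g19=>g6 |g20=>g1 |g21=>g0 |g22=>g3 |g23=>g2 |g24=>g13 |g25=>g12 |g26=>g15 |g27=>g14 |g28=>g9
|g29=>g8 |g30=>g11 |g31=>g10 end
|g22=>match b with |g0=>g22 |g1=>g23 |g2=>g20 |g3=>g21 |g4=>g18 |g5=>g19 |g6=>g16 |g7=>g17 |g8=>g30
|g9=>g31 |g10=>g28 |g11=>g29 |g12=>g26 |g13=>g27 |g14=>g24 |g15=>g25 |g16=>g6 |g17=>g7 |g18=>g4
|g19=>g5 |g20=>g2 |g21=>g3 |g22=>g0 |g23=>g1 |g24=>g14 |g25=>g15 |g26=>g12 |g27=>g13 |g28=>g10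
|g29=>g11 |g30=>g8 |g31=>g9 end
|g23=>match b with |g0=>g23 |g1=>g22 |g2=>g21 |g3=>g20 |g4=>g19 |g5=>g18 |g6=>g17 |g7=>g16 |g8=>g31
|g9=>g30 |g10=>g29 |g11=>g28 |g12=>g27 |g13=>g26 |g14=>g25 |g15=>g24 |g16=>g7 |g17=>g6 |g18=>g5
|g19=>g4 |g20=>g3 |g21=>g2 |g22=>g1 |g23=>g0 |g24=>g15 |g25=>g14 |g26=>g13 |g27=>g12 |g28=>g11
|g29=>g10 |g30=>g9 |g31=>g8 end
|g24=>match b with |g0=>g24 |g1=>g25 |g2=>g26 |g3=>g27 |g4=>g28 |g5=>g29 |g6=>g30 |g7=>g31 |g8=>g16
|g9=>g17 |g10=>g18 |g11=>g19 |g12=>g20 |g13=>g21 |g14=>g22 |g15=>g23 |g16=>g8 |g17=>g9 |g18=>g10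
|g19=>g11 |g20=>g12 |g21=>g13 |g22=>g14 |g23=>g15 |g24=>g0 |g25=>g1 |g26=>g2 |g27=>g3 |g28=>g4
|g29=>g5 |g30=>g6 |g31=>g7 end
|g25=>match b with |g0=>g25 |g1=>g24 |g2=>g27 |g3=>g26 |g4=>g29 |g5=>g28 |g6=>g31 |g7=>g30 |g8=>g17
|g9=>g16 |g10=>g19 |g11=>g18 |g12=>g21 |g13=>g20 |g14=>g23 |g15=>g22 |g16=>g9 |g17=>g8 |g18=>g11
|g19=>g10 |g20=>g13 |g21=>g12 |g22=>g15 |g23=>g14 |g24=>g1 |g25=>g0 |g26=>g3 |g27=>g2 |g28=>g5
|g29=>g4 |g30=>g7 |g31=>g6 end
|g26=>match b with |g0=>g26 |g1=>g27 |g2=>g24 |g3=>g25 |g4=>g30 |g5=>g31 |g6=>g28 |g7=>g29 |g8=>g18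
|g9=>g19 |g10=>g16 |g11=>g17 |g12=>g22 |g13=>g23 |g14=>g20 |g15=>g21 |g16=>g10 |g17=>g11 |g18=>g8
|g19=>g9 |g20=>g14 |g21=>g15 |g22=>g12 |g23=>g13 |g24=>g2 |g25=>g3 |g26=>g0 |g27=>g1 |g28=>g6
|g29=>g7 |g30=>g4 |g31=>g5 end
|g27=>match b with |g0=>g27 |g1=>g26 |g2=>g25 |g3=>g24 |g4=>g31 |g5=>g30 |g6=>g29 |g7=>g28 |g8=>g19
|g9=>g18 |g10=>g17 |g11=>g16 |g12=>g23 |g13=>g22 |g14=>g21 |g15=>g20 |g16=>g11 |g17=>g10 |g18=>g9
|g19=>g8 |g20=>g15 |g21=>g14 |g22=>g13 |g23=>g12 |g24=>g3 |g25=>g2 |g26=>g1 |g27=>g0 |g28=>g7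
|g29=>g6 |g30=>g5 |g31=>g4 end
|g28=>match b with |g0=>g28 |g1=>g29 |g2=>g30 |g3=>g31 |g4=>g24 |g5=>g25 |g6=>g26 |g7=>g27 |g8=>g20
|g9=>g21 |g10=>g22 |g11=>g23 |g12=>g16 |g13=>g17 |g14=>g18 |g15=>g19 |g16=>g12 |g17=>g13 |g18=>g14
|g19=>g15 |g20=>g8 |g21=>g9 |g22=>g10 |g23=>g11 |g24=>g4 |g25=>g5 |g26=>g6 |g27=>g7 |g28=>g0
|g29=>g1 |g30=>g2 |g31=>g3 end
|g29=>match b with |g0=>g29 |g1=>g28 |g2=>g31 |g3=>g30 |g4=>g25 |g5=>g24 |g6=>g27 |g7=>g26 |g8=>g21
|g9=>g20 |g10=>g23 |g11=>g22 |g12=>g17 |g13=>g16 |g14=>g19 |g15=>g18 |g16=>g13 |g17=>g12 |g18=>g15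
|g19=>g14 |g20=>g9 |g21=>g8 |g22=>g11 |g23=>g10 |g24=>g5 |g25=>g4 |g26=>g7 |g27=>g6 |g28=>g1
|g29=>g0 |g30=>g3 |g31=>g2 end
|g30=>match b with |g0=>g30 |g1=>g31 |g2=>g28 |g3=>g29 |g4=>g26 |g5=>g27 |g6=>g24 |g7=>g25 |g8=>g22
|g9=>g23 |g10=>g20 |g11=>g21 |g12=>g18 |g13=>g19 |g14=>g16 |g15=>g17 |g16=>g14 |g17=>g15 |g18=>g12
|g19=>g13 |g20=>g10 |g21=>g11 |g22=>g8 |g23=>g9 |g24=>g6 |g25=>g7 |g26=>g4 |g27=>g5 |g28=>g2
|g29=>g3 |g30=>g0 |g31=>g1 end
|g31=>match b with |g0=>g31 |g1=>g30 |g2=>g29 |g3=>g28 |g4=>g27 |g5=>g26 |g6=>g25 |g7=>g24 |g8=>g23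
|g9=>g22 |g10=>g21 |g11=>g20 |g12=>g19 |g13=>g18 |g14=>g17 |g15=>g16 |g16=>g15 |g17=>g14 |g18=>g13
|g19=>g12 |g20=>g11 |g21=>g10 |g22=>g9 |g23=>g8 |g24=>g7 |g25=>g6 |g26=>g5 |g27=>g4 |g28=>g3
|g29=>g2 |g30=>g1 |g31=>g0 end
end.

Definition fmul (a b : gf32) : gf32 := match a with
|g0=>g0
|g1=>b
|g2=>match b with |g0=>g0 |g1=>g2 |g2=>g4 |g3=>g6 |g4=>g8 |g5=>g10 |g6=>g12 |g7=>g14 |g8=>g16
|g9=>g18 |g10=>g20 |g11=>g22 |g12=>g24 |g13=>g26 |g14=>g28 |g15=>g30 |g16=>g5 |g17=>g7 |g18=>g1
|g19=>g3 |g20=>g13 |g21=>g15 |g22=>g9 |g23=>g11 |g24=>g21 |g25=>g23 |g26=>g17 |g27=>g19 |g28=>g29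
|g29=>g31 |g30=>g25 |g31=>g27 end
|g3=>match b with |g0=>g0 |g1=>g3 |g2=>g6 |g3=>g5 |g4=>g12 |g5=>g15 |g6=>g10 |g7=>g9 |g8=>g24
|g9=>g27 |g10=>g30 |g11=>g29 |g12=>g20 |g13=>g23 |g14=>g18 |g15=>g17 |g16=>g21 |g17=>g22 |g18=>g19
|g19=>g16 |g20=>g25 |g21=>g26 |g22=>g31 |g23=>g28 |g24=>g13 |g25=>g14 |g26=>g11 |g27=>g8 |g28=>g1
|g29=>g2 |g30=>g7 |g31=>g4 end
|g4=>match b with |g0=>g0 |g1=>g4 |g2=>g8 |g3=>g12 |g4=>g16 |g5=>g20 |g6=>g24 |g7=>g28 |g8=>g5
|g9=>g1 |g10=>g13 |g11=>g9 |g12=>g21 |g13=>g17 |g14=>g29 |g15=>g25 |g16=>g10 |g17=>g14 |g18=>g2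
|g19=>g6 |g20=>g26 |g21=>g30 |g22=>g18 |g23=>g22 |g24=>g15 |g25=>g11 |g26=>g7 |g27=>g3 |g28=>g31
|g29=>g27 |g30=>g23 |g31=>g19 end
|g5=>match b with |g0=>g0 |g1=>g5 |g2=>g10 |g3=>g15 |g4=>g20 |g5=>g17 |g6=>g30 |g7=>g27 |g8=>g13
|g9=>g8 |g10=>g7 |g11=>g2 |g12=>g25 |g13=>g28 |g14=>g19 |g15=>g22 |g16=>g26 |g17=>g31 |g18=>g16
|g19=>g21 |g20=>g14 |g21=>g11 |g22=>g4 |g23=>g1 |g24=>g23 |g25=>g18 |g26=>g29 |g27=>g24 |g28=>g3
|g29=>g6 |g30=>g9 |g31=>g12 end
|g6=>match b with |g0=>g0 |g1=>g6 |g2=>g12 |g3=>g10 |g4=>g24 |g5=>g30 |g6=>g20 |g7=>g18 |g8=>g21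
|g9=>g19 |g10=>g25 |g11=>g31 |g12=>g13 |g13=>g11 |g14=>g1 |g15=>g7 |g16=>g15 |g17=>g9 |g18=>g3
|g19=>g5 |g20=>g23 |g21=>g17 |g22=>g27 |g23=>g29 |g24=>g26 |g25=>g28 |g26=>g22 |g27=>g16 |g28=>g2
|g29=>g4 |g30=>g14 |g31=>g8 end
|g7=>match b with |g0=>g0 |g1=>g7 |g2=>g14 |g3=>g9 |g4=>g28 |g5=>g27 |g6=>g18 |g7=>g21 |g8=>g29
|g9=>g26 |g10=>g19 |g11=>g20 |g12=>g1 |g13=>g6 |g14=>g15 |g15=>g8 |g16=>g31 |g17=>g24 |g18=>g17
|g19=>g22 |g20=>g3 |g21=>g4 |g22=>g13 |g23=>g10 |g24=>g2 |g25=>g5 |g26=>g12 |g27=>g11 |g28=>g30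
|g29=>g25 |g30=>g16 |g31=>g23 end
|g8=>match b with |g0=>g0 |g1=>g8 |g2=>g16 |g3=>g24 |g4=>g5 |g5=>g13 |g6=>g21 |g7=>g29 |g8=>g10
|g9=>g2 |g10=>g26 |g11=>g18 |g12=>g15 |g13=>g7 |g14=>g31 |g15=>g23 |g16=>g20 |g17=>g28 |g18=>g4
|g19=>g12 |g20=>g17 |g21=>g25 |g22=>g1 |g23=>g9 |g24=>g30 |g25=>g22 |g26=>g14 |g27=>g6 |g28=>g27
|g29=>g19 |g30=>g11 |g31=>g3 end
|g9=>match b with |g0=>g0 |g1=>g9 |g2=>g18 |g3=>g27 |g4=>g1 |g5=>g8 |g6=>g19 |g7=>g26 |g8=>g2
|g9=>g11 |g10=>g16 |g11=>g25 |g12=>g3 |g13=>g10 |g14=>g17 |g15=>g24 |g16=>g4 |g17=>g13 |g18=>g22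
|g19=>g31 |g20=>g5 |g21=>g12 |g22=>g23 |g23=>g30 |g24=>g6 |g25=>g15 |g26=>g20 |g27=>g29 |g28=>g7
|g29=>g14 |g30=>g21 |g31=>g28 end
|g10=>match b with |g0=>g0 |g1=>g10 |g2=>g20 |g3=>g30 |g4=>g13 |g5=>g7 |g6=>g25 |g7=>g19 |g8=>g26
|g9=>g16 |g10=>g14 |g11=>g4 |g12=>g23 |g13=>g29 |g14=>g3 |g15=>g9 |g16=>g17 |g17=>g27 |g18=>g5
|g19=>g15 |g20=>g28 |g21=>g22 |g22=>g8 |g23=>g2 |g24=>g11 |g25=>g1 |g26=>g31 |g27=>g21 |g28=>g6
|g29=>g12 |g30=>g18 |g31=>g24 end
|g11=>match b with |g0=>g0 |g1=>g11 |g2=>g22 |g3=>g29 |g4=>g9 |g5=>g2 |g6=>g31 |g7=>g20 |g8=>g18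
|g9=>g25 |g10=>g4 |g11=>g15 |g12=>g27 |g13=>g16 |g14=>g13 |g15=>g6 |g16=>g1 |g17=>g10 |g18=>g23
|g19=>g28 |g20=>g8 |g21=>g3 |g22=>g30 |g23=>g21 |g24=>g19 |g25=>g24 |g26=>g5 |g27=>g14 |g28=>g26
|g29=>g17 |g30=>g12 |g31=>g7 end
|g12=>match b with |g0=>g0 |g1=>g12 |g2=>g24 |g3=>g20 |g4=>g21 |g5=>g25 |g6=>g13 |g7=>g1 |g8=>g15
|g9=>g3 |g10=>g23 |g11=>g27 |g12=>g26 |g13=>g22 |g14=>g2 |g15=>g14 |g16=>g30 |g17=>g18 |g18=>g6
|g19=>g10 |g20=>g11 |g21=>g7 |g22=>g19 |g23=>g31 |g24=>g17 |g25=>g29 |g26=>g9 |g27=>g5 |g28=>g4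
|g29=>g8 |g30=>g28 |g31=>g16 end
|g13=>match b with |g0=>g0 |g1=>g13 |g2=>g26 |g3=>g23 |g4=>g17 |g5=>g28 |g6=>g11 |g7=>g6 |g8=>g7
|g9=>g10 |g10=>g29 |g11=>g16 |g12=>g22 |g13=>g27 |g14=>g12 |g15=>g1 |g16=>g14 |g17=>g3 |g18=>g20
|g19=>g25 |g20=>g31 |g21=>g18 |g22=>g5 |g23=>g8 |g24=>g9 |g25=>g4 |g26=>g19 |g27=>g30 |g28=>g24
|g29=>g21 |g30=>g2 |g31=>g15 end
|g14=>match b with |g0=>g0 |g1=>g14 |g2=>g28 |g3=>g18 |g4=>g29 |g5=>g19 |g6=>g1 |g7=>g15 |g8=>g31
|g9=>g17 |g10=>g3 |g11=>g13 |g12=>g2 |g13=>g12 |g14=>g30 |g15=>g16 |g16=>g27 |g17=>g21 |g18=>g7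
|g19=>g9 |g20=>g6 |g21=>g8 |g22=>g26 |g23=>g20 |g24=>g4 |g25=>g10 |g26=>g24 |g27=>g22 |g28=>g25
|g29=>g23 |g30=>g5 |g31=>g11 end
|g15=>match b with |g0=>g0 |g1=>g15 |g2=>g30 |g3=>g17 |g4=>g25 |g5=>g22 |g6=>g7 |g7=>g8 |g8=>g23
|g9=>g24 |g10=>g9 |g11=>g6 |g12=>g14 |g13=>g1 |g14=>g16 |g15=>g31 |g16=>g11 |g17=>g4 |g18=>g21
|g19=>g26 |g20=>g18 |g21=>g29 |g22=>g12 |g23=>g3 |g24=>g28 |g25=>g19 |g26=>g2 |g27=>g13 |g28=>g5
|g29=>g10 |g30=>g27 |g31=>g20 end
|g16=>match b with |g0=>g0 |g1=>g16 |g2=>g5 |g3=>g21 |g4=>g10 |g5=>g26 |g6=>g15 |g7=>g31 |g8=>g20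
|g9=>g4 |g10=>g17 |g11=>g1 |g12=>g30 |g13=>g14 |g14=>g27 |g15=>g11 |g16=>g13 |g17=>g29 |g18=>g8
|g19=>g24 |g20=>g7 |g21=>g23 |g22=>g2 |g23=>g18 |g24=>g25 |g25=>g9 |g26=>g28 |g27=>g12 |g28=>g19
|g29=>g3 |g30=>g22 |g31=>g6 end
|g17=>match b with |g0=>g0 |g1=>g17 |g2=>g7 |g3=>g22 |g4=>g14 |g5=>g31 |g6=>g9 |g7=>g24 |g8=>g28
|g9=>g13 |g10=>g27 |g11=>g10 |g12=>g18 |g13=>g3 |g14=>g21 |g15=>g4 |g16=>g29 |g17=>g12 |g18=>g26
|g19=>g11 |g20=>g19 |g21=>g2 |g22=>g20 |g23=>g5 |g24=>g1 |g25=>g16 |g26=>g6 |g27=>g23 |g28=>g15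
|g29=>g30 |g30=>g8 |g31=>g25 end
|g18=>match b with |g0=>g0 |g1=>g18 |g2=>g1 |g3=>g19 |g4=>g2 |g5=>g16 |g6=>g3 |g7=>g17 |g8=>g4
|g9=>g22 |g10=>g5 |g11=>g23 |g12=>g6 |g13=>g20 |g14=>g7 |g15=>g21 |g16=>g8 |g17=>g26 |g18=>g9
|g19=>g27 |g20=>g10 |g21=>g24 |g22=>g11 |g23=>g25 |g24=>g12 |g25=>g30 |g26=>g13 |g27=>g31 |g28=>g14
|g29=>g28 |g30=>g15 |g31=>g29 end
|g19=>match b with |g0=>g0 |g1=>g19 |g2=>g3 |g3=>g16 |g4=>g6 |g5=>g21 |g6=>g5 |g7=>g22 |g8=>g12
|g9=>g31 |g10=>g15 |g11=>g28 |g12=>g10 |g13=>g25 |g14=>g9 |g15=>g26 |g16=>g24 |g17=>g11 |g18=>g27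
|g19=>g8 |g20=>g30 |g21=>g13 |g22=>g29 |g23=>g14 |g24=>g20 |g25=>g7 |g26=>g23 |g27=>g4 |g28=>g18
|g29=>g1 |g30=>g17 |g31=>g2 end
|g20=>match b with |g0=>g0 |g1=>g20 |g2=>g13 |g3=>g25 |g4=>g26 |g5=>g14 |g6=>g23 |g7=>g3 |g8=>g17
|g9=>g5 |g10=>g28 |g11=>g8 |g12=>g11 |g13=>g31 |g14=>g6 |g15=>g18 |g16=>g7 |g17=>g19 |g18=>g10
|g19=>g30 |g20=>g29 |g21=>g9 |g22=>g16 |g23=>g4 |g24=>g22 |g25=>g2 |g26=>g27 |g27=>g15 |g28=>g12
|g29=>g24 |g30=>g1 |g31=>g21 end
|g21=>match b with |g0=>g0 |g1=>g21 |g2=>g15 |g3=>g26 |g4=>g30 |g5=>g11 |g6=>g17 |g7=>g4 |g8=>g25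
|g9=>g12 |g10=>g22 |g11=>g3 |g12=>g7 |g13=>g18 |g14=>g8 |g15=>g29 |g16=>g23 |g17=>g2 |g18=>g24
|g19=>g13 |g20=>g9 |g21=>g28 |g22=>g6 |g23=>g19 |g24=>g14 |g25=>g27 |g26=>g1 |g27=>g20 |g28=>g16
|g29=>g5 |g30=>g31 |g31=>g10 end
|g22=>match b with |g0=>g0 |g1=>g22 |g2=>g9 |g3=>g31 |g4=>g18 |g5=>g4 |g6=>g27 |g7=>g13 |g8=>g1
|g9=>g23 |g10=>g8 |g11=>g30 |g12=>g19 |g13=>g5 |g14=>g26 |g15=>g12 |g16=>g2 |g17=>g20 |g18=>g11
|g19=>g29 |g20=>g16 |g21=>g6 |g22=>g25 |g23=>g15 |g24=>g3 |g25=>g21 |g26=>g10 |g27=>g28 |g28=>g17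
|g29=>g7 |g30=>g24 |g31=>g14 end
|g23=>match b with |g0=>g0 |g1=>g23 |g2=>g11 |g3=>g28 |g4=>g22 |g5=>g1 |g6=>g29 |g7=>g10 |g8=>g9
|g9=>g30 |g10=>g2 |g11=>g21 |g12=>g31 |g13=>g8 |g14=>g20 |g15=>g3 |g16=>g18 |g17=>g5 |g18=>g25
|g19=>g14 |g20=>g4 |g21=>g19 |g22=>g15 |g23=>g24 |g24=>g27 |g25=>g12 |g26=>g16 |g27=>g7 |g28=>g13
|g29=>g26 |g30=>g6 |g31=>g17 end
|g24=>match b with |g0=>g0 |g1=>g24 |g2=>g21 |g3=>g13 |g4=>g15 |g5=>g23 |g6=>g26 |g7=>g2 |g8=>g30
|g9=>g6 |g10=>g11 |g11=>g19 |g12=>g17 |g13=>g9 |g14=>g4 |g15=>g28 |g16=>g25 |g17=>g1 |g18=>g12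
|g19=>g20 |g20=>g22 |g21=>g14 |g22=>g3 |g23=>g27 |g24=>g7 |g25=>g31 |g26=>g18 |g27=>g10 |g28=>g8
|g29=>g16 |g30=>g29 |g31=>g5 end
|g25=>match b with |g0=>g0 |g1=>g25 |g2=>g23 |g3=>g14 |g4=>g11 |g5=>g18 |g6=>g28 |g7=>g5 |g8=>g22
|g9=>g15 |g10=>g1 |g11=>g24 |g12=>g29 |g13=>g4 |g14=>g10 |g15=>g19 |g16=>g9 |g17=>g16 |g18=>g30
|g19=>g7 |g20=>g2 |g21=>g27 |g22=>g21 |g23=>g12 |g24=>g31 |g25=>g6 |g26=>g8 |g27=>g17 |g28=>g20
|g29=>g13 |g30=>g3 |g31=>g26 end
|g26=>match b with |g0=>g0 |g1=>g26 |g2=>g17 |g3=>g11 |g4=>g7 |g5=>g29 |g6=>g22 |g7=>g12 |g8=>g14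
|g9=>g20 |g10=>g31 |g11=>g5 |g12=>g9 |g13=>g19 |g14=>g24 |g15=>g2 |g16=>g28 |g17=>g6 |g18=>g13
|g19=>g23 |g20=>g27 |g21=>g1 |g22=>g10 |g23=>g16 |g24=>g18 |g25=>g8 |g26=>g3 |g27=>g25 |g28=>g21
|g29=>g15 |g30=>g4 |g31=>g30 end
|g27=>match b with |g0=>g0 |g1=>g27 |g2=>g19 |g3=>g8 |g4=>g3 |g5=>g24 |g6=>g16 |g7=>g11 |g8=>g6
|g9=>g29 |g10=>g21 |g11=>g14 |g12=>g5 |g13=>g30 |g14=>g22 |g15=>g13 |g16=>g12 |g17=>g23 |g18=>g31
|g19=>g4 |g20=>g15 |g21=>g20 |g22=>g28 |g23=>g7 |g24=>g10 |g25=>g17 |g26=>g25 |g27=>g2 |g28=>g9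
|g29=>g18 |g30=>g26 |g31=>g1 end
|g28=>match b with |g0=>g0 |g1=>g28 |g2=>g29 |g3=>g1 |g4=>g31 |g5=>g3 |g6=>g2 |g7=>g30 |g8=>g27
|g9=>g7 |g10=>g6 |g11=>g26 |g12=>g4 |g13=>g24 |g14=>g25 |g15=>g5 |g16=>g19 |g17=>g15 |g18=>g14
|g19=>g18 |g20=>g12 |g21=>g16 |g22=>g17 |g23=>g13 |g24=>g8 |g25=>g20 |g26=>g21 |g27=>g9 |g28=>g23
|g29=>g11 |g30=>g10 |g31=>g22 end
|g29=>match b with |g0=>g0 |g1=>g29 |g2=>g31 |g3=>g2 |g4=>g27 |g5=>g6 |g6=>g4 |g7=>g25 |g8=>g19
|g9=>g14 |g10=>g12 |g11=>g17 |g12=>g8 |g13=>g21 |g14=>g23 |g15=>g10 |g16=>g3 |g17=>g30 |g18=>g28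
|g19=>g1 |g20=>g24 |g21=>g5 |g22=>g7 |g23=>g26 |g24=>g16 |g25=>g13 |g26=>g15 |g27=>g18 |g28=>g11
|g29=>g22 |g30=>g20 |g31=>g9 end
|g30=>match b with |g0=>g0 |g1=>g30 |g2=>g25 |g3=>g7 |g4=>g23 |g5=>g9 |g6=>g14 |g7=>g16 |g8=>g11
|g9=>g21 |g10=>g18 |g11=>g12 |g12=>g28 |g13=>g2 |g14=>g5 |g15=>g27 |g16=>g22 |g17=>g8 |g18=>g15
|g19=>g17 |g20=>g1 |g21=>g31 |g22=>g24 |g23=>g6 |g24=>g29 |g25=>g3 |g26=>g4 |g27=>g26 |g28=>g10
|g29=>g20 |g30=>g19 |g31=>g13 end
|g31=>match b with |g0=>g0 |g1=>g31 |g2=>g27 |g3=>g4 |g4=>g19 |g5=>g12 |g6=>g8 |g7=>g23 |g8=>g3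
|g9=>g28 |g10=>g24 |g11=>g7 |g12=>g16 |g13=>g15 |g14=>g11 |g15=>g20 |g16=>g6 |g17=>g25 |g18=>g29
|g19=>g2 |g20=>g21 |g21=>g10 |g22=>g14 |g23=>g17 |g24=>g5 |g25=>g26 |g26=>g30 |g27=>g1 |g28=>g22
|g29=>g9 |g30=>g13 |g31=>g18 end
end.

Definition finv (a : gf32) : gf32 := match a with
|g0=>g0 |g1=>g1 |g2=>g18 |g3=>g28 |g4=>g9 |g5=>g23 |g6=>g14 |g7=>g12 |g8=>g22 |g9=>g4 |g10=>g25
|g11=>g16 |g12=>g7 |g13=>g15 |g14=>g6 |g15=>g13 |g16=>g11 |g17=>g24 |g18=>g2 |g19=>g29 |g20=>g30
|g21=>g26 |g22=>g8 |g23=>g5 |g24=>g17 |g25=>g10 |g26=>g21 |g27=>g31 |g28=>g3 |g29=>g19 |g30=>g20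
|g31=>g27
end.

Definition fsq (a : gf32) : gf32 := match a with
|g0=>g0 |g1=>g1 |g2=>g4 |g3=>g5 |g4=>g16 |g5=>g17 |g6=>g20 |g7=>g21 |g8=>g10 |g9=>g11 |g10=>g14
|g11=>g15 |g12=>g26 |g13=>g27 |g14=>g30 |g15=>g31 |g16=>g13 |g17=>g12 |g18=>g9 |g19=>g8 |g20=>g29
|g21=>g28 |g22=>g25 |g23=>g24 |g24=>g7 |g25=>g6 |g26=>g3 |g27=>g2 |g28=>g23 |g29=>g22 |g30=>g19
|g31=>g18
end.

Definition froot (a : gf32) : gf32 := match a with
|g0=>g0 |g1=>g1 |g2=>g27 |g3=>g26 |g4=>g2 |g5=>g3 |g6=>g25 |g7=>g24 |g8=>g19 |g9=>g18 |g10=>g8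
|g11=>g9 |g12=>g17 |g13=>g16 |g14=>g10 |g15=>g11 |g16=>g4 |g17=>g5 |g18=>g31 |g19=>g30 |g20=>g6
|g21=>g7 |g22=>g29 |g23=>g28 |g24=>g23 |g25=>g22 |g26=>g12 |g27=>g13 |g28=>g21 |g29=>g20 |g30=>g14
|g31=>g15
end.

Definition fcode (a : gf32) : nat := match a with
|g0=>0 |g1=>1 |g2=>2 |g3=>3 |g4=>4 |g5=>5 |g6=>6 |g7=>7 |g8=>8 |g9=>9 |g10=>10 |g11=>11 |g12=>12
|g13=>13 |g14=>14 |g15=>15 |g16=>16 |g17=>17 |g18=>18 |g19=>19 |g20=>20 |g21=>21 |g22=>22 |g23=>23
|g24=>24 |g25=>25 |g26=>26 |g27=>27 |g28=>28 |g29=>29 |g30=>30 |g31=>31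
end.

Definition fzero (a : gf32) : bool := if a is g0 then true else false.

Arguments fadd : simpl never.
Arguments fmul : simpl never.
Arguments finv : simpl never.
Arguments fsq : simpl never.
Arguments froot : simpl never.

(* [all] uses the strict [&&]; under call by value an early exit needs a conditional. *)
Fixpoint allf (T : Type) (p : T -> bool) (s : seq T) : bool :=
  if s is x :: s' then (if p x then allf p s' else false) else true.

Fixpoint hasf (T : Type) (p : T -> bool) (s : seq T) : bool :=
  if s is x :: s' then (if p x then true else hasf p s') else false.

Lemma allfE (T : Type) (p : T -> bool) s : allf p s = all p s.
Proof. by elim: s => //= x s ->; case: (p x). Qed.

Lemma hasfE (T : Type) (p : T -> bool) s : hasf p s = has p s.
Proof. by elim: s => //= x s ->; case: (p x). Qed.

Definition allg (p : gf32 -> bool) : bool := allf p gf_enum.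

Lemma allgP (p : gf32 -> bool) : reflect (forall x, p x) (allg p).
Proof.
rewrite /allg allfE; apply: (iffP idP) => [|H]; last by rewrite /= !H.
by rewrite /= => H [] ; move: H; do !(case/andP=> ? ) => //.
Qed.

Lemma fcodeK : cancel fcode (nth g0 gf_enum).
Proof. by case. Qed.

HB.instance Definition _ := Equality.copy gf32 (can_type fcodeK).
HB.instance Definition _ := Choice.copy gf32 (can_type fcodeK).
HB.instance Definition _ := Countable.copy gf32 (can_type fcodeK).

Lemma gf_enumP : Finite.axiom gf_enum.
Proof. by case. Qed.

HB.instance Definition _ := isFinite.Build gf32 gf_enumP.

Definition feq (a b : gf32) : bool := fzero (fadd a b).

Lemma feqP a b : reflect (a = b) (feq a b).
Proof. by apply: (iffP idP) => [|->]; [case: a; case: b | case: b]. Qed.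

Lemma feqE a b : feq a b = (a == b).
Proof. by apply/feqP/eqP. Qed.

Lemma fzeroP a : reflect (a = g0) (fzero a).
Proof. by apply: (iffP idP) => [|->] //; case: a. Qed.

Fact faddA : associative fadd.
Proof.
move=> x y z; apply/feqP; move: z; apply/allgP; move: y; apply/allgP; move: x.
by apply/allgP; vm_compute.
Qed.

Fact faddC : commutative fadd.
Proof.
by move=> x y; apply/feqP; move: y; apply/allgP; move: x; apply/allgP; vm_compute.
Qed.

Fact fadd0 : left_id g0 fadd. Proof. by []. Qed.

Fact faddN : left_inverse g0 id fadd. Proof. by case. Qed.

HB.instance Definition _ := GRing.isZmodule.Build gf32 faddA faddC fadd0 faddN.

Fact fmulA : associative fmul.
Proof.
move=> x y z; apply/feqP; move: z; apply/allgP; move: y; apply/allgP; move: x.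
by apply/allgP; vm_compute.
Qed.

Fact fmulC : commutative fmul.
Proof.
by move=> x y; apply/feqP; move: y; apply/allgP; move: x; apply/allgP; vm_compute.
Qed.

Fact fmul1 : left_id g1 fmul. Proof. by []. Qed.

Fact fmulDl : left_distributive fmul fadd.
Proof.
move=> x y z; apply/feqP; move: z; apply/allgP; move: y; apply/allgP; move: x.
by apply/allgP; vm_compute.
Qed.

Fact g1_neq0 : g1 != g0. Proof. by []. Qed.

HB.instance Definition _ :=
  GRing.Zmodule_isComNzRing.Build gf32 fmulA fmulC fmul1 fmulDl g1_neq0.

Fact fmulV (x : gf32) : x != 0 -> finv x * x = 1.
Proof. by case: x. Qed.

Fact finv0 : finv 0 = 0. Proof. by []. Qed.

HB.instance Definition _ := GRing.ComNzRing_isField.Build gf32 fmulV finv0.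

Lemma card_gf32 : #|gf32| = 32%N.
Proof. by rewrite cardE enumT unlock. Qed.

Lemma faddE (a b : gf32) : a + b = fadd a b. Proof. by []. Qed.
Lemma fmulE (a b : gf32) : a * b = fmul a b. Proof. by []. Qed.
Lemma foppE (a : gf32) : - a = a. Proof. by []. Qed.
Lemma fsqE (a : gf32) : fsq a = a ^+ 2. Proof. by case: a. Qed.
Lemma frootK : cancel froot fsq. Proof. by case. Qed.
Lemma fsqK : cancel fsq froot. Proof. by case. Qed.
Lemma froot_sq a : froot a ^+ 2 = a. Proof. by rewrite -fsqE frootK. Qed.
Lemma addff (a : gf32) : a + a = 0. Proof. by case: a. Qed.

Definition F2coef (b : bool) : gf32 := if b then g1 else g0.

Lemma gf_ring_theory :
  Ring_theory.ring_theory g0 g1 fadd fmul fadd id (@eq gf32).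
Proof.
split=> //; [exact: faddC | exact: faddA | exact: fmulC | exact: fmulA | exact: fmulDl | by case].
Qed.

(** With boolean coefficients under exclusive or, [ring] reduces x + x to 0 and so proves identities
    special to characteristic 2. *)
Lemma gf_ring_morph :
  Ring_theory.ring_morph g0 g1 fadd fmul fadd id (@eq gf32)
    false true addb andb addb id eqb F2coef.
Proof. by split=> //; try (by do ![case]); move=> [] []. Qed.

Ltac gf_cst t := match t with g0 => constr:(false) | g1 => constr:(true)
  | _ => constr:(InitialRing.NotConstant) end.
Add Ring gf_ring : gf_ring_theory (morphism gf_ring_morph, constants [gf_cst]).

Lemma fzeroE : (0 : gf32) = g0. Proof. by []. Qed.
Lemma foneE : (1 : gf32) = g1. Proof. by []. Qed.

Ltac gfring :=
  rewrite ?fsqE ?exprS ?expr0 ?mulr1 ?foppE ?faddE ?fmulE ?fzeroE ?foneE;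
  match goal with |- @eq _ ?a ?b => change (@eq gf32 a b) end; ring.

(** * O-polynomials *)

Lemma sum_gfE (F : gf32 -> gf32) :
  \sum_x F x = foldr (fun x s => fadd (F x) s) g0 gf_enum.
Proof. by rewrite -big_enum enumT unlock unlock. Qed.

Lemma all_iotaP (p : pred nat) m n : all p (iota m n) -> forall k, (m <= k < m + n)%N -> p k.
Proof. by move=> /allP H k Hk; apply: H; rewrite mem_iota. Qed.

Lemma gf_expr32 (x : gf32) : x ^+ 32 = x.
Proof. by apply/eqP; rewrite -feqE; move: x; apply/allgP; vm_compute. Qed.

Lemma gf_expr31 (x : gf32) : x != 0 -> x ^+ 31 = 1.
Proof. by move=> x0; apply: (mulfI x0); rewrite -exprS gf_expr32 mulr1. Qed.

Lemma gf_expr_add31 (x : gf32) n : (0 < n)%N -> x ^+ (n + 31) = x ^+ n.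
Proof. by case: n => // n _; rewrite addSnnS exprD gf_expr32 -exprSr. Qed.

Lemma gf_expr_mod31 (x : gf32) n k : (0 < n)%N -> x ^+ (n + 31 * k) = x ^+ n.
Proof.
move=> n0; elim: k => [|k IH]; first by rewrite muln0 addn0.
by rewrite mulnS addnCA addnC gf_expr_add31 // addn_gt0 n0.
Qed.

(** For a positive multiple of 31 the sum counts the 31 nonzero elements, and 31 is 1 in
    characteristic 2; for n = 0 it counts all 32. *)
Lemma psum n : \sum_(x : gf32) x ^+ n = ((0 < n) && (31 %| n))%N%:R.
Proof.
case: n => [|n]; first by rewrite sum_gfE; vm_compute.
(* Residues are taken in the range 1 to 31, not 0 to 30, because 0 ^+ 0 is 1. *)
have [q [r [-> r31]]] : exists q r, n.+1 = (r.+1 + 31 * q)%N /\ (r < 31)%N.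
  by exists (n %/ 31)%N, (n %% 31)%N; rewrite addSn mulnC addnC -divn_eq ltn_mod.
under eq_bigr do rewrite gf_expr_mod31 //.
rewrite dvdn_addl ?dvdn_mulr // addSn /=.
apply/eqP; rewrite sum_gfE -feqE; move: r r31.
apply: (@all_iotaP (fun r => feq (foldr (fun x s => fadd (x ^+ r.+1) s) g0 gf_enum)
  (31 %| r.+1)%N%:R) 0 31); by vm_compute.
Qed.

Lemma psum0 n : (n < 31)%N -> \sum_(x : gf32) x ^+ n = 0.
Proof. by rewrite psum; case: n => // n H; rewrite gtnNdvd. Qed.

Lemma sqrD2 : {morph (fun x : gf32 => x ^+ 2) : x y / x + y}.
Proof. by move=> x y; gfring. Qed.

Lemma sqr4D : {morph (fun x : gf32 => x ^+ 4) : x y / x + y}.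
Proof. by move=> x y; gfring. Qed.

Lemma sum_sqr (I : Type) (r : seq I) (P : pred I) (F : I -> gf32) :
  (\sum_(i <- r | P i) F i) ^+ 2 = \sum_(i <- r | P i) F i ^+ 2.
Proof. exact: (big_morph _ sqrD2 (expr0n _ 2)). Qed.

Lemma sum_pow4 (I : Type) (r : seq I) (P : pred I) (F : I -> gf32) :
  (\sum_(i <- r | P i) F i) ^+ 4 = \sum_(i <- r | P i) F i ^+ 4.
Proof. exact: (big_morph _ sqr4D (expr0n _ 4)). Qed.

(* Multiplying by s^(31 - e) and summing over s isolates the coefficient of s^e. *)
Lemma coef_ext (r : seq nat) (a : nat -> gf32) :
    uniq r -> all (fun e => e < 31)%N r ->
    (forall s, \sum_(e <- r) a e * s ^+ e = 0) -> forall e, e \in r -> a e = 0.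
Proof.
move=> Ur /allP r31 H e er.
have: \sum_(s : gf32) s ^+ (31 - e) * (\sum_(e' <- r) a e' * s ^+ e') = 0.
  by rewrite big1 // => s _; rewrite H mulr0.
under eq_bigr do rewrite big_distrr.
rewrite exchange_big (bigD1_seq e) //=.
rewrite [X in _ + X](_ : _ = 0) ?addr0; last first.
  rewrite big_seq_cond big1 // => i /andP[ir ie].
  under eq_bigr do rewrite mulrCA -exprD.
  rewrite -mulr_sumr psum; have := r31 _ ir; have := r31 _ er => e31 i31.
  case: (boolP (31 %| _)%N) => [/dvdnP[[|[|k]]]|]; rewrite ?andbF ?mulr0 //.
  - by move/eqP; rewrite addn_eq0 subn_eq0 leqNgt e31.
  - by move=> E; case/negP: ie; rewrite -(eqn_add2l (31 - e)) E mul1n subnK // ltnW.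
  - move=> E; suff: (31 - e + i < k.+2 * 31)%N by rewrite E ltnn.
    apply: (@leq_trans (31 + 31)%N); first by rewrite -addnS leq_add // leq_subr.
    by rewrite !mulSn addnA leq_addr.
under eq_bigr do rewrite mulrCA -exprD subnK ?(ltnW (r31 _ er)) //.
by rewrite -mulr_sumr psum /= mulr1.
Qed.

(** * Arcs given by functions, and the moments of an o-polynomial *)

Definition arcfun (h : gf32 -> gf32) : Prop := forall x y z,
  x != y -> y != z -> x != z -> (h x + h z) * (y + z) != (h y + h z) * (x + z).

(** The value at 1 is left free, which makes the notion stable under scaling. Injectivity says that
    (0 : 1 : 0) extends the arc of the points (1 : x : h x); the resulting oval has nucleus (0 : 0 :
    1). *)
Definition opoly (h : gf32 -> gf32) : Prop := [/\ h 0 = 0, injective h & arcfun h].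

Lemma addf_eq0 (x y : gf32) : (x + y == 0) = (x == y).
Proof. by rewrite addr_eq0. Qed.

Lemma eq_opoly (h g : gf32 -> gf32) : h =1 g -> opoly h -> opoly g.
Proof.
move=> E [h0 hi ha]; split; first by rewrite -E.
  by move=> x y; rewrite -!E => /hi.
by move=> x y z; rewrite -!E; apply: ha.
Qed.

Lemma cubeD_mul (a b z : gf32) : (a + b) ^+ 3 * z =
  a ^+ 3 * z + b * (a ^+ 2 * z) + b ^+ 2 * (a ^+ 1 * z) + b ^+ 3 * z.
Proof. gfring. Qed.

Lemma pow5D_mul (a b z : gf32) : (a + b) ^+ 5 * z =
  a ^+ 5 * z + b * (a ^+ 4 * z) + b ^+ 4 * (a ^+ 1 * z) + b ^+ 5 * z.
Proof. gfring. Qed.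

Section OPoly.
Variable h : gf32 -> gf32.
Hypothesis oh : opoly h.

(** The arc condition separates the slopes with y <> s. At y = s the convention 0 / 0 = 0 supplies
    slope 0, the one that injectivity of [h] excludes elsewhere; so the slopes form a permutation of
    the field. *)
Lemma slope_inj s : injective (fun y => (h y + h s) / (y + s)).
Proof.
have [h0 hi ha] := oh; move=> x y /=.
have [->|xs] := eqVneq x s.
  have [-> //|ys] := eqVneq y s.
  rewrite !addff mul0r => /esym/eqP; rewrite mulf_eq0 invr_eq0 !addf_eq0 (negPf ys) orbF.
  by move/eqP/hi.
have [->|ys] := eqVneq y s.
  rewrite !addff mul0r => /eqP; rewrite mulf_eq0 invr_eq0 !addf_eq0 (negPf xs) orbF.
  by move/eqP/hi.
have [-> //|xy] := eqVneq x y.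
move/eqP; rewrite eqr_div ?addf_eq0 // => /eqP E.
by move: (ha x y s xy ys xs); rewrite E eqxx.
Qed.

(** A power sum over a permutation of the field vanishes for these j, and dividing by (y + s)^j
    amounts to multiplying by (y + s)^(31 - j). *)
Lemma slope_sum j s : (0 < j < 31)%N ->
  \sum_y (h y + h s) ^+ j * (y + s) ^+ (31 - j) = 0.
Proof.
case/andP=> j0 j31.
transitivity (\sum_y ((h y + h s) / (y + s)) ^+ j).
  apply: eq_bigr => y _; have [->|ys] := eqVneq y s.
    by rewrite !addff mul0r expr0n gtn_eqF // mul0r.
  rewrite exprMn; congr (_ * _).
  have ys0 : y + s != 0 by rewrite addf_eq0.
  apply: (mulIf (expf_neq0 j ys0)).
  by rewrite -exprD subnK ?(ltnW j31) // gf_expr31 // -exprMn mulVf // expr1n.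
by rewrite -[RHS](psum0 j31) [RHS](reindex_inj (@slope_inj s)).
Qed.

Definition mom k l : gf32 := \sum_x h x ^+ k * x ^+ l.

(** [r] is meant to list the l whose binomial coefficient with n is odd: by Lucas, the binary
    submasks of n. *)
Lemma gf_pow_add (r : seq nat) n :
  allg (fun x => allg (fun y =>
     feq ((x + y) ^+ n) (foldr (fun l s => fadd (x ^+ l * y ^+ (n - l)) s) g0 r))) ->
  forall x y : gf32, (x + y) ^+ n = \sum_(l <- r) x ^+ l * y ^+ (n - l).
Proof. by move=> /allgP H x y; move/allgP: (H x) => /(_ y)/feqP ->; rewrite unlock. Qed.

(** The submasks of 30 are the even numbers up to 30. In the slope sum of order 1 the coefficient of
    s^(30 - l) is [mom 1 l], since [h s] is multiplied by a power sum of exponent below 31. *)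
Lemma mom1_even i : (i < 16)%N -> mom 1 (2 * i) = 0.
Proof.
move=> i16.
pose r := [seq 2 * i | i <- iota 0 16]%N.
suff H e : e \in [seq 30 - l | l <- r]%N -> mom 1 (30 - e) = 0.
  have := H (30 - 2 * i)%N; rewrite subKn; last first.
    by rewrite -[30%N]/(2 * 15)%N leq_pmul2l.
  by apply; apply: map_f; apply: map_f; rewrite mem_iota.
apply: (@coef_ext _ (fun e => mom 1 (30 - e))) => // s.
rewrite big_map -[RHS](@slope_sum 1 s) //.
rewrite [RHS](eq_bigr (fun y => \sum_(l <- r) (h y + h s) * (y ^+ l * s ^+ (30 - l)))); last first.
  by move=> y _; rewrite expr1 (@gf_pow_add r 30) ?mulr_sumr //; vm_compute.
rewrite exchange_big big_seq [RHS]big_seq; apply: eq_bigr => l lr.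
have l30 : (l <= 30)%N by move: l lr; apply/allP.
under [RHS]eq_bigr do rewrite mulrA mulrDl.
by rewrite -mulr_suml big_split /= -mulr_sumr psum0 // mulr0 addr0 subKn.
Qed.

Lemma mom2E l : mom 2 (2 * l) = mom 1 l ^+ 2.
Proof.
by rewrite /mom sum_sqr; apply: eq_bigr => x _; rewrite expr1 exprMn -exprM mulnC.
Qed.

Lemma mom4E l : mom 4 (4 * l) = mom 1 l ^+ 4.
Proof.
by rewrite /mom sum_pow4; apply: eq_bigr => x _; rewrite expr1 exprMn -exprM mulnC.
Qed.

Lemma mom_add31 k l : (0 < l)%N -> mom k (l + 31) = mom k l.
Proof. by move=> l0; apply: eq_bigr => x _; rewrite gf_expr_add31. Qed.

(** The submasks of 28 are the multiples of 4. The cross terms of the cube involve [mom 1 l] and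
    [mom 2 l], the latter being the square of a vanishing first moment. *)
Lemma mom3_eq0 i : (i < 8)%N -> mom 3 (4 * i) = 0.
Proof.
move=> i8.
pose r := [seq 4 * i | i <- iota 0 8]%N.
suff H e : e \in [seq 28 - l | l <- r]%N -> mom 3 (28 - e) = 0.
  have := H (28 - 4 * i)%N; rewrite subKn; last first.
    by rewrite -[28%N]/(4 * 7)%N leq_pmul2l.
  by apply; apply: map_f; apply: map_f; rewrite mem_iota.
apply: (@coef_ext _ (fun e => mom 3 (28 - e))) => // s.
rewrite big_map -[RHS](@slope_sum 3 s) //.
rewrite [RHS](eq_bigr (fun y => \sum_(l <- r) (h y + h s) ^+ 3 * (y ^+ l * s ^+ (28 - l)))); last first.
  by move=> y _; rewrite (@gf_pow_add r 28) ?mulr_sumr //; vm_compute.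
rewrite exchange_big big_seq [RHS]big_seq; apply: eq_bigr => l lr.
have l28 : (l <= 28)%N by move: l lr; apply/allP.
under [RHS]eq_bigr do rewrite mulrA cubeD_mul.
rewrite -mulr_suml !big_split /= -!mulr_sumr psum0 ?mulr0 ?addr0; last first.
  exact: leq_ltn_trans l28 _.
rewrite subKn // -/(mom 3 l) -/(mom 2 l) -/(mom 1 l).
have /mapP[k] := lr; rewrite mem_iota /= add0n => k8 ->.
have -> : (4 * k = 2 * (2 * k))%N by rewrite mulnA.
rewrite mom2E !mom1_even ?expr0n ?mulr0 ?addr0 //.
  by rewrite -[16%N]/(2 * 8)%N ltn_pmul2l.
by apply: ltn_trans k8 _.
Qed.

(** The submasks of 26 = 31 - 5, in binary 11010. *)
Definition k5_exps := [:: 0; 2; 8; 10; 16; 18; 24; 26]%N.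

Lemma mom5_eq0 l : l \in k5_exps -> mom 5 l = 0.
Proof.
move=> lr0.
suff H e : e \in [seq 26 - l | l <- k5_exps]%N -> mom 5 (26 - e) = 0.
  have := H (26 - l)%N; rewrite subKn; last by move: l lr0; apply/allP.
  by apply; apply: map_f.
apply: (@coef_ext _ (fun e => mom 5 (26 - e))) => // s {l lr0}.
rewrite big_map -[RHS](@slope_sum 5 s) //.
rewrite [RHS](eq_bigr (fun y => \sum_(l <- k5_exps) (h y + h s) ^+ 5 * (y ^+ l * s ^+ (26 - l))));
  last by move=> y _; rewrite (@gf_pow_add k5_exps 26) ?mulr_sumr //; vm_compute.
rewrite exchange_big big_seq [RHS]big_seq; apply: eq_bigr => l lr.
have l26 : (l <= 26)%N by move: l lr; apply/allP.
under [RHS]eq_bigr do rewrite mulrA pow5D_mul.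
rewrite -mulr_suml !big_split /= -!mulr_sumr psum0 ?mulr0 ?addr0; last first.
  exact: leq_ltn_trans l26 _.
rewrite subKn // -/(mom 5 l) -/(mom 4 l) -/(mom 1 l).
have -> : mom 1 l = 0.
  move: lr; rewrite !inE => /or4P[||| /or4P[||| /orP[]]] /eqP->.
  - exact: (@mom1_even 0 isT).
  - exact: (@mom1_even 1 isT).
  - exact: (@mom1_even 4 isT).
  - exact: (@mom1_even 5 isT).
  - exact: (@mom1_even 8 isT).
  - exact: (@mom1_even 9 isT).
  - exact: (@mom1_even 12 isT).
  - exact: (@mom1_even 13 isT).
have -> : mom 4 l = 0; last by rewrite !mulr0 !addr0.
(* [mom 4] is a fourth power of a first moment only at multiples of 4; for l = 2 modulo 4, adding
   twice the period 31 reaches a multiple of 8. *)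
suff [i [i16 ->]] : exists i, (i < 16)%N /\ mom 4 l = mom 4 (4 * (2 * i)).
  by rewrite mom4E mom1_even // expr0n.
move: lr; rewrite !inE => /or4P[||| /or4P[||| /orP[]]] /eqP->.
- by exists 0%N.
- by exists 8%N; split; rewrite // -(@mom_add31 4 2) // -mom_add31.
- by exists 1%N.
- by exists 9%N; split; rewrite // -(@mom_add31 4 10) // -mom_add31.
- by exists 2%N.
- by exists 10%N; split; rewrite // -(@mom_add31 4 18) // -mom_add31.
- by exists 3%N.
- by exists 11%N; split; rewrite // -(@mom_add31 4 26) // -mom_add31.
Qed.

End OPoly.

(** The coefficient of x^(2u) for 0 < u < 16, extracted by the power sum of exponent 31. An
    o-polynomial has no terms of odd degree. *)
Definition bc (h : gf32 -> gf32) (u : nat) : gf32 := \sum_x h x * x ^+ (31 - 2 * u).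

Lemma bcE h u : bc h u = mom h 1 (31 - 2 * u).
Proof. by []. Qed.

Lemma eq_bc h g u : h =1 g -> bc h u = bc g u.
Proof. by move=> E; apply: eq_bigr => x _; rewrite E. Qed.

Lemma bcD h g u : bc (fun x => h x + g x) u = bc h u + bc g u.
Proof. by rewrite -big_split; apply: eq_bigr => x _; rewrite mulrDl. Qed.

Lemma indicator31 (x y : gf32) : 1 + (x + y) ^+ 31 = (x == y)%:R.
Proof.
have [->|xy] := eqVneq; first by rewrite addff expr0n addr0.
by rewrite gf_expr31 ?addf_eq0 // addff.
Qed.

(** Interpolation with the indicator 1 + (x + y)^31. Even powers of y drop out by [mom1_even]; y^31
    and the constant term both give the sum of all values, which is also 0. *)
Lemma opolyE h x : opoly h -> h x = \sum_(u <- iota 1 15) bc h u * x ^+ (2 * u).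
Proof.
move=> oh; have [h0 _ _] := oh.
have -> : h x = \sum_y h y * (1 + (y + x) ^+ 31).
  rewrite (bigD1 x) //= indicator31 eqxx mulr1 big1 ?addr0 // => y yx.
  by rewrite indicator31 (negPf yx) mulr0.
pose r1 := [seq 2 * i | i <- iota 0 16]%N; pose r2 := [seq 31 - 2 * u | u <- iota 1 15]%N.
under eq_bigr do rewrite mulrDr mulr1 (@gf_pow_add (31%N :: r1 ++ r2) 31) ?mulr_sumr //.
have E l : \sum_y h y * (y ^+ l * x ^+ (31 - l)) = mom h 1 l * x ^+ (31 - l).
  by rewrite /mom mulr_suml; apply: eq_bigr => y _; rewrite mulrA expr1.
have m0 : \sum_y h y = 0.
  by rewrite -[RHS](@mom1_even h oh 0) //; apply: eq_bigr => y _; rewrite expr1 mulr1.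
have m31 : mom h 1 31 = 0.
  rewrite -[RHS]m0; apply: eq_bigr => y _; rewrite expr1.
  by have [->|y0] := eqVneq y 0; rewrite ?h0 ?mul0r // gf_expr31 ?mulr1.
have ev : \sum_(l <- r1) mom h 1 l * x ^+ (31 - l) = 0.
  rewrite big_map big_seq big1 // => i; rewrite mem_iota => /andP[_ i16].
  by rewrite mom1_even ?mul0r.
rewrite big_split exchange_big (eq_bigr _ (fun l _ => E l)) big_cons big_cat ev m0 m31.
rewrite /= mul0r !add0r big_map big_seq [RHS]big_seq; apply: eq_bigr => u ur.
have u15 : (u <= 15)%N by move: u ur; apply/allP.
rewrite -bcE subKn //.
by rewrite -[31%N]/(2 * 15).+1; apply: leqW; rewrite leq_pmul2l.
Qed.

Lemma pair_sum (F : nat -> nat -> gf32) (c : nat -> nat -> bool) (L : seq (nat * nat)) :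
  perm_eq [seq p <- [seq (u, v) | u <- iota 1 15, v <- iota 1 15] | c p.1 p.2] L ->
  \sum_(u <- iota 1 15) \sum_(v <- iota 1 15) F u v * (c u v)%:R = \sum_(p <- L) F p.1 p.2.
Proof.
move=> /(perm_big _) <-; rewrite big_filter [RHS]big_mkcond [RHS]big_allpairs_dep /=.
apply: eq_bigr => u _; apply: eq_bigr => v _.
by case: (c u v); rewrite ?mulr1 ?mulr0.
Qed.

(** Meant for k = m + 1 with m = 2 or 4, where the hypothesis is additivity of the m-th power.
    Summing over x keeps the pairs whose total exponent is a positive multiple of 31. *)
Lemma mom_pair h k m l : opoly h ->
    (forall x, h x ^+ k = (\sum_(u <- iota 1 15) bc h u ^+ m * x ^+ (2 * m * u)) * h x) ->
  mom h k l = \sum_(u <- iota 1 15) \sum_(v <- iota 1 15)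
     (bc h u ^+ m * bc h v) * ((0 < 2 * m * u + 2 * v + l) && (31 %| 2 * m * u + 2 * v + l))%N%:R.
Proof.
move=> oh Hk; rewrite /mom.
under eq_bigr => x _.
  rewrite Hk (opolyE x oh) -mulrA mulr_suml.
  under eq_bigr do rewrite mulr_suml mulr_sumr.
  over.
rewrite exchange_big; apply: eq_bigr => u _; rewrite exchange_big; apply: eq_bigr => v _.
rewrite -psum mulr_sumr; apply: eq_bigr => x _.
rewrite !exprD; move: (bc h u ^+ m) (bc h v) (x ^+ (2 * m * u)) (x ^+ (2 * v)) (x ^+ l).
by move=> a b c d e; gfring.
Qed.

(** Take the third moment at 4(15 - t). Total exponent 62 means 2u + v = 2t + 1; total exponent 124
    would need 2u + v = 2t + 32, at least 48, whereas 2u + v is at most 45. *)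
Lemma k3_sq h t : opoly h -> (8 <= t <= 15)%N ->
  \sum_(j <- iota 0 8) bc h (t - j) ^+ 2 * bc h (2 * j + 1) = 0.
Proof.
move=> oh t815; have i8 : (15 - t < 8)%N.
  by rewrite ltnS leq_subLR -[15%N]/(8 + 7)%N leq_add2r; case/andP: t815.
have := @mom3_eq0 h oh (15 - t) i8.
rewrite (@mom_pair h 3 2) // => [|x].
  rewrite (@pair_sum _ _ [seq (t - j, 2 * j + 1)%N | j <- iota 0 8]) ?big_map //.
  by move: t t815 {i8}; apply: (@all_iotaP _ 8 8); vm_compute.
rewrite exprSr; congr (_ * _); rewrite {1}(opolyE x oh) sum_sqr; apply: eq_bigr => u _.
by rewrite exprMn -exprM mulnAC.
Qed.

(** Fifth moments at 26, 18, 10, 2. The two kinds of products come from the total exponents 62,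
    where 4u + v = 4n + 2, and 124, where 4u + v = 4n + 33. *)
Lemma k5a h n : opoly h -> (4 <= n <= 7)%N ->
  \sum_(i <- iota 0 4) (bc h (n - i) ^+ 4 * bc h (4 * i + 2)
                      + bc h (n + 8 - i) ^+ 4 * bc h (4 * i + 1)) = 0.
Proof.
move=> oh n47.
have : mom h 5 (58 - 8 * n) = 0.
  by apply: mom5_eq0 => //; move: n n47; apply: (@all_iotaP _ 4 4); vm_compute.
rewrite (@mom_pair h 5 4) // => [|x].
  rewrite (@pair_sum _ _ ([seq (n - i, 4 * i + 2)%N | i <- iota 0 4] ++
                          [seq (n + 8 - i, 4 * i + 1)%N | i <- iota 0 4])).
    by rewrite big_split big_cat !big_map.
  by move: n n47; apply: (@all_iotaP _ 4 4); vm_compute.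
rewrite exprSr; congr (_ * _); rewrite {1}(opolyE x oh) sum_pow4; apply: eq_bigr => u _.
by rewrite exprMn -exprM mulnAC.
Qed.

(** Fifth moments at 24, 16, 8, 0, where 4u + v is 4n + 3 or 4n + 34. *)
Lemma k5b h n : opoly h -> (4 <= n <= 7)%N ->
  \sum_(i <- iota 0 4) (bc h (n - i) ^+ 4 * bc h (4 * i + 3)
                      + bc h (n + 8 - i) ^+ 4 * bc h (4 * i + 2)) = 0.
Proof.
move=> oh n47.
have : mom h 5 (56 - 8 * n) = 0.
  by apply: mom5_eq0 => //; move: n n47; apply: (@all_iotaP _ 4 4); vm_compute.
rewrite (@mom_pair h 5 4) // => [|x].
  rewrite (@pair_sum _ _ ([seq (n - i, 4 * i + 3)%N | i <- iota 0 4] ++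
                          [seq (n + 8 - i, 4 * i + 2)%N | i <- iota 0 4])).
    by rewrite big_split big_cat !big_map.
  by move: n n47; apply: (@all_iotaP _ 4 4); vm_compute.
rewrite exprSr; congr (_ * _); rewrite {1}(opolyE x oh) sum_pow4; apply: eq_bigr => u _.
by rewrite exprMn -exprM mulnAC.
Qed.

Lemma sqr_inj : injective (fun x : gf32 => x ^+ 2).
Proof. by move=> x y /=; rewrite -!fsqE => /(can_inj fsqK). Qed.

(** The square root of [k3_sq], taken so that for known roots of the odd-indexed coefficients the
    identity becomes linear in the others. *)
Lemma k3 h t : opoly h -> (8 <= t <= 15)%N ->
  \sum_(j <- iota 0 8) froot (bc h (2 * j + 1)) * bc h (t - j) = 0.
Proof.
move=> oh t815; apply: sqr_inj; rewrite /= sum_sqr expr0n -[RHS](k3_sq oh t815).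
by apply: eq_bigr => j _; rewrite exprMn froot_sq mulrC.
Qed.

(** * The moves on o-polynomials and their effect on coefficients *)

Definition det3 (h : gf32 -> gf32) x y z := h x * (y + z) + h y * (x + z) + h z * (x + y).

Lemma arcfunE h x y z :
  ((h x + h z) * (y + z) == (h y + h z) * (x + z)) = (det3 h x y z == 0).
Proof.
rewrite -addf_eq0; congr (_ == _).
by rewrite /det3; move: (h x) (h y) (h z) => a b c; gfring.
Qed.

Lemma arcfunP h : arcfun h <->
  (forall x y z, x != y -> y != z -> x != z -> det3 h x y z != 0).
Proof.
by split=> H x y z xy yz xz; move: (H x y z xy yz xz); rewrite arcfunE.
Qed.

Lemma det3_0 (h : gf32 -> gf32) a b : h 0 = 0 -> det3 h a b 0 = h a * b + h b * a.
Proof. by rewrite /det3 => ->; move: (h a) (h b) => c d; gfring. Qed.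

Definition T1 e (h : gf32 -> gf32) x := h (x + e) + h e.
Definition T2 a b (h : gf32 -> gf32) x := a * h (b * x).
(** Exchange of the first two coordinates: (x : 1 : h x) is (1 : 1/x : h x / x). As 0^-1 = 0, the
    value at 0 is 0, in accordance with the exchange of (1 : 0 : 0) and (0 : 1 : 0). *)
Definition T3 (h : gf32 -> gf32) x := x * h x^-1.
Definition T4 (h : gf32 -> gf32) x := h (froot x) ^+ 2.

Lemma opoly_T1 e h : opoly h -> opoly (T1 e h).
Proof.
move=> [h0 hi /arcfunP ha]; split; first by rewrite /T1 add0r addff.
  by move=> x y /addIr/hi/addIr.
apply/arcfunP => x y z xy yz xz.
have := ha (x + e) (y + e) (z + e); rewrite !(inj_eq (addIr e)) => /(_ xy yz xz).
congr (_ != 0); rewrite /det3 /T1.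
by move: (h (x + e)) (h (y + e)) (h (z + e)) (h e) => a b c d; gfring.
Qed.

Lemma opoly_T2 a b h : a != 0 -> b != 0 -> opoly h -> opoly (T2 a b h).
Proof.
move=> a0 b0 [h0 hi /arcfunP ha]; split; first by rewrite /T2 mulr0 h0 mulr0.
  by move=> x y /(mulfI a0)/hi/(mulfI b0).
apply/arcfunP => x y z xy yz xz.
have := ha (b * x) (b * y) (b * z); rewrite !(inj_eq (mulfI b0)) => /(_ xy yz xz).
apply: contra => /eqP E; rewrite -(mulrI_eq0 _ (mulfI a0)) -[X in _ == X](mulr0 b) -E.
apply/eqP; rewrite /det3 /T2.
by move: (h (b * x)) (h (b * y)) (h (b * z)) => u v w; gfring.
Qed.

Lemma opoly_T3 h : opoly h -> opoly (T3 h).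
Proof.
move=> [h0 hi /arcfunP ha].
have hn0 x : (h x == 0) = (x == 0) by apply/eqP/eqP => [E|->//]; apply: hi; rewrite E h0.
have ti (x y : gf32) : x != 0 -> y != 0 -> x != y -> x * h x^-1 != y * h y^-1.
  move=> x0 y0 xy; have := ha x^-1 y^-1 0.
  rewrite (inj_eq invr_inj) !invr_eq0 x0 y0 => /(_ xy isT isT).
  apply: contra => /eqP E; rewrite det3_0 // addf_eq0; apply/eqP.
  apply: (mulfI (mulf_neq0 x0 y0)); move: E (mulfV x0) (mulfV y0).
  move: x^-1 y^-1 (h x^-1) (h y^-1) => x' y' a b E ex ey.
  transitivity (x * a * (y * y')); first by gfring.
  transitivity (y * b * (x * x')); last by gfring.
  by rewrite E ey ex.
split; first by rewrite /T3 mul0r.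
  move=> x y; rewrite /T3.
  have [->|x0] := eqVneq x 0; have [->|y0] := eqVneq y 0 => //.
  - by rewrite mul0r => /esym/eqP; rewrite mulf_eq0 hn0 invr_eq0 orbb (negPf y0).
  - by rewrite mul0r => /eqP; rewrite mulf_eq0 hn0 invr_eq0 orbb (negPf x0).
  - by have [-> //|xy] := eqVneq x y => E; have := ti x y x0 y0 xy; rewrite E eqxx.
have t0 (x y : gf32) : x != 0 -> y != 0 -> x != y -> T3 h x * y + T3 h y * x != 0.
  move=> x0 y0 xy; rewrite /T3 addf_eq0 mulrAC [y * _ * x]mulrAC [y * x]mulrC.
  by rewrite (inj_eq (mulfI (mulf_neq0 x0 y0))) (inj_eq hi) (inj_eq invr_inj).
have T0 : T3 h 0 = 0 by rewrite /T3 mul0r.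
apply/arcfunP => x y z; rewrite /det3.
have [->|x0] := eqVneq x 0.
  rewrite eq_sym => y0 yz; rewrite eq_sym => z0.
  by rewrite T0 mul0r !add0r t0.
have [->|y0] := eqVneq y 0.
  by move=> _; rewrite eq_sym => z0 xz; rewrite T0 mul0r add0r !addr0 t0.
have [->|z0] := eqVneq z 0.
  by move=> xy _ _; rewrite T0 mul0r !addr0 t0.
move=> xy yz xz; have := ha x^-1 y^-1 z^-1.
rewrite !(inj_eq invr_inj) => /(_ xy yz xz).
apply: contra => /eqP E; apply/eqP.
have xyz : x * y * z != 0 by rewrite !mulf_neq0.
apply: (mulfI xyz); rewrite mulr0 -E /det3 /T3.
move: (h x^-1) (h y^-1) (h z^-1) => a b c.
move: (mulfV x0) (mulfV y0) (mulfV z0).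
move: x^-1 y^-1 z^-1 => x' y' z' ex ey ez.
transitivity (a * x * (z * (y * y') + y * (z * z')) + b * y * (z * (x * x') + x * (z * z'))
  + c * z * (y * (x * x') + x * (y * y'))); first by gfring.
by rewrite ex ey ez; gfring.
Qed.

Lemma sqr_froot (x : gf32) : froot (x ^+ 2) = x.
Proof. by rewrite -fsqE fsqK. Qed.

Lemma frootD : {morph froot : x y / x + y}.
Proof. by move=> x y; apply: sqr_inj; rewrite /= sqrD2 !froot_sq. Qed.

Lemma frootM : {morph froot : x y / x * y}.
Proof. by move=> x y; apply: sqr_inj; rewrite /= exprMn !froot_sq. Qed.

Lemma froot_inj : injective froot.
Proof. exact: can_inj frootK. Qed.

Lemma froot_eq0 x : (froot x == 0) = (x == 0).
Proof. by rewrite -[RHS](inj_eq froot_inj). Qed.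

Lemma opoly_T4 h : opoly h -> opoly (T4 h).
Proof.
move=> [h0 hi /arcfunP ha]; split; first by rewrite /T4 h0 expr0n.
  by move=> x y /sqr_inj/hi/froot_inj.
apply/arcfunP => x y z xy yz xz.
have := ha (froot x) (froot y) (froot z); rewrite !(inj_eq froot_inj) => /(_ xy yz xz).
rewrite -(inj_eq sqr_inj) /= expr0n; congr (_ != 0).
by rewrite /det3 /T4 !sqrD2 !exprMn !sqrD2 !froot_sq.
Qed.

(** A directed relation, in which [g] is reached from [h] by successive moves: normalisation only
    goes forward. Where moves have to be undone, as in [tequiv_mono], explicit inverses are used. *)
Inductive tequiv : (gf32 -> gf32) -> (gf32 -> gf32) -> Prop :=
| tequiv_eq h g of h =1 g : tequiv h g
| tequiv_T1 e h g of tequiv (T1 e h) g : tequiv h g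
| tequiv_T2 a b h g of a != 0 & b != 0 & tequiv (T2 a b h) g : tequiv h g
| tequiv_T3 h g of tequiv (T3 h) g : tequiv h g
| tequiv_T4 h g of tequiv (T4 h) g : tequiv h g.

Lemma eq_tequiv h h' g : h =1 h' -> tequiv h' g -> tequiv h g.
Proof.
move=> E H; elim: H h E => {h' g} [h' g E' h E|e h' g _ IH h E|a b h' g a0 b0 _ IH h E
  |h' g _ IH h E|h' g _ IH h E].
- by apply: tequiv_eq => x; rewrite E E'.
- by apply: (@tequiv_T1 e); apply: IH => x; rewrite /T1 !E.
- by apply: (tequiv_T2 a0 b0); apply: IH => x; rewrite /T2 !E.
- by apply: tequiv_T3; apply: IH => x; rewrite /T3 !E.
- by apply: tequiv_T4; apply: IH => x; rewrite /T4 !E.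
Qed.

Lemma tequiv_trans g h k : tequiv h g -> tequiv g k -> tequiv h k.
Proof.
move=> H; elim: H k => {h g} [h g E k|e h g _ IH k|a b h g a0 b0 _ IH k
  |h g _ IH k|h g _ IH k] Hk.
- exact: eq_tequiv E Hk.
- exact/tequiv_T1/IH.
- exact/(tequiv_T2 a0 b0)/IH.
- exact/tequiv_T3/IH.
- exact/tequiv_T4/IH.
Qed.

Lemma tequiv_opoly h g : tequiv h g -> opoly h -> opoly g.
Proof.
elim=> {h g} [h g E|e h g _ IH|a b h g a0 b0 _ IH|h g _ IH|h g _ IH] oh.
- exact: eq_opoly E oh.
- exact/IH/opoly_T1.
- exact/IH/opoly_T2.
- exact/IH/opoly_T3.
- exact/IH/opoly_T4.
Qed.

Lemma bc_T2 a b h u : b != 0 -> (u < 16)%N -> bc (T2 a b h) u = a * b ^+ (2 * u) * bc h u.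
Proof.
move=> b0 u16; rewrite /bc [in RHS](reindex_inj (mulfI b0)) mulr_sumr.
apply: eq_bigr => x _; rewrite /T2 exprMn [X in _ = X](_ : _ =
  b ^+ (2 * u) * b ^+ (31 - 2 * u) * (a * h (b * x) * x ^+ (31 - 2 * u))).
  rewrite -exprD subnKC ?gf_expr31 ?mul1r //.
  by rewrite -[31%N]/(2 * 15).+1; apply: leqW; rewrite leq_pmul2l.
by move: (b ^+ _) (b ^+ _) (h _) (x ^+ _) => p q r s; gfring.
Qed.

Lemma bc_T3 h u : h 0 = 0 -> (1 <= u <= 15)%N -> bc (T3 h) u = bc h (16 - u).
Proof.
move=> h0 /andP[u1 u15]; rewrite /bc (reindex_inj invr_inj).
apply: eq_bigr => x _; rewrite /T3 invrK.
have [->|x0] := eqVneq x 0; first by rewrite h0 invr0 !mul0r.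
rewrite mulrAC mulrC -exprS; congr (_ * _); rewrite exprVn.
have xn0 n : x ^+ n != 0 by rewrite expf_neq0.
apply: (mulfI (xn0 (31 - 2 * u).+1)); rewrite mulfV // -exprD.
rewrite (_ : (31 - 2 * u).+1 + _ = 31)%N ?gf_expr31 // mulnBr.
by move: u u1 u15; do 16?case=> //.
Qed.

Lemma bc_T4 h u : bc (T4 h) u = bc h u ^+ 2.
Proof.
rewrite /bc sum_sqr (reindex_inj sqr_inj); apply: eq_bigr => x _.
by rewrite /T4 /= sqr_froot [RHS]exprMn -!exprM mulnC.
Qed.

Lemma bc_T1 e h u (r : seq nat) : (0 < u)%N ->
    (forall x y : gf32, (x + y) ^+ (31 - 2 * u) = \sum_(l <- r) x ^+ l * y ^+ (31 - 2 * u - l)) ->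
  bc (T1 e h) u = \sum_(l <- r) mom h 1 l * e ^+ (31 - 2 * u - l).
Proof.
move=> u0 Hr; rewrite /bc.
transitivity (\sum_y h y * (y + e) ^+ (31 - 2 * u)).
  rewrite [RHS](reindex_inj (addIr e)).
  under [LHS]eq_bigr do rewrite /T1 mulrDl.
  rewrite big_split /= -mulr_sumr psum0 ?mulr0 ?addr0; last first.
    by rewrite ltn_subrL muln_gt0 u0.
  by apply: eq_bigr => x _; rewrite -addrA addff addr0.
under eq_bigr do rewrite Hr mulr_sumr.
rewrite exchange_big; apply: eq_bigr => l _; rewrite /mom mulr_suml.
by apply: eq_bigr => x _; rewrite mulrA.
Qed.

Lemma bc_T1_15 e h : opoly h -> bc (T1 e h) 15 = bc h 15.
Proof.
move=> oh; rewrite (@bc_T1 _ _ _ [:: 0; 1]%N) //; last by apply: gf_pow_add; vm_compute.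
by rewrite !big_cons big_nil (@mom1_even h oh 0) // mul0r add0r mulr1 addr0.
Qed.

Lemma bc_T1_13 e h : opoly h -> bc (T1 e h) 13 = bc h 13 + e ^+ 4 * bc h 15.
Proof.
move=> oh; rewrite (@bc_T1 _ _ _ [:: 0; 4; 1; 5]%N) //; last by apply: gf_pow_add; vm_compute.
rewrite !big_cons big_nil (@mom1_even h oh 0) // (@mom1_even h oh 2) // !mul0r !add0r.
by rewrite mulr1 addr0 addrC [_ * e ^+ _]mulrC.
Qed.

(** The submasks of 29 are the multiples of 4 up to 28, which give vanishing even moments, and the
    numbers 29 - 4j, whose moments are the coefficients of index 2j + 1. *)
Lemma bc_T1_1 e h : opoly h ->
  bc (T1 e h) 1 = \sum_(j <- iota 0 8) bc h (2 * j + 1) * e ^+ (4 * j).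
Proof.
move=> oh; pose r := ([seq 4 * i | i <- iota 0 8] ++ [seq 29 - 4 * j | j <- iota 0 8])%N.
rewrite (@bc_T1 _ _ _ r) //; last by apply: gf_pow_add; vm_compute.
rewrite big_cat !big_map /= big_seq big1 ?add0r => [|i].
  rewrite big_seq [RHS]big_seq; apply: eq_bigr => j jr.
  have j8 : (j < 8)%N by move: j jr; apply/allP.
  by move: j j8 {jr}; do 8?case=> //.
move=> ir; have i8 : (i < 8)%N by move: i ir; apply/allP.
have -> : (4 * i = 2 * (2 * i))%N by rewrite mulnA.
by rewrite (@mom1_even h oh) ?mul0r // -[16%N]/(2 * 8)%N ltn_pmul2l.
Qed.

(** * Search for o-polynomials *)

(** Entry u, counted from 1, is the coefficient of x^(2u). The first 32 lists have coefficient 1 at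
    x^30 and 0 at x^26; the last three are x^4, x^8, x^16. Since the nucleus is marked, one
    hyperoval can give several classes: x^16 is a conic, and x^30 a conic with one point replaced by
    its nucleus. *)
Definition oval_coefs : seq (seq gf32) := [::
 [:: g0;g0;g0;g0;g0;g0;g0;g0;g0;g0;g0;g0;g0;g0;g1];
 [:: g1;g1;g1;g1;g1;g1;g0;g1;g1;g0;g0;g0;g0;g0;g1];
 [:: g1;g0;g0;g0;g1;g0;g0;g1;g0;g1;g0;g0;g0;g0;g1];
 [:: g0;g1;g0;g1;g1;g1;g1;g0;g0;g0;g1;g0;g0;g0;g1];
 [:: g0;g0;g1;g1;g1;g1;g1;g1;g0;g1;g1;g0;g0;g0;g1];
 [:: g14;g13;g14;g1;g23;g6;g25;g16;g22;g7;g1;g0;g0;g0;g1];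
 [:: g0;g0;g0;g0;g0;g0;g0;g0;g0;g0;g1;g1;g0;g0;g1];
 [:: g0;g0;g1;g1;g0;g0;g1;g1;g0;g0;g1;g1;g0;g0;g1];
 [:: g30;g30;g23;g12;g6;g29;g0;g22;g13;g8;g1;g1;g0;g0;g1];
 [:: g23;g29;g27;g0;g6;g4;g0;g9;g13;g5;g1;g2;g0;g0;g1];
 [:: g10;g1;g7;g10;g17;g29;g6;g9;g30;g1;g1;g3;g0;g0;g1];
 [:: g22;g26;g18;g25;g0;g22;g15;g19;g2;g8;g1;g3;g0;g0;g1];
 [:: g1;g29;g11;g23;g25;g18;g6;g31;g4;g0;g1;g6;g0;g0;g1];
 [:: g24;g30;g9;g2;g20;g15;g22;g23;g23;g24;g1;g6;g0;g0;g1];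
 [:: g13;g17;g29;g6;g11;g14;g6;g3;g25;g25;g1;g6;g0;g0;g1];
 [:: g23;g13;g15;g22;g18;g10;g0;g17;g24;g26;g1;g6;g0;g0;g1];
 [:: g11;g9;g13;g9;g24;g10;g22;g24;g14;g31;g1;g6;g0;g0;g1];
 [:: g6;g31;g5;g3;g10;g25;g22;g0;g1;g11;g0;g7;g0;g0;g1];
 [:: g14;g24;g15;g11;g9;g21;g22;g10;g18;g6;g1;g7;g0;g0;g1];
 [:: g6;g8;g31;g28;g16;g30;g7;g3;g25;g14;g1;g7;g0;g0;g1];
 [:: g10;g14;g26;g31;g23;g13;g3;g17;g26;g25;g1;g7;g0;g0;g1];
 [:: g18;g6;g8;g27;g24;g14;g2;g16;g18;g27;g1;g7;g0;g0;g1];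
 [:: g9;g11;g31;g31;g3;g21;g16;g5;g0;g22;g1;g9;g0;g0;g1];
 [:: g0;g1;g1;g1;g1;g0;g1;g0;g0;g1;g0;g1;g0;g1;g1];
 [:: g0;g1;g1;g0;g1;g1;g0;g0;g1;g0;g1;g1;g0;g1;g1];
 [:: g0;g1;g0;g1;g0;g1;g0;g1;g0;g1;g1;g1;g0;g1;g1];
 [:: g9;g25;g6;g30;g12;g17;g29;g13;g8;g24;g1;g2;g0;g1;g1];
 [:: g21;g21;g0;g5;g13;g20;g22;g24;g1;g1;g1;g2;g0;g2;g1];
 [:: g17;g23;g29;g3;g23;g18;g23;g9;g1;g29;g1;g2;g0;g2;g1];
 [:: g2;g11;g27;g21;g26;g16;g21;g25;g30;g31;g1;g3;g0;g2;g1];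
 [:: g28;g9;g20;g24;g17;g11;g15;g5;g9;g10;g1;g10;g0;g2;g1];
 [:: g12;g4;g27;g28;g8;g5;g10;g18;g12;g10;g1;g14;g0;g8;g1];
 [:: g0;g1;g0;g0;g0;g0;g0;g0;g0;g0;g0;g0;g0;g0;g0];
 [:: g0;g0;g0;g1;g0;g0;g0;g0;g0;g0;g0;g0;g0;g0;g0];
 [:: g0;g0;g0;g0;g0;g0;g0;g1;g0;g0;g0;g0;g0;g0;g0]].

(** Tabulation: under call by value the 32 values are computed once, when [memo h] itself is
    evaluated. *)
Definition memo (h : gf32 -> gf32) : gf32 -> gf32 :=
let v0 := h g0 in let v1 := h g1 in let v2 := h g2 in let v3 := h g3 in let v4 := h g4 in
let v5 := h g5 in let v6 := h g6 in let v7 := h g7 in let v8 := h g8 in let v9 := h g9 in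
let v10 := h g10 in let v11 := h g11 in let v12 := h g12 in let v13 := h g13 in let v14 := h g14 in
let v15 := h g15 in let v16 := h g16 in let v17 := h g17 in let v18 := h g18 in let v19 := h g19 in
let v20 := h g20 in let v21 := h g21 in let v22 := h g22 in let v23 := h g23 in let v24 := h g24 in
let v25 := h g25 in let v26 := h g26 in let v27 := h g27 in let v28 := h g28 in let v29 := h g29 in
let v30 := h g30 in let v31 := h g31 in
fun x => match x with
|g0=>v0 |g1=>v1 |g2=>v2 |g3=>v3 |g4=>v4 |g5=>v5 |g6=>v6 |g7=>v7 |g8=>v8 |g9=>v9 |g10=>v10 |g11=>v11
|g12=>v12 |g13=>v13 |g14=>v14 |g15=>v15 |g16=>v16 |g17=>v17 |g18=>v18 |g19=>v19 |g20=>v20 |g21=>v21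
|g22=>v22 |g23=>v23 |g24=>v24 |g25=>v25 |g26=>v26 |g27=>v27 |g28=>v28 |g29=>v29 |g30=>v30 |g31=>v31
end.

Definition hpoly (bs : seq gf32) (x : gf32) : gf32 :=
  let y := fsq x in foldr (fun b s => fmul y (fadd b s)) g0 bs.

Definition fdet (h : gf32 -> gf32) x y z :=
  fadd (fmul (h x) (fadd y z)) (fadd (fmul (h y) (fadd x z)) (fmul (h z) (fadd x y))).

Definition opolyb (h : gf32 -> gf32) : bool :=
  if fzero (h g0) then
    allg (fun x => allg (fun y => if feq x y then true else
      if feq (h x) (h y) then false else
      allg (fun z => if feq x z then true else if feq y z then true else
        if fzero (fdet h x y z) then false else true)))
  else false.

Definition fpow4 x := fsq (fsq x).
(** These are exponents 31 - 2u for odd u, from 5 for u = 13 down to 29 for u = 1, so that [fmom]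
    yields coefficients. The square root is the power 16. *)
Definition fpow5 x := fmul (fpow4 x) x.
Definition fpow9 x := fmul (fsq (fpow4 x)) x.
Definition fpow13 x := fmul (fpow9 x) (fpow4 x).
Definition fpow17 x := fmul (froot x) x.
Definition fpow21 x := fmul (fpow17 x) (fpow4 x).
Definition fpow25 x := fmul (fpow17 x) (fsq (fpow4 x)).
Definition fpow29 x := fmul (fpow25 x) (fpow4 x).

Definition fsum (F : gf32 -> gf32) : gf32 := foldr (fun x s => fadd (F x) s) g0 gf_enum.
Definition fmom (p : gf32 -> gf32) (h : gf32 -> gf32) := fsum (fun x => fmul (h x) (p x)).

Definition fexp (x : gf32) (n : nat) : gf32 := iter n (fmul x) g1.

Definition same (h g : gf32 -> gf32) : bool := allg (fun x => feq (h x) (g x)).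

(* The scale factor making the next nonzero coefficient 1: the exponents invert 4j modulo 31. *)
Definition fscale (d : gf32) (g : gf32 -> gf32) : gf32 :=
  let q p := fmul (fmom p g) d in
  let b := q fpow9 in if fzero b then
  let b := q fpow13 in if fzero b then
  let b := q fpow17 in if fzero b then
  let b := q fpow21 in if fzero b then
  let b := q fpow25 in if fzero b then
  let b := q fpow29 in if fzero b then g1
  else fexp b 10 else fexp b 22 else fexp b 14 else fexp b 2 else fexp b 13 else fexp b 4.

Definition matches (tabs : seq (gf32 -> gf32)) (g : gf32 -> gf32) : bool :=
  hasf (same g) tabs.

(** Coefficient 1 at x^30 and 0 at x^26 determine [e] and tie the outer factor to b: with the factor
    d b, coefficient u is multiplied by d b^(2u + 1), and b^31 = 1. The local [g1] is the translated
    function and hides the field element of that name. *)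
Definition try_norm (tabs : seq (gf32 -> gf32)) (g : gf32 -> gf32) : bool :=
  let d := finv (fmom id g) in
  if fzero d then false else
  let e := froot (froot (fmul (fmom fpow5 g) d)) in
  let g1 := memo (T1 e g) in
  let b := fscale d g1 in
  if fzero b then false else
  matches tabs (T2 (fmul d b) b g1).

(** Lets each of the 33 points of the oval take the place of (0 : 1 : 0): [T1 e] followed by [T3]
    brings the point of abscissa e there. *)
Definition try_points (f : (gf32 -> gf32) -> bool) (h : gf32 -> gf32) : bool :=
  if f h then true else hasf (fun e => f (memo (T3 (memo (T1 e h))))) gf_enum.

Fixpoint try_frob (f : (gf32 -> gf32) -> bool) (n : nat) (h : gf32 -> gf32) : bool :=
  if f h then true else if n is n'.+1 then try_frob f n' (memo (T4 h)) else false.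

Definition try_scale (tabs : seq (gf32 -> gf32)) (g : gf32 -> gf32) : bool :=
  let d := finv (g g1) in if fzero d then false else matches tabs (T2 d g1 g).

Definition oval_tabs : seq (gf32 -> gf32) := [seq memo (hpoly c) | c <- oval_coefs].

Inductive eqn3 := Eqn3 of gf32 & gf32 & gf32 & gf32.
Inductive eqn2 := Eqn2 of gf32 & gf32 & gf32.
Inductive eqn1 := Eqn1 of gf32 & gf32.

Fixpoint pick (T : Type) (f : T -> gf32) (es : seq T) : option (T * seq T) :=
  if es is e :: es' then
    if fzero (f e) then
      if pick f es' is Some (e', es'') then Some (e', e :: es'') else None
    else Some (e, es')
  else None.

(** In continuation style: [k] is tested on every solution, and an inconsistent system counts as
    success. The larger systems eliminate by cross-multiplication with the pivot. *)
Definition solve1 (es : seq eqn1) (k : gf32 -> bool) : bool :=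
  match pick (fun '(Eqn1 c _) => c) es with
  | Some (Eqn1 c r, es') =>
      let z := fmul r (finv c) in
      if allf (fun '(Eqn1 c r) => feq (fmul c z) r) es' then k z else true
  | None => if allf (fun '(Eqn1 _ r) => fzero r) es then allg k else true
  end.

Definition solve2 (es : seq eqn2) (k : gf32 -> gf32 -> bool) : bool :=
  match pick (fun '(Eqn2 b _ _) => b) es with
  | Some (Eqn2 b c r, es') =>
      solve1 [seq (let '(Eqn2 b' c' r') := e in
                   Eqn1 (fadd (fmul b c') (fmul b' c)) (fadd (fmul b r') (fmul b' r))) | e <- es']
        (fun z => k (fmul (fadd r (fmul c z)) (finv b)) z)
  | None => let es1 := [seq (let '(Eqn2 _ c r) := e in Eqn1 c r) | e <- es] in
            allg (fun y => solve1 es1 (k y))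
  end.

Definition solve3 (es : seq eqn3) (k : gf32 -> gf32 -> gf32 -> bool) : bool :=
  match pick (fun '(Eqn3 a _ _ _) => a) es with
  | Some (Eqn3 a b c r, es') =>
      solve2 [seq (let '(Eqn3 a' b' c' r') := e in
                   Eqn2 (fadd (fmul a b') (fmul a' b)) (fadd (fmul a c') (fmul a' c))
                        (fadd (fmul a r') (fmul a' r))) | e <- es']
        (fun y z => k (fmul (fadd r (fadd (fmul b y) (fmul c z))) (finv a)) y z)
  | None => let es2 := [seq (let '(Eqn3 _ b c r) := e in Eqn2 b c r) | e <- es] in
            allg (fun x => solve2 es2 (k x))
  end.

Definition f4mul a b := fmul (fpow4 a) b.

(** The identities [k5a] and [k5b] for n = 4, 5, 6, with coefficient 1 equal to 1 and coefficient 3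
    equal to 0. *)
Definition k5test b2 b4 b5 b6 b7 b9 b10 b11 b12 b13 b14 b15 : bool :=
  if fzero (fadd (f4mul b4 b2) (fadd (f4mul b2 b10) (fadd b14 (fadd (fpow4 b12)
       (fadd (f4mul b11 b5) (fadd (f4mul b10 b9) (f4mul b9 b13))))))) then
  if fzero (fadd (f4mul b2 b11) (fadd b15 (fadd (f4mul b12 b2)
       (fadd (f4mul b11 b6) (fadd (f4mul b10 b10) (f4mul b9 b14)))))) then
  if fzero (fadd (f4mul b5 b2) (fadd (f4mul b4 b6) (fadd (f4mul b2 b14) (fadd (fpow4 b13)
       (fadd (f4mul b12 b5) (fadd (f4mul b11 b9) (f4mul b10 b13))))))) then
  if fzero (fadd (f4mul b4 b7) (fadd (f4mul b2 b15) (fadd (f4mul b13 b2)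
       (fadd (f4mul b12 b6) (fadd (f4mul b11 b10) (f4mul b10 b14)))))) then
  if fzero (fadd (f4mul b6 b2) (fadd (f4mul b5 b6) (fadd (f4mul b4 b10) (fadd (fpow4 b14)
       (fadd (f4mul b13 b5) (fadd (f4mul b12 b9) (f4mul b11 b13))))))) then
  if fzero (fadd (f4mul b5 b7) (fadd (f4mul b4 b11) (fadd (f4mul b14 b2)
       (fadd (f4mul b13 b6) (fadd (f4mul b12 b10) (f4mul b11 b14)))))) then true
  else false else false else false else false else false else false.

Definition survivor tabs b2 b4 b5 b6 b7 b8 b9 b10 b11 b12 b13 b14 b15 : bool :=
  let h := memo (hpoly [:: g1; b2; g0; b4; b5; b6; b7; b8; b9; b10; b11; b12; b13; b14; b15]) in
  if try_frob (try_points (try_norm tabs)) 4 h then true else if opolyb h then false else true.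

(** c_j is the square root of the coefficient of index 2j + 1, with c_0 = 1 and c_1 = 0. In [k3] the
    even t express the coefficients of index 8, 10, 12, 14; then t = 9, 11, 13 become three linear
    equations for those of index 2, 4, 6. What does not depend on [c7] is computed before [c7] is
    received. *)
Definition cand tabs c2 c3 c4 c5 c6 : gf32 -> bool :=
  let b5 := fsq c2 in let b7 := fsq c3 in let b9 := fsq c4 in
  let b11 := fsq c5 in let b13 := fsq c6 in
  let k8 := fmul c3 b5 in
  let k10 := fadd (fmul c2 k8) (fadd (fmul c3 b7) (fmul c5 b5)) in
  let ra := fadd b9 (fadd (fmul c2 b7) (fmul c4 b5)) in
  let rb := fadd b11 (fadd (fmul c2 b9) (fadd (fmul c3 k8) (fadd (fmul c4 b7) (fmul c6 b5)))) in
  let rc := fadd b13 (fadd (fmul c2 b11) (fadd (fmul c3 k10) (fadd (fmul c4 b9)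
              (fadd (fmul c5 k8) (fmul c6 b7))))) in
  let y2 := fmul c3 c6 in let y4 := fmul c3 c4 in let y6 := fadd (fmul c3 c2) c5 in
  let z2 := fadd (fmul c3 (fmul c2 c6)) (fmul c5 c6) in
  let z4 := fadd (fmul c3 (fadd (fmul c2 c4) c6)) (fmul c5 c4) in
  let z6 := fadd (fmul c3 (fadd b5 c4)) (fmul c5 c2) in
  let n10 := fadd (fmul c3 b7) (fmul c5 b5) in
  let n12 := fadd (fmul c3 b9) (fmul c5 b7) in
  let n14 := fadd (fmul c3 b11) (fmul c5 b9) in
  fun c7 =>
  solve3 [:: Eqn3 c7 c5 c3 ra; Eqn3 y2 (fadd y4 c7) y6 (fadd rb (fmul c3 c7));
             Eqn3 z2 z4 (fadd z6 c7) (fadd rc (fmul y6 c7))]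
  (fun b2 b4 b6 =>
     let b8 := fadd (fadd k8 c7) (fadd (fmul c2 b6) (fadd (fmul c4 b4) (fmul c6 b2))) in
     let b10 := fadd n10 (fadd (fmul c2 b8) (fadd (fmul c4 b6) (fmul c6 b4))) in
     let b12 := fadd n12 (fadd (fmul c2 b10) (fadd (fmul c4 b8) (fadd (fmul c6 b6)
                  (fmul c7 b5)))) in
     let b14 := fadd n14 (fadd (fmul c2 b12) (fadd (fmul c4 b10) (fadd (fmul c6 b8)
                  (fmul c7 b7)))) in
     let b15 := fsq c7 in
     if k5test b2 b4 b5 b6 b7 b9 b10 b11 b12 b13 b14 b15
     then survivor tabs b2 b4 b5 b6 b7 b8 b9 b10 b11 b12 b13 b14 b15 else true).

(** One element of each of the eight orbits of the Frobenius map. *)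
Definition frob_reps := [:: g0; g1; g2; g3; g6; g7; g8; g9].

Definition search2 tabs (c3 : gf32) : bool :=
  allg (fun c4 => allg (fun c5 => allg (fun c6 => allg (cand tabs g1 c3 c4 c5 c6)))).

Definition search3 tabs : bool :=
  allf (fun c4 => allg (fun c5 => allg (fun c6 => allg (cand tabs g0 g1 c4 c5 c6)))) frob_reps.

Definition search4 tabs : bool :=
  allf (fun c5 => allg (fun c6 => allg (cand tabs g0 g0 g1 c5 c6))) frob_reps.

Definition search5 tabs : bool :=
  allf (fun c6 => allg (cand tabs g0 g0 g0 g1 c6)) frob_reps.

Definition search6 tabs : bool := allf (cand tabs g0 g0 g0 g0 g1) frob_reps.

(** * Soundness of the search *)

Lemma memoE h : memo h =1 h. Proof. by case. Qed.

Lemma hpoly_sum (f : nat -> gf32) y m n :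
  y ^+ m * foldr (fun b s => fmul y (fadd b s)) g0 [seq f u | u <- iota m.+1 n]
  = \sum_(u <- iota m.+1 n) f u * y ^+ u.
Proof.
elim: n m => [|n IH] m; first by rewrite big_nil mulr0.
rewrite big_cons -IH /= exprS; move: (foldr _ _ _) (y ^+ m) (f m.+1) => a b c; gfring.
Qed.

Lemma opoly_hpoly h : opoly h -> h =1 hpoly [seq bc h u | u <- iota 1 15].
Proof.
move=> oh x; rewrite (opolyE x oh) /hpoly.
have := hpoly_sum (bc h) (fsq x) 0 15; rewrite expr0 mul1r => ->.
by apply: eq_bigr => u _; rewrite fsqE exprM.
Qed.

Lemma fdetE h x y z : fdet h x y z = det3 h x y z.
Proof. by rewrite /fdet /det3 -!faddE addrA. Qed.

Lemma opolybP h : reflect (opoly h) (opolyb h).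
Proof.
apply: (iffP idP); rewrite /opolyb.
  case: fzeroP => // h0 /allgP H; split=> //.
    move=> x y E; have /allgP/(_ y) := H x.
    by case: feqP => // xy; rewrite E; case: feqP.
  apply/arcfunP => x y z xy yz xz; have /allgP/(_ y) := H x.
  case: feqP => [E|_]; first by rewrite E eqxx in xy.
  case: feqP => // _ /allgP/(_ z).
  case: feqP => [E|_]; first by rewrite E eqxx in xz.
  case: feqP => [E|_]; first by rewrite E eqxx in yz.
  by rewrite fdetE; case: fzeroP => // E _; apply/eqP.
case=> h0 hi /arcfunP ha; case: fzeroP => [_|[]//].
apply/allgP => x; apply/allgP => y; case: feqP => // /eqP xy.
case: feqP => [/hi/eqP E|_]; first by rewrite E in xy.
apply/allgP => z; case: feqP => // /eqP xz; case: feqP => // /eqP yz.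
rewrite fdetE; case: fzeroP => // E; have := ha x y z xy yz xz.
by rewrite E eqxx.
Qed.

Lemma pickP' (T : Type) (f : T -> gf32) es : 
  match pick f es with
  | Some (e, es') => f e <> 0 /\ forall P, all P es -> P e /\ all P es'
  | None => all (fun e => fzero (f e)) es
  end.
Proof.
elim: es => //= e es; case: (fzeroP (f e)) => [fe|fe] /= IH; last first.
  by split=> // P /andP[].
move: IH; case: (pick f es) => [[e' es']|] //= [f0 H]; split=> // P /andP[Pe /H[Pe' Ps]].
by rewrite Pe.
Qed.

Definition sat1 z '(Eqn1 c r) : bool := c * z == r.
Definition sat2 y z '(Eqn2 b c r) : bool := b * y + c * z == r.
Definition sat3 x y z '(Eqn3 a b c r) : bool := a * x + b * y + c * z == r.

Lemma add_eq0P (x y : gf32) : x + y = 0 -> x = y.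
Proof. by move/eqP; rewrite addf_eq0 => /eqP. Qed.

Lemma fdivP (b y r : gf32) : b <> 0 -> b * y = r -> y = fmul r (finv b).
Proof.
move=> /eqP b0 <-; apply/esym/(mulIf b0).
have -> : fmul (b * y) (finv b) = b * y / b by [].
by rewrite divfK // mulrC.
Qed.

Lemma solve1P es k z : solve1 es k -> all (sat1 z) es -> k z.
Proof.
rewrite /solve1; have := pickP' (fun '(Eqn1 c _) => c) es.
case: (pick _ es) => [[[c r] es'] [c0 H]|H].
  move=> K /H[/eqP E Hes']; have Ez : fmul r (finv c) = z by rewrite -(fdivP c0 E).
  move: K; rewrite Ez allfE (_ : all _ es') //.
  by apply: sub_all Hes' => -[c' r'] /eqP <-; apply/feqP.
move=> K Hes; move: K; rewrite allfE (_ : all _ es).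
  by move/allgP; apply.
elim: es H Hes => //= -[c r] es IH /andP[/fzeroP -> /IH H] /andP[/eqP <- /H ->].
by rewrite mul0r.
Qed.

Lemma solve2P es k y z : solve2 es k -> all (sat2 y z) es -> k y z.
Proof.
rewrite /solve2; have := pickP' (fun '(Eqn2 b _ _) => b) es.
case: (pick _ es) => [[[b c r] es'] [b0 H]|H].
  move=> /solve1P K /H[/eqP E Hes'].
  have -> : y = fmul (fadd r (fmul c z)) (finv b).
    by apply: fdivP => //; rewrite -E; gfring.
  apply: (K z); rewrite all_map; apply: sub_all Hes' => -[b' c' r'] /eqP E'.
  by apply/eqP; rewrite -E -E'; gfring.
move/allgP/(_ y)/solve1P=> K Hes; apply: K.
elim: es H Hes => //= -[b c r] es IH /andP[/fzeroP -> /IH H] /andP[/eqP <- /H ->].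
by rewrite /sat1 mul0r add0r eqxx.
Qed.

Lemma solve3P es k x y z : solve3 es k -> all (sat3 x y z) es -> k x y z.
Proof.
rewrite /solve3; have := pickP' (fun '(Eqn3 a _ _ _) => a) es.
case: (pick _ es) => [[[a b c r] es'] [a0 H]|H].
  move=> /solve2P K /H[/eqP E Hes'].
  have -> : x = fmul (fadd r (fadd (fmul b y) (fmul c z))) (finv a).
    by apply: fdivP => //; rewrite -E; gfring.
  apply: (K y z); rewrite all_map; apply: sub_all Hes' => -[a' b' c' r'] /eqP E'.
  by apply/eqP; rewrite -E -E'; gfring.
move/allgP/(_ x)/solve2P=> K Hes; apply: K.
elim: es H Hes => //= -[a b c r] es IH /andP[/fzeroP -> /IH H] /andP[/eqP <- /H ->].
by rewrite /sat2 mul0r add0r eqxx.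
Qed.

Definition oval_equiv (h : gf32 -> gf32) : Prop :=
  exists2 c, c \in oval_coefs & tequiv h (hpoly c).

Lemma tequiv_oval h g : tequiv h g -> oval_equiv g -> oval_equiv h.
Proof. by move=> hg [c co gc]; exists c => //; apply: tequiv_trans hg gc. Qed.

Lemma tequiv_memo h g : tequiv (memo h) g -> tequiv h g.
Proof. by apply: eq_tequiv => x; rewrite memoE. Qed.

Lemma matchesP g : matches oval_tabs g -> oval_equiv g.
Proof.
rewrite /matches hasfE /oval_tabs has_map => /hasP[c co /allgP H]; exists c => //.
by apply: tequiv_eq => x; rewrite -(memoE (hpoly c)); apply/feqP.
Qed.

Lemma try_normP g : try_norm oval_tabs g -> oval_equiv g.
Proof.
rewrite /try_norm; set d := finv _; set e := froot _; set b := fscale _ _.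
case: fzeroP => // d0; case: fzeroP => // b0 /matchesP; apply: tequiv_oval.
apply: (@tequiv_T1 e); apply: tequiv_memo; apply: (@tequiv_T2 (fmul d b) b).
- by apply: mulf_neq0; apply/eqP.
- exact/eqP.
- exact: tequiv_eq.
Qed.

Lemma try_scaleP g : try_scale oval_tabs g -> oval_equiv g.
Proof.
rewrite /try_scale; set d := finv _; case: fzeroP => // d0 /matchesP; apply: tequiv_oval.
by apply: (@tequiv_T2 d 1); [exact/eqP | exact: oner_neq0 | exact: tequiv_eq].
Qed.

Lemma try_pointsP (f : (gf32 -> gf32) -> bool) h : (forall g, f g -> oval_equiv g) -> try_points f h -> oval_equiv h.
Proof.
move=> F; rewrite /try_points; case: (boolP (f h)) => [/F //|_].
rewrite hasfE => /hasP[e _ /F]; apply: tequiv_oval.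
apply: (@tequiv_T1 e); apply: tequiv_memo; apply: tequiv_T3; apply: tequiv_memo.
exact: tequiv_eq.
Qed.

Lemma try_frobP (f : (gf32 -> gf32) -> bool) n h : (forall g, f g -> oval_equiv g) -> try_frob f n h -> oval_equiv h.
Proof.
move=> F; elim: n h => [|n IH] h /=; case: (boolP (f h)) => [/F //|_] // /IH.
by apply: tequiv_oval; apply: tequiv_T4; apply: tequiv_memo; apply: tequiv_eq.
Qed.

(** The equations are [k3] for t = 8, ..., 14 after the normalisation c_0 = 1, c_1 = 0. *)
Lemma cand_solution tabs c2 c3 c4 c5 c6 c7 b2 b4 b6 b8 b10 b12 b14 :
  b8 + c2 * b6 + c3 * c2 ^+ 2 + c4 * b4 + c6 * b2 + c7 = 0 ->
  c4 ^+ 2 + c2 * c3 ^+ 2 + c3 * b6 + c4 * c2 ^+ 2 + c5 * b4 + c7 * b2 = 0 ->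
  b10 + c2 * b8 + c3 * c3 ^+ 2 + c4 * b6 + c5 * c2 ^+ 2 + c6 * b4 = 0 ->
  c5 ^+ 2 + c2 * c4 ^+ 2 + c3 * b8 + c4 * c3 ^+ 2 + c5 * b6 + c6 * c2 ^+ 2 + c7 * b4 = 0 ->
  b12 + c2 * b10 + c3 * c4 ^+ 2 + c4 * b8 + c5 * c3 ^+ 2 + c6 * b6 + c7 * c2 ^+ 2 = 0 ->
  c6 ^+ 2 + c2 * c5 ^+ 2 + c3 * b10 + c4 * c4 ^+ 2 + c5 * b8 + c6 * c3 ^+ 2 + c7 * b6 = 0 ->
  b14 + c2 * b12 + c3 * c5 ^+ 2 + c4 * b10 + c5 * c4 ^+ 2 + c6 * b8 + c7 * c3 ^+ 2 = 0 ->
  cand tabs c2 c3 c4 c5 c6 c7 ->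
  k5test b2 b4 (fsq c2) b6 (fsq c3) (fsq c4) b10 (fsq c5) b12 (fsq c6) b14 (fsq c7) ->
  survivor tabs b2 b4 (fsq c2) b6 (fsq c3) b8 (fsq c4) b10 (fsq c5) b12 (fsq c6) b14 (fsq c7).
Proof.
move=> E8 E9 E10 E11 E12 E13 E14; rewrite /cand.
have {E8} E8 : b8 = fadd (fadd (fmul c3 (fsq c2)) c7)
    (fadd (fmul c2 b6) (fadd (fmul c4 b4) (fmul c6 b2))).
  by apply: add_eq0P; rewrite -[RHS]E8; gfring.
have {E10} E10 : b10 = fadd (fadd (fmul c3 (fsq c3)) (fmul c5 (fsq c2)))
    (fadd (fmul c2 b8) (fadd (fmul c4 b6) (fmul c6 b4))).
  by apply: add_eq0P; rewrite -[RHS]E10; gfring.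
have {E12} E12 : b12 = fadd (fadd (fmul c3 (fsq c4)) (fmul c5 (fsq c3)))
    (fadd (fmul c2 b10) (fadd (fmul c4 b8) (fadd (fmul c6 b6) (fmul c7 (fsq c2))))).
  by apply: add_eq0P; rewrite -[RHS]E12; gfring.
have {E14} E14 : b14 = fadd (fadd (fmul c3 (fsq c5)) (fmul c5 (fsq c4)))
    (fadd (fmul c2 b12) (fadd (fmul c4 b10) (fadd (fmul c6 b8) (fmul c7 (fsq c3))))).
  by apply: add_eq0P; rewrite -[RHS]E14; gfring.
move=> S k5; have := @solve3P _ _ b2 b4 b6 S; cbv beta.
rewrite -E8 -E10 -E12 -E14 k5; apply.
(* The rows of the system have [b8] and [b10] already eliminated, so these are substituted in the
   equations for t = 11 and t = 13. *)
rewrite /= andbT; apply/and3P; split; apply/eqP; apply: add_eq0P.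
- by rewrite -[RHS]E9; gfring.
- by rewrite -[RHS]E11 E8; gfring.
- by rewrite -[RHS]E13 E10 E8; gfring.
Qed.

Lemma survivorP b2 b4 b5 b6 b7 b8 b9 b10 b11 b12 b13 b14 b15 h :
  opoly h ->
  [seq bc h u | u <- iota 1 15] =
    [:: 1; b2; 0; b4; b5; b6; b7; b8; b9; b10; b11; b12; b13; b14; b15] ->
  survivor oval_tabs b2 b4 b5 b6 b7 b8 b9 b10 b11 b12 b13 b14 b15 -> oval_equiv h.
Proof.
move=> oh E; rewrite /survivor -[g1]/(1 : gf32) -[g0]/(0 : gf32) -E.
set g := memo _; have hg : h =1 g by move=> x; rewrite /g memoE; apply: opoly_hpoly.
case: (boolP (try_frob _ _ _)) => [/try_frobP H _|_].
  have [|c co gc] := H; first by move=> k; apply: try_pointsP => {}k; apply: try_normP.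
  by exists c => //; apply: eq_tequiv gc.
by case: opolybP => // -[]; apply: eq_opoly oh.
Qed.


Lemma cand_opoly h : opoly h -> bc h 1 = 1 -> bc h 3 = 0 ->
  cand oval_tabs (froot (bc h 5)) (froot (bc h 7)) (froot (bc h 9)) (froot (bc h 11))
    (froot (bc h 13)) (froot (bc h 15)) -> oval_equiv h.
Proof.
move=> oh E1 E3 K.
have bsq u : bc h u = froot (bc h u) ^+ 2 by rewrite froot_sq.
have E8 := @k3 h 8 oh isT; have E9 := @k3 h 9 oh isT; have E10 := @k3 h 10 oh isT.
have E11 := @k3 h 11 oh isT; have E12 := @k3 h 12 oh isT; have E13 := @k3 h 13 oh isT.
have E14 := @k3 h 14 oh isT.
have A4 := @k5a h 4 oh isT; have A5 := @k5a h 5 oh isT; have A6 := @k5a h 6 oh isT.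
have B4 := @k5b h 4 oh isT; have B5 := @k5b h 5 oh isT; have B6 := @k5b h 6 oh isT.
have f1 : froot 1 = 1 by []. have f0 : froot 0 = 0 by [].
move: E8 E9 E10 E11 E12 E13 E14 A4 A5 A6 B4 B5 B6; rewrite !big_cons !big_nil.
rewrite ![(2 * _ + _)%N]/= ![(4 * _ + _)%N]/= ![(_ - _)%N]/= E1 E3 f1 f0.
have := survivorP oh _; rewrite [map _ _]/= E1 E3 => /(_ _ _ _ _ _ _ _ _ _ _ _ _ _ erefl) S.
move=> E8 E9 E10 E11 E12 E13 E14 A4 A5 A6 B4 B5 B6; apply: S.
move: K E8 E9 E10 E11 E12 E13 E14 A4 A5 A6 B4 B5 B6.
rewrite (bsq 5) (bsq 7) (bsq 9) (bsq 11) (bsq 13) (bsq 15) !sqr_froot.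
move: (froot (bc h 5)) (froot (bc h 7)) (froot (bc h 9)) (froot (bc h 11)) (froot (bc h 13))
  (froot (bc h 15)) => c2 c3 c4 c5 c6 c7.
move: (bc h 2) (bc h 4) (bc h 6) (bc h 8) (bc h 10) (bc h 12) (bc h 14).
move=> b2 b4 b6 b8 b10 b12 b14 K E8 E9 E10 E11 E12 E13 E14 A4 A5 A6 B4 B5 B6.
rewrite -!fsqE; apply: (cand_solution _ _ _ _ _ _ _ K).
- by rewrite -[RHS]E8; gfring.
- by rewrite -[RHS]E9; gfring.
- by rewrite -[RHS]E10; gfring.
- by rewrite -[RHS]E11; gfring.
- by rewrite -[RHS]E12; gfring.
- by rewrite -[RHS]E13; gfring.
- by rewrite -[RHS]E14; gfring.
rewrite /k5test /f4mul /fpow4.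
rewrite (_ : fadd _ _ = 0) ?[fzero _]/=; last by rewrite -[RHS]A4; gfring.
rewrite (_ : fadd _ _ = 0) ?[fzero _]/=; last by rewrite -[RHS]B4; gfring.
rewrite (_ : fadd _ _ = 0) ?[fzero _]/=; last by rewrite -[RHS]A5; gfring.
rewrite (_ : fadd _ _ = 0) ?[fzero _]/=; last by rewrite -[RHS]B5; gfring.
rewrite (_ : fadd _ _ = 0) ?[fzero _]/=; last by rewrite -[RHS]A6; gfring.
by rewrite (_ : fadd _ _ = 0) //; rewrite -[RHS]B6; gfring.
Qed.

(** After translation by e, coefficient 1 is a polynomial in e with distinct exponents 4j < 31, one
    of whose coefficients is nonzero; it cannot vanish for all e. *)
Lemma norm_b1 h j : opoly h -> (j < 8)%N -> bc h (2 * j + 1) != 0 ->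
  exists e, bc (T1 e h) 1 != 0.
Proof.
move=> oh j8 bj; apply/existsP; apply: contraNT bj; rewrite negb_exists => /forallP H.
have -> : (2 * j + 1 = 2 * (4 * j %/ 4) + 1)%N by rewrite mulKn.
apply/eqP; apply: (@coef_ext [seq 4 * i | i <- iota 0 8]%N (fun e => bc h (2 * (e %/ 4) + 1))) => //.
  move=> s; rewrite big_map; have := H s; rewrite negbK => /eqP; rewrite bc_T1_1 // => E.
  by rewrite -[RHS]E; apply: eq_bigr => i _; rewrite mulKn.
by apply: map_f; rewrite mem_iota.
Qed.

(** [T3] reverses the list of coefficients. Between two uses of it a translation removes coefficient
    13; coefficient 15, nonzero at that stage, makes this possible and does not change. *)
Lemma norm_b1_b3 h j : opoly h -> (j < 8)%N -> bc h (2 * j + 1) != 0 ->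
  exists g, [/\ tequiv h g, opoly g, bc g 1 = 1 & bc g 3 = 0].
Proof.
move=> oh j8 /(norm_b1 oh j8)[e b1].
pose h1 := T1 e h; have o1 : opoly h1 := opoly_T1 e oh.
pose h2 := T3 h1; have o2 : opoly h2 := opoly_T3 o1.
have b15 : bc h2 15 = bc h1 1 by rewrite bc_T3 //; case: o1.
pose e' := froot (froot (bc h2 13 / bc h2 15)).
pose h3 := T1 e' h2; have o3 : opoly h3 := opoly_T1 e' o2.
have b13 : bc h3 13 = 0.
  rewrite bc_T1_13 // (_ : e' ^+ 4 = bc h2 13 / bc h2 15); last first.
    by rewrite -[4%N]/(2 * 2)%N exprM !froot_sq.
  by rewrite divfK ?addff // b15.
have b15' : bc h3 15 = bc h1 1 by rewrite bc_T1_15.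
pose h4 := T3 h3; have o4 : opoly h4 := opoly_T3 o3.
have h30 : h3 0 = 0 by case: o3.
have b1' : bc h4 1 = bc h1 1 by rewrite bc_T3.
have b3' : bc h4 3 = 0 by rewrite bc_T3.
exists (T2 (bc h1 1)^-1 1 h4); split.
- do 2!(apply: tequiv_T1; apply: tequiv_T3).
  apply: (@tequiv_T2 (bc h1 1)^-1 1); rewrite ?invr_eq0 ?oner_neq0 //.
  exact: tequiv_eq.
- by apply: opoly_T2; rewrite ?invr_eq0 ?oner_neq0.
- by rewrite bc_T2 ?oner_neq0 // expr1n mulr1 b1' mulVf.
- by rewrite bc_T2 ?oner_neq0 // b3' mulr0.
Qed.

(** Scaling by b^-2 outside and b inside keeps coefficient 1 and multiplies coefficient 2j + 1 by
    b^(4j); as [m] inverts 4j modulo 31, every nonzero factor is of this form. *)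
Lemma norm_scale g j m : opoly g -> bc g 1 = 1 -> (j < 8)%N -> (4 * j * m = 1 %[mod 31])%N ->
  bc g (2 * j + 1) != 0 ->
  exists g', [/\ tequiv g g', opoly g', bc g' 1 = 1, bc g' (2 * j + 1) = 1 &
     forall u, (u < 16)%N -> bc g u = 0 -> bc g' u = 0].
Proof.
move=> og b1 j8 jm bj; set d := bc g _ in bj; pose b := d^-1 ^+ m.
have b0 : b != 0 by rewrite expf_neq0 ?invr_eq0.
have b20 : (b ^+ 2)^-1 != 0 by rewrite invr_eq0 expf_neq0.
exists (T2 (b ^+ 2)^-1 b g); split.
- by apply: (@tequiv_T2 (b ^+ 2)^-1 b) => //; apply: tequiv_eq.
- exact: opoly_T2.
- by rewrite bc_T2 // b1 mulr1; apply: mulVf; apply: expf_neq0.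
- rewrite bc_T2 //; last first.
    by apply: (@leq_ltn_trans (2 * 7 + 1)); rewrite // leq_add2r leq_mul2l /= -ltnS.
  have -> : b ^+ (2 * (2 * j + 1)) = b ^+ 2 * b ^+ (4 * j).
    by rewrite -exprD mulnDr muln1 mulnA addnC.
  rewrite mulKf ?expf_neq0 // -/d.
  rewrite -exprM mulnC; apply: (mulIf (invr_neq0 bj)); rewrite mulfK // mul1r.
  rewrite (divn_eq (4 * j * m) 31) jm mulnC addnC gf_expr_mod31 // expr1.
  exact: invr_neq0.
- by move=> u u16 E; rewrite bc_T2 // E mulr0.
Qed.

Lemma frob_repsP (c : gf32) : exists2 t, (t < 5)%N & iter t fsq c \in frob_reps.
Proof.
have /allgP/(_ c) : allg (fun c => has (fun t => iter t fsq c \in frob_reps) (iota 0 5)).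
  by vm_compute.
by case/hasP=> t; rewrite mem_iota => /andP[_ t5] H; exists t.
Qed.

Lemma iter_T4 t h : opoly h ->
  [/\ tequiv h (iter t T4 h), opoly (iter t T4 h) & forall u, bc (iter t T4 h) u = iter t fsq (bc h u)].
Proof.
move=> oh; elim: t => [|t [IH1 IH2 IH3]]; first by split=> //; apply: tequiv_eq.
split=> [||u] /=; first by apply: tequiv_trans IH1 _; apply: tequiv_T4; apply: tequiv_eq.
  exact: opoly_T4.
by rewrite bc_T4 IH3 fsqE.
Qed.

Lemma froot_iter t c : froot (iter t fsq c) = iter t fsq (froot c).
Proof. by elim: t => //= t IH; rewrite fsqK -{1}[iter t fsq c]frootK IH. Qed.

Lemma iter_fsq0 t : iter t fsq 0 = 0. Proof. by elim: t => //= t ->. Qed.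
Lemma iter_fsq1 t : iter t fsq 1 = 1. Proof. by elim: t => //= t ->. Qed.

Lemma norm_frob h j : opoly h ->
  exists g t, [/\ tequiv h g, opoly g, froot (bc g j) \in frob_reps &
     forall u, bc g u = iter t fsq (bc h u)].
Proof.
move=> oh; have [t _ Ht] := frob_repsP (froot (bc h j)).
have [h1 h2 h3] := iter_T4 t oh; exists (iter t T4 h), t; split=> //.
by rewrite h3 froot_iter.
Qed.

Definition survivor0 tabs e1 e2 e3 e4 e5 e6 e7 : bool :=
  let h := memo (hpoly [:: g0; e1; g0; e2; g0; e3; g0; e4; g0; e5; g0; e6; g0; e7; g0]) in
  if try_points (try_scale tabs) h then true else if opolyb h then false else true.

(** All odd-indexed coefficients vanish and e_i has index 2i. Then [k3] is void and each of the
    eight identities of exponent 5 has two terms, tested as soon as its variables are bound. The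
    coefficient [e4] of x^16 occurs in none of them; only the value 1 at 1 restricts it. *)
Definition search0 tabs : bool :=
  allg (fun e1 => allg (fun e2 => allg (fun e5 =>
  if feq (f4mul e2 e1) (f4mul e1 e5) then allg (fun e3 =>
  if feq (f4mul e3 e1) (f4mul e2 e5) then allg (fun e7 =>
  if feq (f4mul e2 e3) (f4mul e1 e7) then
  if feq (f4mul e3 e3) (f4mul e2 e7) then allg (fun e6 =>
  if feq (f4mul e6 e1) (f4mul e5 e5) then
  if feq (f4mul e6 e3) (f4mul e5 e7) then
  if feq (f4mul e7 e1) (f4mul e6 e5) then
  if feq (f4mul e7 e3) (f4mul e6 e7) then allg (fun e4 =>
  if feq (fadd e1 (fadd e2 (fadd e3 (fadd e4 (fadd e5 (fadd e6 e7)))))) g1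
  then survivor0 tabs e1 e2 e3 e4 e5 e6 e7 else true)
  else true else true else true else true) else true else true) else true) else true))).

Lemma search2_g0 : search2 oval_tabs g0. Proof. vm_cast_no_check (erefl true). Qed.
Lemma search2_g1 : search2 oval_tabs g1. Proof. vm_cast_no_check (erefl true). Qed.
Lemma search2_g2 : search2 oval_tabs g2. Proof. vm_cast_no_check (erefl true). Qed.
Lemma search2_g3 : search2 oval_tabs g3. Proof. vm_cast_no_check (erefl true). Qed.
Lemma search2_g6 : search2 oval_tabs g6. Proof. vm_cast_no_check (erefl true). Qed.
Lemma search2_g7 : search2 oval_tabs g7. Proof. vm_cast_no_check (erefl true). Qed.
Lemma search2_g8 : search2 oval_tabs g8. Proof. vm_cast_no_check (erefl true). Qed.
Lemma search2_g9 : search2 oval_tabs g9. Proof. vm_cast_no_check (erefl true). Qed.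
Lemma search3_ok : search3 oval_tabs. Proof. vm_cast_no_check (erefl true). Qed.
Lemma search4_ok : search4 oval_tabs. Proof. vm_cast_no_check (erefl true). Qed.
Lemma search5_ok : search5 oval_tabs. Proof. vm_cast_no_check (erefl true). Qed.
Lemma search6_ok : search6 oval_tabs. Proof. vm_cast_no_check (erefl true). Qed.
Lemma search7_ok : cand oval_tabs g0 g0 g0 g0 g0 g1. Proof. vm_cast_no_check (erefl true). Qed.
Lemma search8_ok : cand oval_tabs g0 g0 g0 g0 g0 g0. Proof. vm_cast_no_check (erefl true). Qed.
Lemma search0_ok : search0 oval_tabs. Proof. vm_cast_no_check (erefl true). Qed.

Lemma allf_mem (T : eqType) (p : T -> bool) s x : allf p s -> x \in s -> p x.
Proof. by rewrite allfE => /allP H /H. Qed.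

Lemma search2_all c3 c4 c5 c6 c7 : c3 \in frob_reps -> cand oval_tabs g1 c3 c4 c5 c6 c7.
Proof.
rewrite !inE => H; suff : search2 oval_tabs c3.
  by rewrite /search2 => /allgP/(_ c4)/allgP/(_ c5)/allgP/(_ c6)/allgP/(_ c7).
case/or4P: H => [/eqP->|/eqP->|/eqP->|/or4P[/eqP->|/eqP->|/eqP->|/orP[/eqP->|/eqP->]]].
- exact: search2_g0.
- exact: search2_g1.
- exact: search2_g2.
- exact: search2_g3.
- exact: search2_g6.
- exact: search2_g7.
- exact: search2_g8.
- exact: search2_g9.
Qed.

(** Coefficient 2j + 1 is scaled to 1; then a power of the Frobenius map, which fixes 0 and 1,
    brings the root of coefficient [k] into [frob_reps]. *)
Lemma norm_step h j k m : opoly h -> bc h 1 = 1 -> bc h 3 = 0 -> (j < 8)%N ->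
  (4 * j * m = 1 %[mod 31])%N -> bc h (2 * j + 1) != 0 ->
  exists g, [/\ tequiv h g, opoly g, [/\ bc g 1 = 1, bc g 3 = 0 & bc g (2 * j + 1) = 1],
     froot (bc g k) \in frob_reps & forall u, (u < 16)%N -> bc h u = 0 -> bc g u = 0].
Proof.
move=> oh b1 b3 j8 jm bj; have [g [hg og g1' gj gz]] := norm_scale oh b1 j8 jm bj.
have [g' [t [gg' og' gk gu]]] := norm_frob k og; exists g'; split=> //.
- exact: tequiv_trans hg gg'.
- by split; rewrite gu ?g1' ?gj ?iter_fsq1 // gz // iter_fsq0.
- by move=> u u16 hu; rewrite gu gz // iter_fsq0.
Qed.

Lemma classify_norm h : opoly h -> bc h 1 = 1 -> bc h 3 = 0 -> oval_equiv h.
Proof.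
move=> oh b1 b3.
have f1 : froot 1 = 1 by []. have f0 : froot 0 = 0 by [].
have S3 := search3_ok; rewrite /search3 in S3.
have S4 := search4_ok; have S5 := search5_ok; rewrite /search4 in S4; rewrite /search5 in S5.
(* The first nonzero coefficient among those of index 5, 7, ..., 15 is made 1 and, before the last
   index, the next one a Frobenius representative. The numbers 4, 13, 2, 14, 22, 10 invert 4j modulo
   31 for j = 2, ..., 7. *)
have [b5|b5] := eqVneq (bc h 5) 0; last first.
  have [//|g [hg og [g1' g3' gj] gk gz]] := @norm_step h 2 7 4 oh b1 b3 isT _ b5.
  apply: (tequiv_oval hg); apply: (cand_opoly og g1' g3'); rewrite gj f1; exact: search2_all.
have [b7|b7] := eqVneq (bc h 7) 0; last first.
  have [//|g [hg og [g1' g3' gj] gk gz]] := @norm_step h 3 9 13 oh b1 b3 isT _ b7.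
  apply: (tequiv_oval hg); apply: (cand_opoly og g1' g3'); rewrite gj (gz 5 isT b5) f1 f0.
  by have /allgP/(_ (froot (bc g 11)))/allgP/(_ (froot (bc g 13)))/allgP := allf_mem S3 gk; apply.
have [b9|b9] := eqVneq (bc h 9) 0; last first.
  have [//|g [hg og [g1' g3' gj] gk gz]] := @norm_step h 4 11 2 oh b1 b3 isT _ b9.
  apply: (tequiv_oval hg); apply: (cand_opoly og g1' g3'); rewrite gj (gz 5 isT b5) (gz 7 isT b7) f1 f0.
  by have /allgP/(_ (froot (bc g 13)))/allgP := allf_mem S4 gk; apply.
have [b11|b11] := eqVneq (bc h 11) 0; last first.
  have [//|g [hg og [g1' g3' gj] gk gz]] := @norm_step h 5 13 14 oh b1 b3 isT _ b11.
  apply: (tequiv_oval hg); apply: (cand_opoly og g1' g3').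
  rewrite gj (gz 5 isT b5) (gz 7 isT b7) (gz 9 isT b9) f1 f0.
  by have /allgP := allf_mem S5 gk; apply.
have [b13|b13] := eqVneq (bc h 13) 0; last first.
  have [//|g [hg og [g1' g3' gj] gk gz]] := @norm_step h 6 15 22 oh b1 b3 isT _ b13.
  apply: (tequiv_oval hg); apply: (cand_opoly og g1' g3').
  rewrite gj (gz 5 isT b5) (gz 7 isT b7) (gz 9 isT b9) (gz 11 isT b11) f1 f0.
  by have S6 := search6_ok; rewrite /search6 in S6; apply: allf_mem S6 gk.
have [b15|b15] := eqVneq (bc h 15) 0; last first.
  have [//|g [hg og [g1' g3' gj] gk gz]] := @norm_step h 7 15 10 oh b1 b3 isT _ b15.
  apply: (tequiv_oval hg); apply: (cand_opoly og g1' g3').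
  rewrite gj (gz 5 isT b5) (gz 7 isT b7) (gz 9 isT b9) (gz 11 isT b11) (gz 13 isT b13) f0 f1; exact: search7_ok.
by apply: (cand_opoly oh b1 b3); rewrite b5 b7 b9 b11 b13 b15 f0; exact: search8_ok.
Qed.

Lemma f4mulE a b : f4mul a b = a ^+ 4 * b.
Proof. by rewrite /f4mul /fpow4; gfring. Qed.

Lemma hpoly1 bs : hpoly bs g1 = foldr fadd g0 bs.
Proof. by rewrite /hpoly; elim: bs => //= b bs ->. Qed.

Lemma search0P tabs e1 e2 e3 e4 e5 e6 e7 :
  search0 tabs ->
  f4mul e2 e1 = f4mul e1 e5 -> f4mul e3 e1 = f4mul e2 e5 -> f4mul e2 e3 = f4mul e1 e7 ->
  f4mul e3 e3 = f4mul e2 e7 -> f4mul e6 e1 = f4mul e5 e5 -> f4mul e6 e3 = f4mul e5 e7 ->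
  f4mul e7 e1 = f4mul e6 e5 -> f4mul e7 e3 = f4mul e6 e7 ->
  fadd e1 (fadd e2 (fadd e3 (fadd e4 (fadd e5 (fadd e6 e7))))) = g1 ->
  survivor0 tabs e1 e2 e3 e4 e5 e6 e7.
Proof.
rewrite /search0; move: (survivor0 tabs) => S /allgP/(_ e1)/allgP/(_ e2)/allgP/(_ e5) H.
move=> /feqP E1 /feqP E2 /feqP E3 /feqP E4 /feqP E5 /feqP E6 /feqP E7 /feqP E8 /feqP E9.
move: H; rewrite E1 => /allgP/(_ e3); rewrite E2 => /allgP/(_ e7); rewrite E3 E4.
by move=> /allgP/(_ e6); rewrite E5 E6 E7 E8 => /allgP/(_ e4); rewrite E9.
Qed.

Lemma survivor0P e1 e2 e3 e4 e5 e6 e7 h :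
  opoly h ->
  [seq bc h u | u <- iota 1 15] =
    [:: 0; e1; 0; e2; 0; e3; 0; e4; 0; e5; 0; e6; 0; e7; 0] ->
  survivor0 oval_tabs e1 e2 e3 e4 e5 e6 e7 -> oval_equiv h.
Proof.
move=> oh E; rewrite /survivor0 -[g0]/(0 : gf32) -E.
set g := memo _; have hg : h =1 g by move=> x; rewrite /g memoE; apply: opoly_hpoly.
case: (boolP (try_points _ _)) => [/try_pointsP H _|_].
  have [|c co gc] := H; first exact: try_scaleP.
  by exists c => //; apply: eq_tequiv gc.
by case: opolybP => // -[]; apply: eq_opoly oh.
Qed.

Lemma classify_even h : opoly h -> h 1 = 1 ->
  (forall j, (j < 8)%N -> bc h (2 * j + 1) = 0) -> oval_equiv h.
Proof.
move=> oh h1 b0.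
have A4 := @k5a h 4 oh isT; have A5 := @k5a h 5 oh isT.
have A6 := @k5a h 6 oh isT; have A7 := @k5a h 7 oh isT.
have B4 := @k5b h 4 oh isT; have B5 := @k5b h 5 oh isT.
have B6 := @k5b h 6 oh isT; have B7 := @k5b h 7 oh isT.
have E1 := b0 0%N isT; have E3 := b0 1%N isT; have E5 := b0 2%N isT; have E7 := b0 3%N isT.
have E9 := b0 4%N isT; have E11 := b0 5%N isT; have E13 := b0 6%N isT; have E15 := b0 7%N isT.
move: E1 E3 E5 E7 E9 E11 E13 E15; rewrite ![(2 * _ + _)%N]/= => E1 E3 E5 E7 E9 E11 E13 E15.
have h1' := opoly_hpoly oh 1.
have S := @survivor0P (bc h 2) (bc h 4) (bc h 6) (bc h 8) (bc h 10) (bc h 12) (bc h 14) h oh.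
apply: S; first by rewrite [map _ _]/= E1 E3 E5 E7 E9 E11 E13 E15.
move: A4 A5 A6 A7 B4 B5 B6 B7 h1'; rewrite !big_cons !big_nil [map _ _]/=.
rewrite ![(4 * _ + _)%N]/= ![(_ - _)%N]/= E1 E3 E5 E7 E9 E11 E13 E15 h1.
move: (bc h 2) (bc h 4) (bc h 6) (bc h 8) (bc h 10) (bc h 12) (bc h 14).
move=> e1 e2 e3 e4 e5 e6 e7 A4 A5 A6 A7 B4 B5 B6 B7 h1'.
apply: (search0P search0_ok); rewrite ?f4mulE.
- by apply: add_eq0P; rewrite -[RHS]A4; gfring.
- by apply: add_eq0P; rewrite -[RHS]A6; gfring.
- by apply: add_eq0P; rewrite -[RHS]A5; gfring.
- by apply: add_eq0P; rewrite -[RHS]A7; gfring.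
- by apply: add_eq0P; rewrite -[RHS]B4; gfring.
- by apply: add_eq0P; rewrite -[RHS]B5; gfring.
- by apply: add_eq0P; rewrite -[RHS]B6; gfring.
- by apply: add_eq0P; rewrite -[RHS]B7; gfring.
- by rewrite [RHS](h1' : g1 = _) hpoly1 [foldr _ _ _]/=; gfring.
Qed.

Theorem oval_classification h : opoly h -> oval_equiv h.
Proof.
move=> oh; have [b0|] := boolP (all (fun j => bc h (2 * j + 1) == 0) (iota 0 8)); last first.
  case/allPn=> j; rewrite mem_iota => /andP[_ j8] bj.
  have [g [hg og b1 b3]] := norm_b1_b3 oh j8 bj.
  exact/(tequiv_oval hg)/classify_norm.
have h1 : h 1 != 0.
  by have [h0 hi _] := oh; apply/eqP => E; have /eqP := hi 1 0 (etrans E (esym h0)); rewrite oner_eq0.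
have hg : tequiv h (T2 (h 1)^-1 1 h).
  by apply: (@tequiv_T2 (h 1)^-1 1); rewrite ?invr_eq0 ?oner_neq0 //; apply: tequiv_eq.
apply: (tequiv_oval hg); apply: classify_even.
- exact: tequiv_opoly hg oh.
- by rewrite /T2 mulr1 mulVf.
move=> j j8; rewrite bc_T2 ?oner_neq0 //.
  by rewrite (eqP (all_iotaP b0 _)) ?mulr0.
by move: j j8; do 8?case=> //.
Qed.

(** * Pairs of o-polynomials with o-polynomial sum *)

Definition fbits (a : gf32) : seq bool := match a with
| g0 => [:: false; false; false; false; false]
| g1 => [:: true; false; false; false; false]
| g2 => [:: false; true; false; false; false]
| g3 => [:: true; true; false; false; false]
| g4 => [:: false; false; true; false; false]
| g5 => [:: true; false; true; false; false]
| g6 => [:: false; true; true; false; false]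
| g7 => [:: true; true; true; false; false]
| g8 => [:: false; false; false; true; false]
| g9 => [:: true; false; false; true; false]
| g10 => [:: false; true; false; true; false]
| g11 => [:: true; true; false; true; false]
| g12 => [:: false; false; true; true; false]
| g13 => [:: true; false; true; true; false]
| g14 => [:: false; true; true; true; false]
| g15 => [:: true; true; true; true; false]
| g16 => [:: false; false; false; false; true]
| g17 => [:: true; false; false; false; true]
| g18 => [:: false; true; false; false; true]
| g19 => [:: true; true; false; false; true]
| g20 => [:: false; false; true; false; true]
| g21 => [:: true; false; true; false; true]
| g22 => [:: false; true; true; false; true]
| g23 => [:: true; true; true; false; true]
| g24 => [:: false; false; false; true; true]
| g25 => [:: true; false; false; true; true]
| g26 => [:: false; true; false; true; true]
| g27 => [:: true; true; false; true; true]
| g28 => [:: false; false; true; true; true]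
| g29 => [:: true; false; true; true; true]
| g30 => [:: false; true; true; true; true]
| g31 => [:: true; true; true; true; true]
end.

Definition gf_basis := [:: g1; g2; g4; g8; g16].

Definition fofbits (bs : seq bool) : gf32 :=
  foldr (fun p s => if p.1 then fadd p.2 s else s) g0 (zip bs gf_basis).

Lemma fbitsK a : fofbits (fbits a) = a. Proof. by case: a. Qed.

Lemma size_fbits a : size (fbits a) = 5%N. Proof. by case: a. Qed.

Lemma fbitsD a b : fbits (a + b) = [seq x.1 (+) x.2 | x <- zip (fbits a) (fbits b)].
Proof.
apply/eqP; move: b; apply/allgP; move: a; apply/allgP; by vm_compute.
Qed.

Lemma gf_span (P : gf32 -> Prop) : P 0 -> (forall a b, P a -> P b -> P (a + b)) ->
  (forall g, g \in gf_basis -> P g) -> forall a, P a.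
Proof.
move=> P0 PD Pb a; rewrite -(fbitsK a) /fofbits.
have: all (mem gf_basis) [seq p.2 | p <- zip (fbits a) gf_basis] by case: a.
elim: (zip _ _) => //= -[[] g] s IH /andP[gb /IH Ps] //=.
by apply: PD => //; apply: Pb.
Qed.

(* Solutions of a homogeneous linear system over F2: [plan] eliminates the variables in turn,
   recording for each either the row expressing it by the later ones or [None] if it is free. *)
Definition bdot (r x : seq bool) : bool := foldr (fun p s => (p.1 && p.2) (+) s) false (zip r x).

Lemma bdot_nil x : bdot [::] x = false. Proof. by case: x. Qed.

Fixpoint pick_row (rows : seq (seq bool)) : option (seq bool * seq (seq bool)) :=
  if rows is r :: rs then
    if head false r then Some (r, rs) else
    if pick_row rs is Some (p, rs') then Some (p, r :: rs') else None
  else None.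

Definition bxor (r s : seq bool) : seq bool := [seq p.1 (+) p.2 | p <- zip r s].

Fixpoint plan (n : nat) (rows : seq (seq bool)) : seq (option (seq bool)) :=
  if n is n'.+1 then
    match pick_row rows with
    | Some (p, rs) => let p' := behead p in
        Some p' :: plan n' [seq (if head false r then bxor p' (behead r) else behead r) | r <- rs]
    | None => None :: plan n' (map behead rows)
    end
  else [::].

Fixpoint walk (pl : seq (option (seq bool))) (k : seq bool -> bool) : bool :=
  match pl with
  | [::] => k [::]
  | Some r :: pl' => walk pl' (fun x => k (bdot r x :: x))
  | None :: pl' => walk pl' (fun x => if k (false :: x) then k (true :: x) else false)
  end.

Lemma bdot_xor n r s x : size r = n -> size s = n -> size x = n ->
  bdot (bxor r s) x = bdot r x (+) bdot s x.
Proof.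
rewrite /bdot /bxor; elim: n r s x => [|n IH] [|a r] [|b s] [|c x] //= [er] [es] [ex].
by rewrite IH //; case: a; case: b; case: c => //=; case: foldr; case: foldr.
Qed.

Lemma pick_rowP n rows : all (fun r => size r == n.+1) rows ->
  match pick_row rows with
  | Some (p, rs) => [/\ p = true :: behead p, size p = n.+1,
       all (fun r => size r == n.+1) rs & forall x, all (fun r => ~~ bdot r x) rows ->
         ~~ bdot p x /\ all (fun r => ~~ bdot r x) rs]
  | None => all (fun r => ~~ head false r) rows
  end.
Proof.
elim: rows => //= r rows IH /andP[/eqP sr srs]; have {IH} := IH srs.
case: r sr => // -[] r [sr] /=; first by split=> //= [|x /andP[-> ->] //]; rewrite sr.
case: (pick_row rows) => [[p rs] [-> sp srs' H]|] //=; split; rewrite ?sr ?eqxx // => x /andP[Hr /H[]].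
by rewrite Hr => -> ->.
Qed.

Lemma walkP n rows k x : all (fun r => size r == n) rows -> size x = n ->
  walk (plan n rows) k -> all (fun r => ~~ bdot r x) rows -> k x.
Proof.
elim: n rows k x => [|n IH] rows k [|b x] //= srows [sx].
have := pick_rowP srows; case: (pick_row rows) => [[p rs] [ep sp srs H]|H] /=.
  move=> /IH K Hx; have [Hp Hrs] := H _ Hx; rewrite ep in sp Hp; case: sp => sp.
  have eb : b = bdot (behead p) x.
    by move: Hp; rewrite /bdot /=; case: b {Hx Hrs} => //=; case: foldr.
  rewrite eb; apply: K => //.
    rewrite all_map; apply: sub_all srs => -[|c r] //= /eqP[sr]; case: c => /=; rewrite ?sr //.
    by rewrite /bxor size_map size_zip sp sr minnn.
  rewrite all_map; elim: rs Hrs srs {H} => //= r rs IHr /andP[Hr /IHr H'] /andP[sr /H' ->].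
  rewrite andbT; case: r Hr sr => // c r; rewrite /= eqSS => Hr /eqP sr.
  case: c Hr => /=; last by rewrite /bdot /=.
  by rewrite (@bdot_xor n) // /bdot /= -/(bdot r x) -/(bdot _ x) eb /=; case: (bdot _ x); case: (bdot _ x).
move=> /IH K Hx; have /(_ x) := K; set kk := (if _ then _ else _) => K'.
have : kk.
  apply: K' => //.
    by rewrite all_map; apply: sub_all srows => -[|c r] //=; rewrite eqSS.
  rewrite all_map; elim: rows H Hx {srows K kk} => //= r rs IHr /andP[hr /IHr H] /andP[Hr /H ->].
  by rewrite andbT; case: r hr Hr => [_ _|[] r //= _]; rewrite ?bdot_nil.
by rewrite /kk; case: (boolP (k (false :: x))) => // k0 k1; case: b {Hx}.
Qed.

(** The left sides of [k3], [k5a] and [k5b] with independent arguments. Roots and fourth powers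
    being additive, these forms are additive in both. *)
Definition k3_form (f h : nat -> gf32) (t : nat) : gf32 :=
  foldr (fun j s => fadd (fmul (froot (f (2 * j + 1)%N)) (h (t - j)%N)) s) g0 (iota 0 8).

Definition k5a_form (f h : nat -> gf32) (n : nat) : gf32 :=
  foldr (fun i s => fadd (fadd (f4mul (f (n - i)%N) (h (4 * i + 2)%N))
     (f4mul (f (n + 8 - i)%N) (h (4 * i + 1)%N))) s) g0 (iota 0 4).

Definition k5b_form (f h : nat -> gf32) (n : nat) : gf32 :=
  foldr (fun i s => fadd (fadd (f4mul (f (n - i)%N) (h (4 * i + 3)%N))
     (f4mul (f (n + 8 - i)%N) (h (4 * i + 2)%N))) s) g0 (iota 0 4).

Definition forms (f h : nat -> gf32) : seq gf32 :=
  [seq k3_form f h t | t <- iota 8 8] ++ [seq k5a_form f h n | n <- iota 4 4]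
  ++ [seq k5b_form f h n | n <- iota 4 4].

Definition zeros (s : seq gf32) : bool := allf fzero s.

Lemma foldr_sum (I : Type) (F : I -> gf32) r :
  foldr (fun i s => fadd (F i) s) g0 r = \sum_(i <- r) F i.
Proof. by elim: r => [|i r IH]; rewrite ?big_nil ?big_cons //= IH. Qed.

Lemma forms_opoly h : opoly h -> zeros (forms (bc h) (bc h)).
Proof.
move=> oh; rewrite /zeros allfE /forms !all_cat !all_map; apply/and3P; split; apply/allP => t.
- rewrite mem_iota => /andP[t8 t15]; apply/fzeroP; rewrite -[RHS](@k3 h t oh) ?t8 //.
  exact: foldr_sum.
- rewrite mem_iota => /andP[t8 t15]; apply/fzeroP; rewrite -[RHS](@k5a h t oh) ?t8 //.
  by rewrite /k5a_form foldr_sum; apply: eq_bigr => i _; rewrite !f4mulE.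
- rewrite mem_iota => /andP[t8 t15]; apply/fzeroP; rewrite -[RHS](@k5b h t oh) ?t8 //.
  by rewrite /k5b_form foldr_sum; apply: eq_bigr => i _; rewrite !f4mulE.
Qed.

Section EqForms.
Variables f f' h h' : nat -> gf32.
Hypothesis Ef : forall u, (0 < u < 16)%N -> f u = f' u.
Hypothesis Eh : forall u, (0 < u < 16)%N -> h u = h' u.

Lemma eq_k3_form t : (8 <= t <= 15)%N -> k3_form f h t = k3_form f' h' t.
Proof.
move=> /andP[t8 t15]; rewrite /k3_form !foldr_sum; apply: eq_big_seq => j.
rewrite mem_iota => /andP[_ j8]; rewrite Ef ?Eh //.
  by rewrite subn_gt0 (leq_trans j8) //=; apply: leq_ltn_trans (leq_subr _ _) _.
by rewrite addn1 /= -[16%N]/(2 * 8)%N ltnS; move: j j8; do 8?case=> //.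
Qed.

Lemma eq_k5a_form n : (4 <= n <= 7)%N -> k5a_form f h n = k5a_form f' h' n.
Proof.
move=> Hn; rewrite /k5a_form !foldr_sum; apply: eq_big_seq => i ir.
have : all (fun n => all (fun i => [&& 0 < n - i < 16, 0 < 4 * i + 2 < 16, 0 < n + 8 - i < 16 &
  0 < 4 * i + 1 < 16])%N (iota 0 4)) (iota 4 4) by [].
by move=> /all_iotaP/(_ n Hn)/allP/(_ i ir)/and4P[? ? ? ?]; rewrite !Ef ?Eh.
Qed.

Lemma eq_k5b_form n : (4 <= n <= 7)%N -> k5b_form f h n = k5b_form f' h' n.
Proof.
move=> Hn; rewrite /k5b_form !foldr_sum; apply: eq_big_seq => i ir.
have : all (fun n => all (fun i => [&& 0 < n - i < 16, 0 < 4 * i + 3 < 16, 0 < n + 8 - i < 16 &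
  0 < 4 * i + 2 < 16])%N (iota 0 4)) (iota 4 4) by [].
by move=> /all_iotaP/(_ n Hn)/allP/(_ i ir)/and4P[? ? ? ?]; rewrite !Ef ?Eh.
Qed.

Lemma eq_forms : forms f h = forms f' h'.
Proof.
rewrite /forms; congr (_ ++ (_ ++ _)); apply/eq_in_map => t; rewrite mem_iota => Ht.
- exact: eq_k3_form.
- exact: eq_k5a_form.
- exact: eq_k5b_form.
Qed.
End EqForms.

Lemma forms_addl f f' h : forms (fun u => f u + f' u) h =
  [seq p.1 + p.2 | p <- zip (forms f h) (forms f' h)].
Proof.
rewrite /forms !zip_cat ?size_map ?size_iota // !map_cat !zip_map -!map_comp.
congr (_ ++ (_ ++ _)); apply: eq_map => t /=;
  rewrite /k3_form /k5a_form /k5b_form !foldr_sum -big_split; apply: eq_bigr => i _ /=.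
- by rewrite frootD -!fmulE mulrDl.
- by rewrite !f4mulE !sqr4D !mulrDl addrACA.
- by rewrite !f4mulE !sqr4D !mulrDl addrACA.
Qed.

Lemma forms_addr f h h' : forms f (fun u => h u + h' u) =
  [seq p.1 + p.2 | p <- zip (forms f h) (forms f h')].
Proof.
rewrite /forms !zip_cat ?size_map ?size_iota // !map_cat !zip_map -!map_comp.
congr (_ ++ (_ ++ _)); apply: eq_map => t /=;
  rewrite /k3_form /k5a_form /k5b_form !foldr_sum -big_split; apply: eq_bigr => i _ /=.
- by rewrite -!fmulE mulrDr.
- by rewrite !f4mulE !mulrDr addrACA.
- by rewrite !f4mulE !mulrDr addrACA.
Qed.

Lemma size_forms f h : size (forms f h) = 16%N.
Proof. by rewrite /forms !size_cat !size_map !size_iota. Qed.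

Lemma zeros_zip s t : zeros s -> zeros t -> zeros [seq p.1 + p.2 | p <- zip s t].
Proof.
rewrite /zeros !allfE; elim: s t => [|a s IH] [|b t] //= /andP[/fzeroP -> /IH Hs] /andP[/fzeroP -> /Hs].
by rewrite addr0.
Qed.

Lemma forms_scaler a f h : forms f (fun u => a * h u) = [seq a * x | x <- forms f h].
Proof.
rewrite /forms !map_cat -!map_comp.
congr (_ ++ (_ ++ _)); apply: eq_map => t /=;
  rewrite /k3_form /k5a_form /k5b_form !foldr_sum mulr_sumr; apply: eq_bigr => i _ /=.
- by rewrite -!fmulE mulrCA.
- by rewrite !f4mulE mulrDr !(mulrCA a).
- by rewrite !f4mulE mulrDr !(mulrCA a).
Qed.

Lemma zeros_scaler a f h : zeros (forms f h) -> zeros (forms f (fun u => a * h u)).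
Proof.
by rewrite forms_scaler /zeros !allfE all_map; apply: sub_all => x /= /fzeroP ->; rewrite mulr0.
Qed.

Lemma f4mulZ a b c : f4mul (a * b) c = a ^+ 4 * f4mul b c.
Proof. by rewrite !f4mulE; gfring. Qed.

Lemma zeros_scalel a f h : zeros (forms f h) -> zeros (forms (fun u => a * f u) h).
Proof.
rewrite /zeros !allfE /forms !all_cat !all_map => /and3P[H1 H2 H3]; apply/and3P; split.
- apply: sub_all H1 => t /= /fzeroP; rewrite /k3_form !foldr_sum => E; apply/fzeroP.
  rewrite -[RHS](mulr0 (froot a)) -[X in _ * X]E mulr_sumr; apply: eq_bigr => i _.
  by rewrite frootM -!fmulE mulrA.
- apply: sub_all H2 => t /= /fzeroP; rewrite /k5a_form !foldr_sum => E; apply/fzeroP.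
  rewrite -[RHS](mulr0 (a ^+ 4)) -[X in _ * X]E mulr_sumr; apply: eq_bigr => i _.
  by rewrite !f4mulZ -!faddE -mulrDr.
- apply: sub_all H3 => t /= /fzeroP; rewrite /k5b_form !foldr_sum => E; apply/fzeroP.
  rewrite -[RHS](mulr0 (a ^+ 4)) -[X in _ * X]E mulr_sumr; apply: eq_bigr => i _.
  by rewrite !f4mulZ -!faddE -mulrDr.
Qed.

(** Zero whenever [f], [h] and their sum satisfy the identities. Additivity in [h] makes this a
    linear system over GF(2). *)
Definition pol (f h : nat -> gf32) : seq gf32 := [seq p.1 + p.2 | p <- zip (forms f h) (forms h f)].

Lemma size_pol f h : size (pol f h) = 16%N.
Proof. by rewrite /pol size_map size_zip !size_forms. Qed.

Lemma zip_addACA s1 s2 t1 t2 : size s1 = size s2 -> size t1 = size t2 -> size s1 = size t1 ->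
  [seq p.1 + p.2 | p <- zip [seq p.1 + p.2 | p <- zip s1 s2] [seq p.1 + p.2 | p <- zip t1 t2]]
  = [seq p.1 + p.2 | p <- zip [seq p.1 + p.2 | p <- zip s1 t1] [seq p.1 + p.2 | p <- zip s2 t2]]
    :> seq gf32.
Proof.
elim: s1 s2 t1 t2 => [|a s1 IH] [|b s2] [|c t1] [|d t2] //= [e1] [e2] [e3].
by rewrite addrACA IH.
Qed.

Lemma polD f h h' : pol f (fun u => h u + h' u) = [seq p.1 + p.2 | p <- zip (pol f h) (pol f h')].
Proof. by rewrite /pol forms_addl forms_addr zip_addACA // ?size_map ?size_zip !size_forms. Qed.

Lemma eq_pol f h h' : (forall u, (0 < u < 16)%N -> h u = h' u) -> pol f h = pol f h'.
Proof.
move=> E; rewrite /pol (@eq_forms f f h h') // (@eq_forms h h' f f) //.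
Qed.

(** Selects one of the 16 * 5 scalar equations over GF(2) into which the vanishing of [pol]
    splits. *)
Definition bitqs (q s : nat) (v : seq gf32) : bool := nth false (fbits (nth g0 v q)) s.

Lemma bitqsD q s v w : size v = 16%N -> size w = 16%N ->
  (q < 16)%N -> (s < 5)%N ->
  bitqs q s [seq p.1 + p.2 | p <- zip v w] = bitqs q s v (+) bitqs q s w.
Proof.
move=> sv sw q16 s5; rewrite /bitqs (nth_map (g0, g0)) ?size_zip ?sv ?sw //.
rewrite nth_zip ?sv ?sw //= fbitsD (nth_map (false, false)) ?size_zip ?size_fbits //.
by rewrite nth_zip ?size_fbits.
Qed.

Definition comb (x : seq bool) (E : seq (nat -> gf32)) (u : nat) : gf32 :=
  foldr (fun p s => if p.1 then p.2 u + s else s) 0 (zip x E).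

Lemma bdot_comb f q s x E : (q < 16)%N -> (s < 5)%N ->
  bdot [seq bitqs q s (pol f e) | e <- E] x = bitqs q s (pol f (comb x E)).
Proof.
move=> q16 s5; have z0 : bitqs q s (pol f (fun=> 0)) = false.
  have := @bitqsD q s _ _ (size_pol f (fun=> 0)) (size_pol f (fun=> 0)) q16 s5.
  have e : pol f (fun=> (0 : gf32) + 0) = pol f (fun=> 0) by apply: eq_pol => u _; apply: addr0.
  by rewrite -polD e; case: (bitqs q s _).
elim: E x => [|e E IH] [|b x]; rewrite /bdot //= -/(bdot _ _) IH.
case: b => //=; last by rewrite andbF.
rewrite andbT -bitqsD ?size_pol // -polD.
by congr (bitqs _ _ _); apply: eq_pol.
Qed.

Lemma comb_cat x1 x2 E1 E2 u : size x1 = size E1 ->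
  comb (x1 ++ x2) (E1 ++ E2) u = comb x1 E1 u + comb x2 E2 u.
Proof.
rewrite /comb; elim: x1 E1 => [|b x1 IH] [|e E1] //= [/IH ->].
by case: b; rewrite ?addrA.
Qed.

(** The second entry, at 15, makes the coefficients sum to zero: combinations of these vectors are
    the polynomials that vanish at 1. *)
Definition unit_vec (a : gf32) (u0 u : nat) : gf32 :=
  if (u == u0) || (u == 15)%N then a else g0.

Definition unit_vecs (u0 : nat) : seq (nat -> gf32) := [seq unit_vec a u0 | a <- gf_basis].

Lemma comb_unit a u0 u : comb (fbits a) (unit_vecs u0) u = unit_vec a u0 u.
Proof.
by rewrite /comb /unit_vecs /unit_vec; case: a => /=; case: (_ || _) => //=; rewrite ?addr0.
Qed.

Definition all_vecs : seq (nat -> gf32) := flatten [seq unit_vecs u0 | u0 <- iota 1 14].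

(** Five bits for each of the coefficients 1 to 14; coefficient 15 is recovered as their sum. *)
Definition encode (k : nat -> gf32) : seq bool := flatten [seq fbits (k u) | u <- iota 1 14].

Definition decode (x : seq bool) : seq gf32 :=
  let ks := [seq fofbits c | c <- reshape (nseq 14 5) x] in rcons ks (foldr fadd g0 ks).

Lemma comb_encode k r u :
  comb (flatten [seq fbits (k u) | u <- r]) (flatten [seq unit_vecs u0 | u0 <- r]) u
  = \sum_(u0 <- r) unit_vec (k u0) u0 u.
Proof.
elim: r => [|u0 r IH]; first by rewrite big_nil.
rewrite -[flatten [seq fbits (k u1) | u1 <- u0 :: r]]/(fbits (k u0) ++ flatten [seq fbits (k u1) | u1 <- r]).
rewrite -[flatten [seq unit_vecs u1 | u1 <- u0 :: r]]/(unit_vecs u0 ++ flatten [seq unit_vecs u1 | u1 <- r]).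
by rewrite big_cons comb_cat ?size_fbits ?size_map // IH comb_unit.
Qed.

Lemma size_encode k : size (encode k) = 70%N.
Proof. by rewrite /encode size_flatten /shape -map_comp /= !size_fbits. Qed.

Lemma foldr_fadd_map (I : Type) (F : I -> gf32) r : foldr fadd g0 (map F r) = \sum_(i <- r) F i.
Proof. by elim: r => [|i r IH]; rewrite ?big_nil ?big_cons //= IH. Qed.

Lemma sum_iota15 (k : nat -> gf32) :
  \sum_(u <- iota 1 15) k u = \sum_(u <- iota 1 14) k u + k 15%N.
Proof. by rewrite -[iota 1 15]/(iota 1 14 ++ [:: 15%N]) big_cat big_seq1. Qed.

Lemma decode_encode k : \sum_(u <- iota 1 15) k u = 0 ->
  decode (encode k) = [seq k u | u <- iota 1 15].
Proof.
rewrite sum_iota15 => /add_eq0P S.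
rewrite /decode /encode.
have -> : nseq 14 5%N = shape [seq fbits (k u) | u <- iota 1 14].
  by rewrite /shape -map_comp /= !size_fbits.
rewrite flattenK -map_comp (eq_map (fun u => fbitsK (k u))) foldr_fadd_map S.
by rewrite -[iota 1 15]/(iota 1 14 ++ [:: 15%N]) map_cat cats1.
Qed.

Definition vec (c : seq gf32) (u : nat) : gf32 := nth g0 c u.-1.

Definition pol_rows (c : seq gf32) : seq (seq bool) :=
  let cols := [seq pol (vec c) e | e <- all_vecs] in
  flatten [seq [seq [seq bitqs q s v | v <- cols] | s <- iota 0 5] | q <- iota 0 16].

Definition zero_forms (f h : nat -> gf32) : bool :=
  if allf (fun t => fzero (k3_form f h t)) (iota 8 8) then
  if allf (fun n => fzero (k5a_form f h n)) (iota 4 4) then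
  allf (fun n => fzero (k5b_form f h n)) (iota 4 4) else false else false.

Lemma zero_formsE f h : zero_forms f h = zeros (forms f h).
Proof.
rewrite /zero_forms /zeros /forms !allfE !all_cat !all_map /preim.
by case: all => //; case: all.
Qed.

(** The kernel vector stands for k = h + a f, which vanishes at 1 when a = h(1) / f(1). So one
    enumeration of the kernel serves all four ratios a; k = 0 is the allowed case h = a f. *)
Definition pair_leaf (c : seq gf32) (f : gf32 -> gf32) (x : seq bool) : bool :=
  let ks := decode x in
  if zeros ks then true else
  allf (fun a =>
    let hs := [seq fadd (fmul a p.1) p.2 | p <- zip c ks] in
    if zero_forms (vec hs) (vec hs) then
      let h := memo (hpoly hs) in
      if opolyb h then if opolyb (fun x => fadd (f x) (h x)) then false else true else true
    else true) [:: g2; g4; g8; g16].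

Lemma pair_leafP c f x ks a hs : pair_leaf c f x -> decode x = ks -> ~~ zeros ks ->
  a \in [:: g2; g4; g8; g16] -> [seq fadd (fmul a p.1) p.2 | p <- zip c ks] = hs ->
  zero_forms (vec hs) (vec hs) -> opolyb (memo (hpoly hs)) ->
  opolyb (fun x => fadd (f x) (memo (hpoly hs) x)) -> False.
Proof.
rewrite /pair_leaf => H <- /negPf Z ab <- e1 e2 e3; move: H; rewrite Z => H.
by have := allf_mem H ab; rewrite e1 e2 e3.
Qed.

Definition pairs_ok (c : seq gf32) : bool :=
  walk (plan 70 (pol_rows c)) (pair_leaf c (memo (hpoly c))).

Definition coefs_ok (c : seq gf32) : bool :=
  let f := memo (hpoly c) in
  (size c == 15%N) && (opolyb f && all (fun u => feq (fsum (fun x => fmul (f x) (x ^+ (31 - 2 * u)))) (vec c u))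
    (iota 1 15)).

Lemma oval_coefs_ok : all coefs_ok oval_coefs.
Proof. by vm_compute. Qed.

Lemma coefsP c : c \in oval_coefs ->
  [/\ size c = 15%N, opoly (hpoly c) & forall u, (0 < u < 16)%N -> bc (hpoly c) u = vec c u].
Proof.
move/allP: oval_coefs_ok => H /H/andP[/eqP sc /andP[/opolybP oc Hc]]; split=> //.
  by apply: eq_opoly oc => x; rewrite memoE.
move=> u Hu; have /feqP <- := all_iotaP Hc Hu.
apply: etrans (sum_gfE (fun x => fmul (memo (hpoly c) x) (x ^+ (31 - 2 * u)))).
by apply: eq_bigr => x _; rewrite memoE.
Qed.

Lemma all_vecs_size : size all_vecs = 70%N. Proof. by []. Qed.

(** The shape in which biadditivity expands the forms of a sum f + h: [A] and [D] belong to f and h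
    alone, [B] and [C] are the mixed terms. *)
Lemma zeros_middle (A B C D : seq gf32) :
  zeros [seq p.1 + p.2 | p <- zip [seq p.1 + p.2 | p <- zip A B] [seq p.1 + p.2 | p <- zip C D]] ->
  zeros A -> zeros D -> size A = size B -> size B = size C -> size C = size D ->
  zeros [seq p.1 + p.2 | p <- zip B C].
Proof.
rewrite /zeros !allfE; elim: A B C D => [|a A IH] [|b B] [|c C] [|d D] //=.
move=> /andP[e /IH H] /andP[/fzeroP a0 /H{}H] /andP[/fzeroP d0 /H{}H] [/H{}H] [/H{}H] [/H ->].
by move: e; rewrite a0 d0 add0r addr0 => ->.
Qed.

(** Adding a multiple of [c] preserves the equation, since scaling either argument preserves the
    zeros of the forms. This allows the value at 1 to be normalised to 0. *)
Lemma pol_eq0 c h a : c \in oval_coefs -> opoly h -> opoly (fun x => hpoly c x + h x) ->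
  zeros (pol (vec c) (fun u => bc h u + a * vec c u)).
Proof.
move=> cc oh ofh; have [sc oc Hc] := coefsP cc.
have F1 := forms_opoly oc; have F2 := forms_opoly oh; have F3 := forms_opoly ofh.
have {}F1 : zeros (forms (vec c) (vec c)) by rewrite -(@eq_forms _ (vec c) _ (vec c) Hc Hc).
have E3 u : (0 < u < 16)%N -> bc (fun x => hpoly c x + h x) u = vec c u + bc h u.
  by move=> Hu; rewrite bcD Hc.
rewrite (eq_forms E3 E3) forms_addl !forms_addr in F3.
rewrite (polD _ (bc h) (fun u => a * vec c u)).
apply: zeros_zip; last by apply: zeros_zip; [apply: zeros_scaler | apply: zeros_scalel].
by rewrite /pol; apply: (zeros_middle F3 F1 F2); rewrite !size_forms.
Qed.

Lemma encode_comb (k : nat -> gf32) u : \sum_(u <- iota 1 15) k u = 0 -> (0 < u < 16)%N ->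
  comb (encode k) all_vecs u = k u.
Proof.
move=> Sk /andP[u0 u16]; rewrite comb_encode.
have [->|u15] := eqVneq u 15%N.
  move: Sk; rewrite sum_iota15.
  by move=> /add_eq0P <-; apply: eq_bigr => v _; rewrite /unit_vec orbT.
rewrite (bigD1_seq u); [|by rewrite mem_iota u0 ltn_neqAle u15|exact: iota_uniq].
rewrite big1 => [|v vu]; first by rewrite /unit_vec eqxx /= addr0.
by rewrite /unit_vec eq_sym (negPf vu) (negPf u15).
Qed.

Lemma pol_rows_size c : all (fun r => size r == 70%N) (pol_rows c).
Proof.
apply/allP => r /flattenP[rs /mapP[q _ ->] /mapP[s _ ->]].
by rewrite !size_map all_vecs_size.
Qed.

Lemma pol_rows_encode c (k : nat -> gf32) : \sum_(u <- iota 1 15) k u = 0 ->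
  zeros (pol (vec c) k) -> all (fun r => ~~ bdot r (encode k)) (pol_rows c).
Proof.
move=> Sk Hpol; apply/allP => r /flattenP[rs /mapP[q Hq ->] /mapP[s Hs ->]].
move: Hq Hs; rewrite !mem_iota => /andP[_ q16] /andP[_ s5].
rewrite -map_comp (bdot_comb _ _ _ q16 s5) (eq_pol _ (fun u => encode_comb Sk)) /bitqs.
suff -> : nth g0 (pol (vec c) k) q = 0 by case: s s5 => [|[|[|[|[|s]]]]].
by move: Hpol; rewrite /zeros allfE => /all_nthP-/(_ g0 q); rewrite size_pol => /(_ q16)/fzeroP.
Qed.

Lemma pairs_ok_leaf c (k : nat -> gf32) : pairs_ok c -> \sum_(u <- iota 1 15) k u = 0 ->
  zeros (pol (vec c) k) -> pair_leaf c (memo (hpoly c)) (encode k).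
Proof.
rewrite /pairs_ok => pc Sk Hpol.
exact: (walkP (pol_rows_size c) (size_encode k) pc (pol_rows_encode Sk Hpol)).
Qed.

Lemma pairs_okP c h a : c \in oval_coefs -> pairs_ok c -> a \in [:: g2; g4; g8; g16] ->
  opoly h -> opoly (fun x => hpoly c x + h x) -> h 1 = a * hpoly c 1 ->
  h =1 (fun x => a * hpoly c x).
Proof.
move=> cc pc ab oh ofh h1; have [sc oc Hc] := coefsP cc.
pose k u := bc h u + a * vec c u.
have ev g : opoly g -> g 1 = \sum_(u <- iota 1 15) bc g u.
  by move=> og; rewrite (opolyE 1 og); apply: eq_bigr => u _; rewrite expr1n mulr1.
have Sk : \sum_(u <- iota 1 15) k u = 0.
  rewrite big_split -mulr_sumr -ev // h1 ev //=.
  rewrite (_ : \sum_(u <- iota 1 15) bc (hpoly c) u = \sum_(u <- iota 1 15) vec c u) ?addff //.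
  by apply: eq_big_seq => u; rewrite mem_iota => Hu; apply: Hc.
have Hpol := pol_eq0 a cc oh ofh; rewrite -/k in Hpol.
have leaf := pairs_ok_leaf pc Sk Hpol.
have hs : [seq fadd (fmul a p.1) p.2 | p <- zip c [seq k u | u <- iota 1 15]] =
    [seq bc h u | u <- iota 1 15].
  apply: (@eq_from_nth _ g0); rewrite size_map size_zip size_map size_iota sc //.
  move=> i; rewrite minnn => i15; rewrite (nth_map (g0, g0)) ?size_zip ?size_map ?size_iota ?sc //.
  rewrite nth_zip ?size_map ?size_iota // !(nth_map 0%N) ?size_iota // nth_iota // add1n.
  rewrite -[LHS]/(fadd (fmul a (nth g0 c i)) (bc h i.+1 + a * nth g0 c i)).
  by move: (bc h i.+1) (nth g0 c i) => x y; gfring.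
have vE u : (0 < u < 16)%N -> vec [seq bc h u | u <- iota 1 15] u = bc h u.
  by case: u => // u /andP[_ u15]; rewrite /vec (nth_map 0%N) ?size_iota // nth_iota.
have om : opolyb (memo (hpoly [seq bc h u | u <- iota 1 15])).
  apply/opolybP; apply: (@eq_opoly h) => // x; rewrite memoE; exact: opoly_hpoly.
have om' : opolyb (fun x => fadd (memo (hpoly c) x) (memo (hpoly [seq bc h u | u <- iota 1 15]) x)).
  apply/opolybP; apply: eq_opoly ofh => x; rewrite !memoE -opoly_hpoly //.
have [Z x|nZ] := boolP (zeros [seq k u | u <- iota 1 15]).
  have {}Z u : (0 < u < 16)%N -> bc h u = a * vec c u.
    move=> Hu; apply: add_eq0P; move: Z; rewrite /zeros allfE all_map => /allP/(_ u).
    by rewrite mem_iota => /(_ Hu)/fzeroP.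
  rewrite (opolyE x oh) (opolyE x oc) mulr_sumr; apply: eq_big_seq => u; rewrite mem_iota => Hu.
  by rewrite Z // Hc // mulrA.
case: (pair_leafP leaf (decode_encode Sk) nZ ab hs).
- by rewrite zero_formsE (eq_forms vE vE) (forms_opoly oh).
- exact: om.
- exact: om'.
Qed.

Lemma pairs_ok1 : all pairs_ok (take 5 (behead oval_coefs)).
Proof. vm_cast_no_check (erefl true). Qed.
Lemma pairs_ok2 : pairs_ok (nth [::] oval_coefs 6).
Proof. vm_cast_no_check (erefl true). Qed.
Lemma pairs_ok3 : all pairs_ok (take 12 (drop 7 oval_coefs)).
Proof. vm_cast_no_check (erefl true). Qed.
Lemma pairs_ok4 : all pairs_ok (take 13 (drop 19 oval_coefs)).
Proof. vm_cast_no_check (erefl true). Qed.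

(** * The classes of the monomials x^30, x^4, x^8 and x^16 *)

Definition mono_coefs : seq (seq gf32) := head [::] oval_coefs :: drop 32 oval_coefs.

Lemma oval_coefs_split c : c \in oval_coefs -> c \in mono_coefs \/ pairs_ok c.
Proof.
have -> : oval_coefs = head [::] oval_coefs :: take 5 (behead oval_coefs) ++
  [:: nth [::] oval_coefs 6] ++ take 12 (drop 7 oval_coefs) ++ take 13 (drop 19 oval_coefs)
  ++ drop 32 oval_coefs by [].
rewrite in_cons !mem_cat mem_seq1 => /orP[H|/or4P[|||/orP[]]].
- by left; rewrite in_cons H.
- by move/(allP pairs_ok1); right.
- by move/eqP->; right; apply: pairs_ok2.
- by move/(allP pairs_ok3); right.
- by move/(allP pairs_ok4); right.
- by move=> H; left; rewrite in_cons H orbT.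
Qed.

(** Up to a factor, all functions equivalent to monomials: x^(2^k) is additive, hence unchanged by
    translations, and x^(32 - 2^k) is its image under [T3], for which [e] records the
    translation. *)
Definition mono (k : nat) (o : option gf32) (x : gf32) : gf32 :=
  if o is Some e then (x + e) ^+ (32 - 2 ^ k) + e ^+ (32 - 2 ^ k) else x ^+ (2 ^ k).

Definition mono_fun (h : gf32 -> gf32) : Prop :=
  exists k o a, [/\ (0 < k < 5)%N, a != 0 & h =1 (fun x => a * mono k o x)].

Lemma eq_mono_fun h g : h =1 g -> mono_fun h -> mono_fun g.
Proof. by move=> E [k [o [a [Hk a0 H]]]]; exists k, o, a; split=> // x; rewrite -E. Qed.

Lemma mono_T1 e h : mono_fun h -> mono_fun (T1 e h).
Proof.
move=> [k [o [a [Hk a0 H]]]]; exists k, (omap (fun d => e + d) o), a; split=> // x.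
rewrite /T1 !H -mulrDr; congr (_ * _); case: o {H} => [d|] /=.
  rewrite (addrA x e d); move: ((x + e + d) ^+ _) (d ^+ _) ((e + d) ^+ _) => p q r; gfring.
apply/eqP; rewrite -feqE; move: e; apply/allgP; move: x; apply/allgP; move: k Hk.
by apply: (@all_iotaP _ 1 4); vm_compute.
Qed.

Lemma mono_T2 c b h : c != 0 -> b != 0 -> mono_fun h -> mono_fun (T2 c b h).
Proof.
move=> c0 b0 [k [o [a [Hk a0 H]]]].
exists k, (omap (fun d => d / b) o), (c * a * b ^+ (if o is Some _ then (32 - 2 ^ k)%N else 2 ^ k)).
split=> // [|x]; first by rewrite !mulf_neq0 // expf_neq0.
rewrite /T2 !H mulrA -[RHS]mulrA; congr (_ * _); case: o {H} => [d|] /=; last by rewrite exprMn.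
by rewrite mulrDr -!exprMn mulrDr [b * (d / b)]mulrC divfK.
Qed.

Lemma mono_T3 h : mono_fun h -> mono_fun (T3 h).
Proof.
move=> [k [o [a [Hk a0 H]]]].
pose o' := if o is Some d then (if d == 0 then None else Some d^-1) else Some 0.
(* The proportionality factor is read off at 1, or at [g2] if [mono k o'] is 0 at 1; the computation
   then confirms it for all arguments. *)
pose s := T3 (mono k o) 1 / mono k o' 1.
pose s' := if mono k o' 1 == 0 then T3 (mono k o) g2 / mono k o' g2 else s.
have E : allg (fun x => feq (T3 (mono k o) x) (s' * mono k o' x)) && (s' != 0).
  rewrite {}/s' {}/s {}/o'; move: k Hk {H}; case: o => [d|].
    move=> k Hk; move: d; apply/allgP; move: k Hk.
    by apply: (@all_iotaP _ 1 4); vm_compute.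
  by apply: (@all_iotaP _ 1 4); vm_compute.
case/andP: E => /allgP E s0; exists k, o', (a * s'); split=> // [|x]; first exact: mulf_neq0.
by rewrite /T3 H mulrCA -/(T3 (mono k o) x) (feqP _ _ (E x)) mulrA.
Qed.

Lemma mono_T4 h : mono_fun h -> mono_fun (T4 h).
Proof.
move=> [k [o [a [Hk a0 H]]]]; exists k, (omap (fun d => d ^+ 2) o), (a ^+ 2); split=> // [|x].
  exact: expf_neq0.
rewrite /T4 H exprMn; congr (_ * _); case: o {H} => [d|] /=.
  by rewrite sqrD2 -!exprM ![(_ * 2)%N]mulnC !exprM sqrD2 froot_sq.
by rewrite -exprM mulnC exprM froot_sq.
Qed.

(** The moves are undone: on functions vanishing at 0, [T1 e] and [T3] are involutions, [T2] has an
    inverse of its own kind, and four more uses of [T4] complete the identity. *)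
Lemma tequiv_mono h g : opoly h -> mono_fun g -> tequiv h g -> mono_fun h.
Proof.
move=> oh mg H; elim: H oh mg => {h g} [h g E|e h g _ IH|a b h g a0 b0 _ IH|h g _ IH|h g _ IH] oh mg.
- by apply: eq_mono_fun mg => x; rewrite E.
- have [h0 _ _] := oh; apply: (eq_mono_fun _ (mono_T1 e (IH (opoly_T1 e oh) mg))) => x.
  rewrite /T1 (_ : x + e + e = x) ?addff ?h0; last by rewrite -addrA addff addr0.
  by move: (h x) (h e) => p q; gfring.
- have := mono_T2 (invr_neq0 a0) (invr_neq0 b0) (IH (opoly_T2 a0 b0 oh) mg).
  by apply: eq_mono_fun => x; rewrite /T2 mulrA mulVf // mul1r mulVKf.
- have [h0 _ _] := oh; apply: (eq_mono_fun _ (mono_T3 (IH (opoly_T3 oh) mg))) => x.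
  rewrite /T3 invrK; have [->|x0] := eqVneq x 0; first by rewrite h0 mul0r.
  by rewrite mulVKf.
- have H := IH (opoly_T4 oh) mg; apply: (eq_mono_fun _ (mono_T4 (mono_T4 (mono_T4 (mono_T4 H))))) => x.
  have e32 (y : gf32) : y ^+ 2 ^+ 2 ^+ 2 ^+ 2 ^+ 2 = y.
    by apply/eqP; rewrite -feqE; move: y; apply/allgP; vm_compute.
  by rewrite /T4 e32; congr h; case: x.
Qed.

(** A candidate h is a multiple b n of some n = [mono k o], and h(1) = a f(1) forces b. *)
Definition mono_pairs_ok : bool :=
  allf (fun c => let f := memo (hpoly c) in
    allf (fun a => allf (fun k => allf (fun o =>
      let n := memo (mono k o) in
      if fzero (n g1) then true else
      let b := fmul (fmul a (f g1)) (finv (n g1)) in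
      if allg (fun x => feq (fmul b (n x)) (fmul a (f x))) then true else
      if opolyb (memo (fun x => fadd (f x) (fmul b (n x)))) then false else true)
      (None :: [seq Some e | e <- gf_enum])) (iota 1 4)) [:: g2; g4; g8; g16]) mono_coefs.

Lemma mono_pairs : mono_pairs_ok.
Proof. vm_cast_no_check (erefl true). Qed.

Definition mono_idx : bool :=
  all (fun c => has (fun k => has (fun o => allg (fun x => feq (hpoly c x) (mono k o x)))
     [:: None; Some g0]) (iota 1 4)) mono_coefs.

Lemma mono_coefs_mono c : c \in mono_coefs -> mono_fun (hpoly c).
Proof.
have : mono_idx by vm_compute.
move=> /allP H /H/hasP[k]; rewrite mem_iota => Hk /hasP[o _ /allgP E].
by exists k, o, 1; split=> [||x] //; rewrite ?oner_neq0 // mul1r; apply/feqP.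
Qed.

Lemma mono_pairP c h a : c \in mono_coefs -> a \in [:: g2; g4; g8; g16] -> mono_fun h ->
  opoly (fun x => hpoly c x + h x) -> h 1 = a * hpoly c 1 -> a * hpoly c 1 != 0 ->
  h =1 (fun x => a * hpoly c x).
Proof.
move=> cc ab [k [o [b [Hk b0 hE]]]] ofh h1 ne.
have := mono_pairs; rewrite /mono_pairs_ok => /allf_mem-/(_ c cc)/allf_mem-/(_ a ab).
move=> /allf_mem-/(_ k); rewrite mem_iota => /(_ Hk)/allf_mem-/(_ o).
have -> : o \in None :: [seq Some e | e <- gf_enum].
  case: o {hE} => [e|//]; rewrite in_cons; apply/orP; right; apply/mapP.
  by exists e => //; case: e.
move=> /(_ isT).
have n1 : mono k o 1 != 0.
  by apply: contraNneq ne => E; rewrite -h1 hE E mulr0.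
rewrite !memoE; case: fzeroP => [E|_]; first by rewrite [mono k o g1]E eqxx in n1.
have -> : fmul (fmul a (hpoly c g1)) (finv (mono k o g1)) = b.
  apply: etrans (_ : a * hpoly c 1 / mono k o 1 = _) => //.
  by rewrite -h1 hE mulfK.
case: allgP => [E _ x|_]; first by rewrite hE; have /feqP := E x; rewrite !memoE.
case: opolybP => // -[]; apply: eq_opoly ofh => x.
by rewrite memoE !memoE hE.
Qed.

(** * Additive families of o-polynomials *)

Record additive_family (H : gf32 -> gf32 -> gf32) : Prop := AdditiveFamily {
  familyD : forall a b x, H (a + b) x = H a x + H b x;
  family_opoly : forall a, a != 0 -> opoly (H a) }.

Definition scalar_family (H : gf32 -> gf32 -> gf32) : Prop :=
  forall a, exists k, forall x, H a x = k * H 1 x.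

Lemma family0 H x : additive_family H -> H 0 x = 0.
Proof.
by case=> D _; apply: (addrI (H 0 x)); rewrite -D !addr0.
Qed.

Lemma opoly_neq0 h x : opoly h -> x != 0 -> h x != 0.
Proof. by case=> h0 hi _; apply: contraNneq => E; apply/eqP/hi; rewrite E h0. Qed.

(* It suffices to find the multiples of [H 1] by a basis: evaluation at 1 is injective on the family. *)
Lemma scalar_family_basis H : additive_family H ->
  (forall a b, b \in [:: g2; g4; g8; g16] -> H a 1 = b * H 1 1 -> forall x, H a x = b * H 1 x) ->
  scalar_family H.
Proof.
move=> fH Hb; have [D O] := fH.
have inj : injective (fun a => H a 1).
  move=> a b /= E; apply/eqP; rewrite -addf_eq0; apply: contraT => ab.
  have := opoly_neq0 (O _ ab) (oner_neq0 _); rewrite D E addff eqxx //.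
have onto b : exists a, forall x, H a x = b * H 1 x.
  elim/gf_span: b => [|b b' [a Ha] [a' Ha']|b].
  - by exists 0 => x; rewrite family0 // mul0r.
  - by exists (a + a') => x; rewrite D Ha Ha' mulrDl.
  rewrite in_cons => /orP[/eqP->|bb]; first by exists 1 => x; rewrite mul1r.
  have [g _ gK] := injF_bij inj.
  by exists (g (b * H 1 1)); apply: Hb => //; rewrite gK.
have h1 : H 1 1 != 0 by apply: (opoly_neq0 (O _ (oner_neq0 _)) (oner_neq0 _)).
move=> a; have [a' Ha'] := onto (H a 1 / H 1 1).
exists (H a 1 / H 1 1) => x; rewrite -Ha'; congr (H _ x); apply: inj => /=.
by rewrite Ha' divfK.
Qed.

Lemma family_T (T : (gf32 -> gf32) -> gf32 -> gf32) H :
  (forall h g x, T (fun y => h y + g y) x = T h x + T g x) ->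
  (forall h g, h =1 g -> T h =1 T g) ->
  (forall h, opoly h -> opoly (T h)) ->
  additive_family H -> additive_family (fun a => T (H a)).
Proof.
move=> TD Te To [D O]; split=> [a b x|a /O/To //].
by rewrite -TD; apply: Te => y; rewrite D.
Qed.

(** [P] restricts the members of the family: the comparison at a monomial [f] is only available with
    other functions equivalent to monomials. *)
Definition scalar_at (P : (gf32 -> gf32) -> Prop) (f : gf32 -> gf32) : Prop :=
  forall H, additive_family H -> (forall a, a != 0 -> P (H a)) -> H 1 =1 f -> scalar_family H.

(** Every move is additive in the function, so it carries families to families. The factor found for
    the moved family is also one for the original, except under [T4], where its square root is. *)
Lemma scalar_at_tequiv (P : (gf32 -> gf32) -> Prop) f g :
  (forall h k, h =1 k -> P h -> P k) ->
  (forall e h, P h -> P (T1 e h)) -> (forall a b h, a != 0 -> b != 0 -> P h -> P (T2 a b h)) ->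
  (forall h, P h -> P (T3 h)) -> (forall h, P h -> P (T4 h)) ->
  tequiv f g -> scalar_at P g -> scalar_at P f.
Proof.
move=> Pe P1 P2 P3 P4; elim=> {f g} [f g E|e f g _ IH|a b f g a0 b0 _ IH|f g _ IH|f g _ IH] /=.
- by move=> Pg H fH PH H1; apply: Pg => // x; rewrite H1 E.
- move=> /IH Pf H fH PH H1.
  have f1 : additive_family (fun a => T1 e (H a)).
    apply: (@family_T (T1 e)) fH => [h k x|h k E x|h].
    - by rewrite /T1 addrACA.
    - by rewrite /T1 !E.
    - exact: opoly_T1.
  have S : scalar_family (fun a => T1 e (H a)).
    by apply: Pf f1 _ _ => [a /PH/P1 //|x]; rewrite /T1 !H1.
  have H0 a : H a 0 = 0.
    have [->|/(family_opoly fH)[] //] := eqVneq a 0; exact: family0.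
  move=> a; have [k Hk] := S a; exists k => x.
  have He : H a e = k * H 1 e.
    by have := Hk e; rewrite /T1 addff !H0 !add0r.
  have := Hk (x + e); rewrite /T1 -addrA addff addr0 He mulrDr => /eqP.
  by rewrite (inj_eq (addIr _)) => /eqP.
- move=> /IH Pf H fH PH H1.
  have f1 : additive_family (fun c => T2 a b (H c)).
    apply: (@family_T (T2 a b)) fH => [h k x|h k E x|h].
    - by rewrite /T2 mulrDr.
    - by rewrite /T2 !E.
    - exact: opoly_T2.
  have S : scalar_family (fun c => T2 a b (H c)).
    by apply: Pf f1 _ _ => [c /PH/(P2 a b) //|x]; [apply | rewrite /T2 !H1].
  move=> c; have [k Hk] := S c; exists k => x.
  have := Hk (b^-1 * x); rewrite /T2 mulVKf // mulrCA => /(mulfI a0).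
  by [].
- move=> /IH Pf H fH PH H1.
  have f1 : additive_family (fun c => T3 (H c)).
    apply: (@family_T T3) fH => [h k x|h k E x|h].
    - by rewrite /T3 mulrDr.
    - by rewrite /T3 !E.
    - exact: opoly_T3.
  have S : scalar_family (fun c => T3 (H c)).
    by apply: Pf f1 _ _ => [c /PH/P3 //|x]; rewrite /T3 !H1.
  have H0 a : H a 0 = 0.
    have [->|/(family_opoly fH)[] //] := eqVneq a 0; exact: family0.
  move=> c; have [k Hk] := S c; exists k => x.
  have [->|x0] := eqVneq x 0; first by rewrite !H0 mulr0.
  have := Hk x^-1; rewrite /T3 invrK mulrCA => /(mulfI (invr_neq0 x0)).
  by [].
- move=> /IH Pf H fH PH H1.
  have f1 : additive_family (fun c => T4 (H c)).
    apply: (@family_T T4) fH => [h k x|h k E x|h].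
    - by rewrite /T4 sqrD2.
    - by rewrite /T4 !E.
    - exact: opoly_T4.
  have S : scalar_family (fun c => T4 (H c)).
    by apply: Pf f1 _ _ => [c /PH/P4 //|x]; rewrite /T4 !H1.
  move=> c; have [k Hk] := S c; exists (froot k) => x; apply: sqr_inj => /=.
  by have := Hk (x ^+ 2); rewrite /T4 sqr_froot => ->; rewrite exprMn froot_sq.
Qed.

Lemma add1_neq0 (b : gf32) : b \in [:: g2; g4; g8; g16] -> b != 0 /\ b != 1.
Proof. by rewrite !inE => /or4P[] /eqP ->. Qed.

Lemma family_pair H a b : additive_family H -> b \in [:: g2; g4; g8; g16] ->
  H a 1 = b * H 1 1 -> [/\ a != 0, opoly (H a) & opoly (fun x => H 1 x + H a x)].
Proof.
move=> fH /add1_neq0[b0 b1] E; have [D O] := fH.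
have h1 : H 1 1 != 0 by apply: (opoly_neq0 (O _ (oner_neq0 _)) (oner_neq0 _)).
have a0 : a != 0.
  by apply: contra_neq (mulf_neq0 b0 h1) => E0; rewrite -E E0 family0.
split=> //; first exact: O.
have a1 : 1 + a != 0.
  rewrite addf_eq0; apply: contra_neq b1 => E1; apply: (mulIf h1); rewrite mul1r -E.
  by rewrite -E1.
by apply: eq_opoly (O _ a1) => x; rewrite D.
Qed.

Lemma scalar_at_pairs c : c \in oval_coefs -> pairs_ok c -> scalar_at (fun=> True) (hpoly c).
Proof.
move=> cc pc H fH _ H1; apply: scalar_family_basis => // a b bb E x.
have [a0 oa oa1] := family_pair fH bb E.
rewrite H1; apply: (pairs_okP cc pc bb oa); last by rewrite E H1.
by apply: eq_opoly oa1 => y; rewrite H1.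
Qed.

Lemma scalar_at_mono c : c \in mono_coefs -> scalar_at mono_fun (hpoly c).
Proof.
move=> cc H fH MH H1; apply: scalar_family_basis => // a b bb E x.
have [a0 oa oa1] := family_pair fH bb E; have [b0 _] := add1_neq0 bb.
rewrite H1; apply: (mono_pairP cc bb (MH _ a0)).
- by apply: eq_opoly oa1 => y; rewrite H1.
- by rewrite E H1.
- rewrite -H1 mulf_neq0 //; apply: opoly_neq0 (oner_neq0 _).
  by apply: (family_opoly fH); apply: oner_neq0.
Qed.

(** Stands in for excluded middle, the alternatives being propositions without a boolean form. *)
Lemma gf_all_or_ex (P Q : gf32 -> Prop) : (forall x, P x \/ Q x) ->
  (forall x, P x) \/ (exists x, Q x).
Proof.
move=> PQ; suff [H|H] : (forall x, x \in gf_enum -> P x) \/ (exists x, Q x).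
- by left=> x; apply: H; case: x.
- by right.
elim: gf_enum => [|x s [IH|IH]]; [by left | | by right].
have [Px|Qx] := PQ x; [left | by right; exists x].
by move=> y; rewrite in_cons => /orP[/eqP ->|/IH].
Qed.

Theorem family_scalar H : additive_family H -> scalar_family H.
Proof.
move=> fH; have [D O] := fH.
have step a : (a != 0 -> exists2 c, c \in mono_coefs & tequiv (H a) (hpoly c)) \/
    (a != 0 /\ exists c, [/\ c \in oval_coefs, pairs_ok c & tequiv (H a) (hpoly c)]).
  have [->|a0] := eqVneq a 0; first by left=> /eqP.
  have [c cc tc] := oval_classification (O a a0).
  by have [mc|pc] := oval_coefs_split cc; [left=> _; exists c | right; split=> //; exists c].
have [M|[a [a0 [c [cc pc tc]]]]] := gf_all_or_ex step.
  have [c cc tc] := M 1 (oner_neq0 _).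
  have := @scalar_at_tequiv mono_fun _ _ eq_mono_fun mono_T1 mono_T2 mono_T3 mono_T4 tc.
  apply; first exact: scalar_at_mono.
  - exact: fH.
  - move=> a a0; have [c' cc' tc'] := M a a0.
    exact: tequiv_mono (O a a0) (mono_coefs_mono cc') tc'.
  - by [].
(* The family is based at a member outside the monomial classes, whose pairs are settled whatever
   the other member is. *)
have f' : additive_family (fun b => H (a * b)).
  by split=> [x y z|x x0]; [rewrite mulrDr D | apply: O; rewrite mulf_neq0].
have S : scalar_family (fun b => H (a * b)).
  have := @scalar_at_tequiv (fun=> True) _ _ _ _ _ _ _ tc.
  apply=> //; first exact: scalar_at_pairs.
  by move=> x; rewrite mulr1.
have [k1 H1] := S a^-1; rewrite mulfV // mulr1 in H1.
have k10 : k1 != 0.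
  have := opoly_neq0 (O _ (oner_neq0 _)) (oner_neq0 _); rewrite H1.
  by apply: contraNneq => ->; rewrite mul0r.
move=> b; have [k Hk] := S (a^-1 * b); rewrite mulVKf // mulr1 in Hk.
by exists (k / k1) => x; rewrite Hk H1 mulrA divfK.
Qed.

(** * Pseudo-ovals realised over GF(32) *)

Notation G3 := (gf32 * gf32 * gf32)%type.

Lemma F2P (b : 'F_2) : b = 0 \/ b = 1.
Proof. by case: b => -[|[|//]] H; [left|right]; apply: val_inj. Qed.

Lemma F2_addbb (b : 'F_2) : b + b = 0.
Proof. by have [->|->] := F2P b; [rewrite addr0 | apply: val_inj]. Qed.

Lemma vec_addvv n (v : 'rV['F_2]_n) : v + v = 0.
Proof. by apply/rowP => i; rewrite !mxE F2_addbb. Qed.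

Lemma G3_addvv (v : G3) : v + v = 0.
Proof. by case: v => -[a b] c; congr (_, _, _); apply: addff. Qed.

Lemma card_rowspace m n (A : 'M['F_2]_(m, n)) :
  #|[set v : 'rV['F_2]_n | (v <= A)%MS]| = (2 ^ \rank A)%N.
Proof. by rewrite -[LHS]/#|rowg A| card_rowg card_Fp. Qed.

Lemma canon_inj (A B : sub15) : canon15 A -> canon15 B ->
  (forall v : vec15, (v <= A)%MS = (v <= B)%MS) -> A = B.
Proof.
move=> cA cB H; rewrite -cA -cB; apply/genmxP/andP.
by split; apply/rV_subP => v; rewrite H.
Qed.

Lemma additive_subspace (P : pred vec15) : P 0 -> (forall v w, P v -> P w -> P (v + w)) ->
  exists2 A : sub15, canon15 A & forall v : vec15, (v <= A)%MS = P v.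
Proof.
move=> P0 PD; pose A := (\sum_(v : vec15 | P v) <<v>>)%MS.
exists <<A>>%MS; first by rewrite /canon15 genmx_id.
move=> v; rewrite genmxE; apply/idP/idP; last first.
  by move=> Pv; apply: (sumsmx_sup v) => //; rewrite genmxE.
case/sub_sumsmxP => u ->; elim/big_rec: _ => // w x Pw Px; apply: PD => //.
have : (u w *m <<w>> <= w)%MS by rewrite (submx_trans (submxMl _ _)) ?genmxE.
by case/sub_rVP => a ->; have [->|->] := F2P a; rewrite ?scale0r ?scale1r.
Qed.

Lemma additive0 (U V : zmodType) (f : U -> V) : {morph f : x y / x + y} -> f 0 = 0.
Proof. by move=> fD; apply: (addrI (f 0)); rewrite -fD !addr0. Qed.

Lemma additive_matrix n (f : 'rV['F_2]_n -> 'rV['F_2]_n) :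
  {morph f : x y / x + y} -> exists A : 'M['F_2]_n, forall v, f v = v *m A.
Proof.
move=> fD; have f0 := additive0 fD.
exists (\matrix_i f (delta_mx 0 i)) => v.
rewrite mulmx_sum_row {1}(row_sum_delta v) (big_morph f fD f0); apply: eq_bigr => i _.
by rewrite rowK; have [->|->] := F2P (v 0 i); rewrite ?scale0r ?scale1r.
Qed.

Lemma additive_matrix_unit n (f g : 'rV['F_2]_n -> 'rV['F_2]_n) :
  {morph f : x y / x + y} -> cancel f g -> cancel g f ->
  exists2 A : 'M['F_2]_n, A \in unitmx & forall v, f v = v *m A.
Proof.
move=> fD fK gK.
have gD : {morph g : x y / x + y} by move=> x y; apply: (can_inj fK); rewrite fD !gK.
have [A fA] := additive_matrix fD; have [B gB] := additive_matrix gD.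
exists A => //; suff : A *m B = 1%:M by case/mulmx1_unit.
by apply/row_matrixP => i; rewrite rowE mulmxA -fA -gB fK rowE mulmx1.
Qed.

(** Membership of (w, x, y) in a point of the oval of [h]: (1 : m : h m) for [Some m], and (0 : 1 :
    0) for [None]. *)
Definition pt (h : gf32 -> gf32) (i : option gf32) (v : G3) : bool :=
  let: (w, x, y) := v in
  if i is Some m then (x == w * m) && (y == w * h m) else (w == 0) && (y == 0).

Lemma pt0 h i : pt h i 0.
Proof. by case: i => [m|] /=; rewrite ?mul0r !eqxx. Qed.

Lemma ptD h i v w : pt h i v -> pt h i w -> pt h i (v + w).
Proof.
case: v w i => [[a b] c] [[a' b'] c'] [m|] /= /andP[/eqP -> /eqP ->] /andP[/eqP -> /eqP ->].
  by rewrite -!mulrDl !eqxx.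
by rewrite !addr0 !eqxx.
Qed.

Definition ptv (h : gf32 -> gf32) (i : option gf32) (a : gf32) : G3 :=
  if i is Some m then (a, a * m, a * h m) else (0, a, 0).

Lemma ptP h i v : reflect (exists a, v = ptv h i a) (pt h i v).
Proof.
apply: (iffP idP) => [|[a ->]]; last by case: i => [m|] /=; rewrite !eqxx.
by case: v i => [[a b] c] [m|] /= /andP[/eqP -> /eqP ->]; [exists a | exists b].
Qed.

Lemma ptv_inj h i : injective (ptv h i).
Proof. by case: i => [m|] a b []. Qed.

Record realizes (phi : vec15 -> G3) (O : {set sub15}) (h : gf32 -> gf32) : Prop := Realizes {
  realD : {morph phi : x y / x + y};
  real_bij : bijective phi;
  real_canon : forall X, X \in O -> canon15 X;
  real_pt : forall X, X \in O -> exists i, forall v, (v <= X)%MS = pt h i (phi v);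
  real_ex : forall i, exists2 X, X \in O & forall v, (v <= X)%MS = pt h i (phi v) }.

(** The two coordinate systems differ by an additive bijection of GF(2)^15, and over GF(2) that is
    an invertible matrix. *)
Lemma realizes_proj_equiv phi phi' O O' h :
  realizes phi O h -> realizes phi' O' h -> proj_equiv O O'.
Proof.
move=> [D [g K gK] C P E] [D' [g' K' gK'] C' P' E'].
pose f v := g' (phi v); pose f' v := g (phi' v).
have fK : cancel f f' by move=> v; rewrite /f /f' gK'.
have f'K : cancel f' f by move=> v; rewrite /f /f' gK.
have fD : {morph f : x y / x + y}.
  by move=> x y; apply: (can_inj K'); rewrite /f D' !gK' D.
have [A uA fA] := additive_matrix_unit fD fK f'K; exists A; split=> //.
have key (X X' : sub15) i : (forall v, (v <= X)%MS = pt h i (phi v)) ->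
    (forall v, (v <= X')%MS = pt h i (phi' v)) -> canon15 X' -> <<X *m A>>%MS = X'.
  move=> HX HX' cX'; apply: canon_inj => //; first by rewrite /canon15 genmx_id.
  move=> v; rewrite genmxE HX' -[v in LHS]f'K fA submxMfree ?row_free_unit // HX.
  by rewrite /f' gK.
apply/setP => Y; apply/idP/imsetP => [Y'|[X XO ->]].
  have [i Hi] := P' _ Y'; have [X XO HX] := E i; exists X => //.
  by rewrite (key X Y i) //; apply: C'.
have [i Hi] := P _ XO; have [Y' YO HY] := E' i.
by rewrite (key X Y' i) //; apply: C'.
Qed.

Lemma realizes_map phi O h h' (psi : G3 -> G3) (s : option gf32 -> option gf32) :
  realizes phi O h -> {morph psi : x y / x + y} -> bijective psi ->
  (forall i, exists j, s j = i) -> (forall i v, pt h' (s i) (psi v) = pt h i v) ->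
  realizes (fun v => psi (phi v)) O h'.
Proof.
move=> [D B C P E] pD pB sB H; split=> //.
- by move=> x y; rewrite D pD.
- exact: bij_comp pB B.
- by move=> X /P[i Hi]; exists (s i) => v; rewrite H.
- by move=> i; have [j <-] := sB i; have [X XO HX] := E j; exists X => // v; rewrite H.
Qed.

Lemma finv_neq0 (b : gf32) : b != 0 -> b^-1 != 0. Proof. by rewrite invr_eq0. Qed.

(** Each move is a change of coordinates of GF(32)^3: linear for [T1], [T2], [T3], and the
    coordinatewise square for [T4]. All are additive, which is all that [realizes] asks. *)
Lemma realizes_tequiv phi O h h' : h 0 = 0 -> tequiv h h' -> realizes phi O h ->
  exists phi', realizes phi' O h'.
Proof.
move=> h0 H; elim: H h0 phi => {h h'} [h h' E|e h h' _ IH|a b h h' a0 b0 _ IH|h h' _ IH|h h' _ IH] h0 phi R.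
- exists phi; apply: (@realizes_map _ _ _ _ id id) R _ _ _ _ => //.
  + by exists id.
  + by move=> i; exists i.
  + by move=> [m|] [[w x] y] //=; rewrite E.
- pose psi (v : G3) : G3 := let: (w, x, y) := v in (w, x + e * w, y + h e * w).
  apply: (IH _ (fun v => psi (phi v))); first by rewrite /T1 add0r addff.
  apply: (@realizes_map _ _ _ _ psi (omap (fun m => m + e))) R _ _ _ _.
  + by move=> [[w x] y] [[w' x'] y']; congr (_, _, _) => /=; rewrite mulrDr addrACA.
  + by exists psi => -[[w x] y]; congr (_, _, _) => /=; rewrite -addrA addff addr0.
  + case=> [m|]; last by exists None.
    by exists (Some (m + e)); congr Some; rewrite -addrA addff addr0.
  + case=> [m|] [[w x] y] /=; rewrite /T1.
      rewrite -addrA addff addr0 mulrDr [e * w]mulrC (inj_eq (addIr _)).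
      by rewrite [h e * w]mulrC mulrDr (inj_eq (addIr _)).
    by case: eqP => //= ->; rewrite mulr0 addr0.
- pose psi (v : G3) : G3 := let: (w, x, y) := v in (w, b^-1 * x, a * y).
  apply: (IH _ (fun v => psi (phi v))); first by rewrite /T2 mulr0 h0 mulr0.
  apply: (@realizes_map _ _ _ _ psi (omap (fun m => b^-1 * m))) R _ _ _ _.
  + by move=> [[w x] y] [[w' x'] y']; congr (_, _, _) => /=; rewrite mulrDr.
  + exists (fun v : G3 => let: (w, x, y) := v in (w, b * x, a^-1 * y)) => -[[w x] y];
      by congr (_, _, _) => /=; rewrite ?mulVKf ?mulKf.
  + case=> [m|]; last by exists None.
    by exists (Some (b * m)); congr Some; rewrite mulKf.
  + case=> [m|] [[w x] y] /=; rewrite /T2.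
      rewrite mulVKf // mulrCA (inj_eq (mulfI (finv_neq0 b0))).
      by rewrite [w * (a * _)]mulrCA (inj_eq (mulfI a0)).
    by rewrite mulf_eq0 (negPf a0).
- pose psi (v : G3) : G3 := let: (w, x, y) := v in (x, w, y).
  pose s (i : option gf32) := if i is Some m then (if m == 0 then None else Some m^-1) else Some 0.
  apply: (IH _ (fun v => psi (phi v))); first by rewrite /T3 mul0r.
  apply: (@realizes_map _ _ _ _ psi s) R _ _ _ _.
  + by move=> [[w x] y] [[w' x'] y'].
  + by exists psi => -[[w x] y].
  + case=> [m|]; last by exists (Some 0); rewrite /s eqxx.
    have [->|m0] := eqVneq m 0; first by exists None.
    by exists (Some m^-1); rewrite /s invr_eq0 (negPf m0) invrK.
  + case=> [m|] [[w x] y] /=; last by rewrite /T3 mul0r !mulr0.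
    have [->|m0] := eqVneq m 0; first by rewrite !mulr0 h0 mulr0.
    rewrite /pt /T3 invrK; apply/andP/andP=> -[/eqP e1 /eqP e2]; split; apply/eqP.
    * by rewrite e1 divfK.
    * by rewrite e2 e1 mulrA.
    * by rewrite e1 mulfK.
    * by rewrite e2 e1 mulrA mulfK.
- pose psi (v : G3) : G3 := let: (w, x, y) := v in (w ^+ 2, x ^+ 2, y ^+ 2).
  apply: (IH _ (fun v => psi (phi v))); first by rewrite /T4 h0 expr0n.
  apply: (@realizes_map _ _ _ _ psi (omap (fun m => m ^+ 2))) R _ _ _ _.
  + by move=> [[w x] y] [[w' x'] y']; congr (_, _, _) => /=; rewrite sqrD2.
  + exists (fun v : G3 => let: (w, x, y) := v in (froot w, froot x, froot y)) => -[[w x] y];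
      by congr (_, _, _) => /=; rewrite ?sqr_froot ?froot_sq.
  + case=> [m|]; last by exists None.
    by exists (Some (froot m)); congr Some; rewrite froot_sq.
  + case=> [m|] [[w x] y] /=; rewrite /T4 ?sqr_froot -?exprMn ?(inj_eq sqr_inj) //.
    by rewrite !expf_eq0.
Qed.

Definition act2 (b : 'F_2) (x : G3) : G3 := if b == 0 then 0 else x.

Lemma act2D b c x : act2 (b + c) x = act2 b x + act2 c x.
Proof.
rewrite /act2; have [->|->] := F2P b; have [->|->] := F2P c;
  rewrite ?add0r ?addr0 ?eqxx ?oner_eq0 ?add0r ?addr0 //.
by rewrite F2_addbb eqxx G3_addvv.
Qed.

Definition G3_basis : seq G3 :=
  [seq (b, 0, 0) | b <- gf_basis] ++ [seq (0, b, 0) | b <- gf_basis]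
  ++ [seq (0, 0, b) | b <- gf_basis].

Definition phi0 (v : vec15) : G3 := \sum_(i < 15) act2 (v 0 i) (nth 0 G3_basis i).

Lemma phi0D : {morph phi0 : x y / x + y}.
Proof.
by move=> x y; rewrite /phi0 -big_split; apply: eq_bigr => i _; rewrite mxE act2D.
Qed.

Lemma phi0_delta i : phi0 (delta_mx 0 i) = nth 0 G3_basis i.
Proof.
rewrite /phi0 (bigD1 i) //= mxE !eqxx /act2 oner_eq0 big1 ?addr0 // => j ji.
by rewrite mxE (negPf ji) andbF eqxx.
Qed.

Lemma phi0_surj y : exists v, phi0 v == y.
Proof.
have D a b : (exists v, phi0 v = a) -> (exists v, phi0 v = b) -> exists v, phi0 v = a + b.
  by move=> [v <-] [w <-]; exists (v + w); rewrite phi0D.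
have B b : b \in G3_basis -> exists v, phi0 v = b.
  move=> Hb; have Hi : (index b G3_basis < 15)%N by rewrite -[15%N]/(size G3_basis) index_mem.
  by exists (delta_mx 0 (Ordinal Hi)); rewrite phi0_delta /= nth_index.
have Z : exists v, phi0 v = 0 by exists 0; apply: (additive0 phi0D).
case: y => -[a b] c.
have [v <-] : exists v, phi0 v = (a, b, c); last by exists v.
have -> : (a, b, c) = (a, 0, 0) + ((0, b, 0) + (0, 0, c)) :> G3.
  by congr (_, _, _); rewrite /= ?add0r ?addr0.
refine (D _ _ _ (D _ _ _ _)).
- elim/gf_span: a => [||g Hg]; [exact: Z| |].
    by move=> x x' Hx Hx'; have := D _ _ Hx Hx'; congr (exists v, _ = _); congr (_, _, _); rewrite /= addr0.
  by apply: B; rewrite mem_cat (map_f (fun b => (b, 0, 0) : G3)).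
- elim/gf_span: b => [||g Hg]; [exact: Z| |].
    by move=> x x' Hx Hx'; have := D _ _ Hx Hx'; congr (exists v, _ = _); congr (_, _, _); rewrite /= addr0.
  by apply: B; rewrite !mem_cat (map_f (fun b => (0, b, 0) : G3)) ?orbT.
- elim/gf_span: c => [||g Hg]; [exact: Z| |].
    by move=> x x' Hx Hx'; have := D _ _ Hx Hx'; congr (exists v, _ = _); congr (_, _, _); rewrite /= addr0.
  by apply: B; rewrite !mem_cat (map_f (fun b => (0, 0, b) : G3)) ?orbT.
Qed.

Lemma card_G3 : #|{: G3}| = #|{: vec15}|.
Proof. by rewrite !card_prod !card_gf32 card_mx card_Fp // -[32%N]/(2 ^ 5)%N -!expnD. Qed.

Lemma surj_bij (A B : finType) (f : A -> B) : #|B| = #|A| -> (forall y, exists x, f x == y) -> bijective f.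
Proof.
move=> AB fS; pose g y := xchoose (fS y).
have gK : cancel g f by move=> y; apply/eqP/(xchooseP (fS y)).
have gB : bijective g by apply: inj_card_bij; [exact: can_inj gK | rewrite AB].
by have [g' _ g'K] := gB; exists g => // x; rewrite -(g'K x) gK.
Qed.

Lemma phi0_bij : bijective phi0.
Proof. by apply: surj_bij phi0_surj; apply: card_G3. Qed.

Definition oval_spaces (h : gf32 -> gf32) : {set sub15} :=
  [set A : sub15 | (<<A>>%MS == A) &&
     [exists i : option gf32, [forall v : vec15, (v <= A)%MS == pt h i (phi0 v)]]].

Lemma oval_spacesP h : realizes phi0 (oval_spaces h) h.
Proof.
split; [exact: phi0D | exact: phi0_bij | | |].
- by move=> X; rewrite inE => /andP[/eqP].
- by move=> X; rewrite inE => /andP[_ /existsP[i /forallP H]]; exists i => v; apply/eqP.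
move=> i; have [||A cA HA] := @additive_subspace (fun v => pt h i (phi0 v)).
- by rewrite (additive0 phi0D) pt0.
- by move=> v w Hv Hw; rewrite phi0D ptD.
exists A => //; rewrite inE cA eqxx; apply/existsP; exists i; apply/forallP => v.
by rewrite HA.
Qed.

Lemma pt_ptv h i j a : a != 0 -> pt h j (ptv h i a) -> i = j.
Proof.
move=> a0; case: i j => [m|] [m'|] //= /andP[/eqP e1 _].
- by congr Some; apply: (mulfI a0).
- by rewrite e1 eqxx in a0.
- by rewrite mul0r in e1; rewrite e1 eqxx in a0.
Qed.

Lemma ptv0 h i : ptv h i 0 = 0.
Proof. by case: i => [m|] //=; rewrite !mul0r. Qed.


Lemma ptv_indep2 h m m' a b c : opoly h -> m != m' ->
  ptv h (Some m) a + ptv h (Some m') b + ptv h None c = 0 -> [/\ a = 0, b = 0 & c = 0].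
Proof.
move=> [h0 hi _] mm' [] /eqP; rewrite addr0 addf_eq0 => /eqP <- e2 /eqP.
rewrite addr0 -mulrDr mulf_eq0 addf_eq0 (inj_eq hi) (negPf mm') orbF => /eqP a0.
by move: e2; rewrite a0 !mul0r !add0r.
Qed.

Lemma ptv_indep3 h m1 m2 m3 a b c : opoly h -> m1 != m2 -> m2 != m3 -> m1 != m3 ->
  ptv h (Some m1) a + ptv h (Some m2) b + ptv h (Some m3) c = 0 -> [/\ a = 0, b = 0 & c = 0].
Proof.
move=> [h0 hi /arcfunP ha] m12 m23 m13 [] /add_eq0P e1 e2 e3.
have D := ha m1 m2 m3 m12 m23 m13.
have ea : a * det3 h m1 m2 m3 = 0.
  transitivity ((a * m1 + b * m2 + c * m3) * (h m2 + h m3) + (a * h m1 + b * h m2 + c * h m3) * (m2 + m3)).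
    by rewrite -e1 /det3; move: (h m1) (h m2) (h m3) => x y z; gfring.
  by rewrite [_ + c * m3]e2 [_ + c * h m3]e3 !mul0r addr0.
have eb : b * det3 h m1 m2 m3 = 0.
  transitivity ((a * m1 + b * m2 + c * m3) * (h m1 + h m3) + (a * h m1 + b * h m2 + c * h m3) * (m1 + m3)).
    by rewrite -e1 /det3; move: (h m1) (h m2) (h m3) => x y z; gfring.
  by rewrite [_ + c * m3]e2 [_ + c * h m3]e3 !mul0r addr0.
move/eqP: ea; rewrite mulf_eq0 (negPf D) orbF => /eqP a0.
move/eqP: eb; rewrite mulf_eq0 (negPf D) orbF => /eqP b0.
by rewrite -e1 a0 b0 addr0.
Qed.

Lemma ptv_indep h i j k a b c : opoly h -> i != j -> j != k -> i != k ->
  ptv h i a + ptv h j b + ptv h k c = 0 -> [/\ a = 0, b = 0 & c = 0].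
Proof.
move=> oh; case: i j k => [m1|] [m2|] [m3|] // ij jk ik E.
- exact: ptv_indep3 E.
- by apply: (ptv_indep2 oh) E.
- by rewrite addrAC in E; case: (ptv_indep2 oh _ E).
- by rewrite -addrA addrC in E; case: (ptv_indep2 oh _ E).
Qed.

Definition row3 (K : nzRingType) (a b c : K) : 'rV[K]_3 := \row_i nth 0 [:: a; b; c] i.

Lemma row3E (K : nzRingType) (u : 'rV[K]_3) : u = row3 (u 0 0) (u 0 1) (u 0 2).
Proof.
apply/rowP => i; rewrite mxE; case: i => -[|[|[|//]]] Hi /=; congr (u _ _); exact: val_inj.
Qed.

Lemma row3_inj (K : nzRingType) (a b c a' b' c' : K) :
  row3 a b c = row3 a' b' c' -> [/\ a = a', b = b' & c = c'].
Proof. by move/rowP=> H; have := H 0; have := H 1; have := H 2; rewrite !mxE. Qed.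

Lemma row3D (K : nzRingType) (a b c a' b' c' : K) :
  row3 a b c + row3 a' b' c' = row3 (a + a') (b + b') (c + c').
Proof. by apply/rowP => i; rewrite !mxE; case: i => -[|[|[|//]]] Hi /=. Qed.

Lemma row3Z (K : nzRingType) (k a b c : K) : k *: row3 a b c = row3 (k * a) (k * b) (k * c).
Proof. by apply/rowP => i; rewrite !mxE; case: i => -[|[|[|//]]] Hi /=. Qed.

Lemma row3_0 (K : nzRingType) : row3 0 0 0 = 0 :> 'rV[K]_3.
Proof. by apply/rowP => i; rewrite !mxE; case: i => -[|[|[|//]]] Hi /=. Qed.

Definition G3row (v : G3) : 'rV[gf32]_3 := let: (w, x, y) := v in row3 w x y.

Lemma G3rowD : {morph G3row : u v / u + v}.
Proof. by move=> [[a b] c] [[a' b'] c']; rewrite /= row3D. Qed.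

Lemma G3row_bij : bijective G3row.
Proof.
exists (fun u : 'rV[gf32]_3 => (u 0 0, u 0 1, u 0 2)) => [[[a b] c]|u] /=.
  by rewrite !mxE.
by rewrite -row3E.
Qed.

Lemma ptv_scale h i a : G3row (ptv h i a) = a *: G3row (ptv h i 1).
Proof. by case: i => [m|] /=; rewrite row3Z ?mul1r ?mulr1 ?mulr0. Qed.

Lemma pt_submx h i v : pt h i v = (G3row v <= G3row (ptv h i 1))%MS.
Proof.
apply/ptP/sub_rVP => [[a ->]|[a]]; first by exists a; rewrite ptv_scale.
by rewrite -ptv_scale => /(bij_inj G3row_bij); exists a.
Qed.

Lemma G3row_ptv_neq0 h i : G3row (ptv h i 1) != 0.
Proof.
have -> : 0 = G3row 0 by rewrite -row3_0.
rewrite (inj_eq (bij_inj G3row_bij)) -[X in _ != X](ptv0 h i) (inj_eq (@ptv_inj h i)).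
exact: oner_neq0.
Qed.

Lemma PG2_pointsP (K : finFieldType) (p : 'M[K]_3) :
  reflect (exists2 u : 'rV[K]_3, u != 0 & p = <<u>>%MS) (p \in PG2_points K).
Proof.
rewrite inE; apply: (iffP andP) => [[/eqP gp /eqP rp]|[u u0 ->]]; last first.
  by rewrite genmx_id eqxx genmxE rank_rV u0.
have p0 : p != 0 by rewrite -mxrank_eq0 rp.
exists (nz_row p); first by rewrite nz_row_eq0.
rewrite -{1}gp; apply/genmxP; apply/eqmxP; apply: eqmx_sym; apply/eqmxP.
by rewrite -(geq_leqif (mxrank_leqif_eq (nz_row_sub p))) rp rank_rV nz_row_eq0 p0.
Qed.

Section Realized.
Variables (phi : vec15 -> G3) (O : {set sub15}) (h : gf32 -> gf32).
Hypotheses (R : realizes phi O h) (oh : opoly h).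

Lemma real_rank X : X \in O -> \rank X = 5%N.
Proof.
move=> XO; have [i Hi] := real_pt R XO; have [g K gK] := real_bij R.
apply: (@expnI 2) => //; rewrite -card_rowspace.
rewrite (_ : [set v | _] = [set g (ptv h i a) | a : gf32]).
  by rewrite card_imset ?cardsT ?card_gf32 //; apply: inj_comp (can_inj gK) (@ptv_inj h i).
apply/setP => v; rewrite inE Hi; apply/ptP/imsetP => [[a E]|[a _ ->]].
  by exists a; rewrite // -E K.
by exists a; rewrite gK.
Qed.

Lemma real_uniq X Y i : X \in O -> Y \in O -> (forall v, (v <= X)%MS = pt h i (phi v)) ->
  (forall v, (v <= Y)%MS = pt h i (phi v)) -> X = Y.
Proof.
move=> XO YO HX HY; apply: canon_inj; [exact: real_canon R _ XO | exact: real_canon R _ YO |].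
by move=> v; rewrite HX HY.
Qed.

Lemma real_space i : {X | X \in O & forall v, (v <= X)%MS = pt h i (phi v)}.
Proof.
have E : exists X, (X \in O) && [forall v : vec15, (v <= X)%MS == pt h i (phi v)].
  have [X XO HX] := real_ex R i; exists X; rewrite XO; apply/forallP => v.
  by rewrite HX.
exists (xchoose E); have /andP[XO /forallP H] := xchooseP E => //.
by move=> v; apply/eqP.
Qed.

Definition sp i : sub15 := s2val (real_space i).

Lemma sp_in i : sp i \in O. Proof. exact: (s2valP (real_space i)). Qed.

Lemma spE i v : (v <= sp i)%MS = pt h i (phi v). Proof. exact: (s2valP' (real_space i)). Qed.

Lemma sp_inj : injective sp.
Proof.
move=> i j E; have [g K gK] := real_bij R.
apply: (@pt_ptv h i j 1); first exact: oner_neq0.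
by rewrite -[ptv h i 1]gK -spE -E spE gK; apply/ptP; exists 1.
Qed.

Lemma sp_onto X : X \in O -> exists i, X = sp i.
Proof.
move=> XO; have [i Hi] := real_pt R XO; exists i.
by apply: (@real_uniq _ _ i) => //; [exact: sp_in | exact: spE].
Qed.

Lemma real_card : #|O| = 33%N.
Proof.
have -> : O = [set sp i | i : option gf32].
  apply/setP => X; apply/idP/imsetP => [/sp_onto[i ->]|[i _ ->]]; [by exists i | exact: sp_in].
by rewrite card_imset ?card_option ?card_gf32 //; apply: sp_inj.
Qed.

(** By independence the sum map on triples of coordinates is injective, hence onto by finiteness. *)
Lemma real_span i j k : i != j -> j != k -> i != k -> \rank (sp i + sp j + sp k)%MS = 15%N.
Proof.
move=> ij jk ik; apply/eqP; rewrite -[_ == _]/(row_full _) -sub1mx; apply/rV_subP => v _.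
pose f (t : G3) : G3 := let: (a, b, c) := t in ptv h i a + ptv h j b + ptv h k c.
have pD l a b : ptv h l (a + b) = ptv h l a + ptv h l b.
  by case: l => [m|]; congr (_, _, _); rewrite /= ?mulrDl ?addr0.
have fI : injective f.
  move=> [[a b] c] [[a' b'] c'] E.
  have : ptv h i (a + a') + ptv h j (b + b') + ptv h k (c + c') = 0.
    by rewrite !pD (addrACA (ptv h i a)) (addrACA (ptv h i a + ptv h j b)) -[LHS]/(f (a, b, c) + f (a', b', c')) E G3_addvv.
  by case/(ptv_indep oh ij jk ik) => /add_eq0P -> /add_eq0P -> /add_eq0P ->.
have [f' _ fK] := injF_bij fI; have [g K gK] := real_bij R.
have := fK (phi v); case: (f' _) => -[a b] c /= E.
have -> : v = g (ptv h i a) + g (ptv h j b) + g (ptv h k c).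
  by apply: (can_inj K); rewrite !(realD R) !gK.
by rewrite !addmx_sub_adds // ?spE ?gK; apply/ptP; eexists.
Qed.

Lemma realizes_pseudo_oval : pseudo_oval O.
Proof.
split; last split; first by move=> X XO; split; [exact: real_canon R _ XO | exact: real_rank].
  exact: real_card.
move=> X Y Z /sp_onto[i ->] /sp_onto[j ->] /sp_onto[k ->].
by rewrite !(inj_eq sp_inj); apply: real_span.
Qed.

End Realized.

Section Elementary.
Variables (phi : vec15 -> G3) (O : {set sub15}) (h : gf32 -> gf32).
Hypotheses (R : realizes phi O h) (oh : opoly h).

Definition oval_pt i : 'M[gf32]_3 := <<G3row (ptv h i 1)>>%MS.

Lemma oval_pt_inj : injective oval_pt.
Proof.
move=> i j E; apply: (@pt_ptv h i j 1); first exact: oner_neq0.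
have : (G3row (ptv h i 1) <= oval_pt i)%MS by rewrite genmxE.
by rewrite E genmxE -pt_submx.
Qed.

Lemma oval_pt_rank i j k : i != j -> j != k -> i != k ->
  \rank (oval_pt i + oval_pt j + oval_pt k)%MS = 3%N.
Proof.
move=> ij jk ik; apply/eqP; rewrite -[_ == _]/(row_full _) -sub1mx; apply/rV_subP => u _.
have [g K gK] := real_bij R; have [r rK Kr] := G3row_bij.
have := real_span R oh ij jk ik => /eqP; rewrite -[_ == _]/(row_full _) -sub1mx => full.
have : (g (r u) <= sp R i + sp R j + sp R k)%MS by apply: submx_trans (submx1 _) full.
case/sub_addsmxP => -[u1 u2] /= E; have : (u1 *m (sp R i + sp R j)%MS <= sp R i + sp R j)%MS.
  exact: submxMl.
case/sub_addsmxP => -[u3 u4] /= E'; rewrite {}E' in E.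
have sub l (w : vec15) : (w <= sp R l)%MS -> (G3row (phi w) <= oval_pt l)%MS.
  by rewrite spE pt_submx genmxE.
have -> : u = G3row (phi (u3 *m sp R i)) + G3row (phi (u4 *m sp R j)) + G3row (phi (u2 *m sp R k)).
  by rewrite -!G3rowD -!(realD R) -E gK Kr.
by rewrite !addmx_sub_adds // sub // submxMl.
Qed.

Lemma realizes_elementary : elementary O.
Proof.
exists gf32; split; first exact: card_gf32.
exists (fun v => G3row (phi v)); split; first by move=> x y; rewrite (realD R) G3rowD.
split; first exact: bij_comp G3row_bij (real_bij R).
exists [set oval_pt i | i : option gf32]; split.
  split; last split.
  - apply/subsetP => p /imsetP[i _ ->]; apply/PG2_pointsP.
    by exists (G3row (ptv h i 1)); first exact: G3row_ptv_neq0.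
  - by rewrite card_imset ?card_option ?card_gf32 //; apply: oval_pt_inj.
  - move=> p1 p2 p3 /imsetP[i _ ->] /imsetP[j _ ->] /imsetP[k _ ->].
    by rewrite !(inj_eq oval_pt_inj); apply: oval_pt_rank.
split=> [X XO|p /imsetP[i _ ->]].
  have [i Hi] := real_pt R XO; exists (oval_pt i); first exact: imset_f.
  by move=> v; rewrite Hi pt_submx genmxE.
by exists (sp R i); [exact: sp_in | move=> v; rewrite spE pt_submx genmxE].
Qed.

End Elementary.

(** * The Desarguesian plane of a realised pseudo-oval *)

Lemma vec_opp n (v : 'rV['F_2]_n) : - v = v.
Proof. by apply: (addrI v); rewrite addrN vec_addvv. Qed.

Lemma rank0P n (A : 'M['F_2]_n) : (forall v : 'rV['F_2]_n, (v <= A)%MS -> v = 0) -> \rank A = 0%N.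
Proof.
move=> H; apply/eqP; rewrite mxrank_eq0; apply/eqP/row_matrixP => i.
by rewrite row0; apply: H; apply: row_sub.
Qed.

Section Desarguesian.
Variables (phi : vec15 -> G3) (O : {set sub15}) (h : gf32 -> gf32).
Hypotheses (R : realizes phi O h) (oh : opoly h).

Let phiD := realD R.
Let phi_0 : phi 0 = 0. Proof. exact: (additive0 phiD). Qed.

Lemma subspace_of (P : pred G3) : P 0 -> (forall v w, P v -> P w -> P (v + w)) ->
  exists2 A : sub15, canon15 A & forall v : vec15, (v <= A)%MS = P (phi v).
Proof.
move=> P0 PD; apply: (@additive_subspace (fun v => P (phi v))); first by rewrite phi_0.
by move=> v w Hv Hw; rewrite phiD PD.
Qed.

Lemma rank_pairs (A : sub15) (f : gf32 * gf32 -> G3) (P : pred G3) :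
  injective f -> (forall v, P v <-> exists t, v = f t) ->
  (forall v : vec15, (v <= A)%MS = P (phi v)) -> \rank A = 10%N.
Proof.
move=> fI PE HA; have [g K gK] := real_bij R.
apply: (@expnI 2) => //; rewrite -card_rowspace.
rewrite (_ : [set v | _] = [set g (f t) | t : gf32 * gf32]).
  rewrite card_imset; last exact: inj_comp (can_inj gK) fI.
  by rewrite card_prod card_gf32.
apply/setP => v; rewrite inE HA; apply/idP/imsetP => [/PE[t E]|[t _ ->]].
  by exists t; rewrite // -E K.
by apply/PE; exists t; rewrite gK.
Qed.

Definition dirS (o : option gf32) (v : G3) : bool :=
  let: (w, x, y) := v in (x == 0) && (if o is Some s then y == w * s else w == 0).

(** With X the point (0 : 1 : 0), take w = 0 for the tangent space and x = 0 for [S]. The join of X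
    with the point m meets [S] in y = h(m) w; every slope occurs because [h] is a bijection, and w =
    0 is the direction left for the tangent space. *)
Lemma desarguesian_data : exists T S : sub15,
  [/\ tangent_space O (sp R None) T, \rank S = 10%N, \rank (sp R None :&: S)%MS = 0%N,
      (forall v : vec15, (v <= S)%MS = ((phi v).1.2 == 0)) &
      forall W, W \in induced_spread O (sp R None) T S <->
        canon15 W /\ exists o, forall v : vec15, (v <= W)%MS = dirS o (phi v)].
Proof.
have [||T cT HT] := @subspace_of (fun v => v.1.1 == 0).
- exact: eqxx.
- by move=> [[a b] c] [[a' b'] c'] /= /eqP -> /eqP ->; rewrite addr0.
have [||S cS HS] := @subspace_of (fun v => v.1.2 == 0).
- exact: eqxx.
- by move=> [[a b] c] [[a' b'] c'] /= /eqP -> /eqP ->; rewrite addr0.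
have [g K gK] := real_bij R; have [h0 hi _] := oh.
have g0' : g 0 = 0 by apply: (can_inj K); rewrite gK phi_0.
have zero v : phi v = 0 -> v = 0 by rewrite -phi_0 => /(can_inj K).
have rT : \rank T = 10%N.
  apply: (@rank_pairs T (fun t => (0, t.1, t.2)) (fun v => v.1.1 == 0)) HT.
    by move=> [a b] [a' b'] [-> ->].
  move=> [[a b] c]; split=> [/eqP /= ->|[[x y] [-> _ _]]]; last exact: eqxx.
  by exists (b, c).
have rS : \rank S = 10%N.
  apply: (@rank_pairs S (fun t => (t.1, 0, t.2)) (fun v => v.1.2 == 0)) HS.
    by move=> [a b] [a' b'] [-> ->].
  move=> [[a b] c]; split=> [/eqP /= ->|[[x y] [_ -> _]]]; last exact: eqxx.
  by exists (a, c).
have WT v : (v <= <<T :&: S>>)%MS = dirS None (phi v).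
  by rewrite genmxE sub_capmx HT HS andbC; case: (phi v) => -[].
have WY m v : (v <= <<(sp R None + sp R (Some m)) :&: S>>)%MS = dirS (Some (h m)) (phi v).
  rewrite genmxE sub_capmx HS andbC; case E : (phi v) => [[w x] y] /=; congr (_ && _).
  apply/idP/eqP => [/sub_addsmxP[[u1 u2] /= Ev]|Ey].
    have : (u1 *m sp R None <= sp R None)%MS by apply: submxMl.
    rewrite spE => /ptP[a Ea]; have : (u2 *m sp R (Some m) <= sp R (Some m))%MS by apply: submxMl.
    rewrite spE => /ptP[b Eb]; move: E; rewrite Ev phiD Ea Eb => -[<- _ <-].
    by rewrite !add0r.
  have -> : v = g (0, x + w * m, 0) + g (w, w * m, y).
    apply: (can_inj K); rewrite phiD !gK E; congr (_, _, _); rewrite /= ?add0r //.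
    by rewrite -addrA addff addr0.
  by rewrite addmx_sub_adds // spE gK /= ?eqxx // Ey !eqxx.
exists T, S; split=> //.
- split=> //; split.
    by apply/rV_subP => v; rewrite spE HT; case: (phi v) => -[a b] c /= /andP[].
  move=> Y /(sp_onto R)[[m|->]]; last by rewrite eqxx.
  move=> -> _; apply: rank0P => v; rewrite sub_capmx HT spE => /andP[].
  case E : (phi v) => [[a b] c] /= /eqP a0; rewrite a0 !mul0r => /andP[/eqP b0 /eqP c0].
  by apply: zero; rewrite E a0 b0 c0.
- apply: rank0P => v; rewrite sub_capmx spE HS; case E : (phi v) => [[a b] c] /=.
  by move=> /andP[/andP[/eqP a0 /eqP c0] /eqP b0]; apply: zero; rewrite E a0 b0 c0.
- move=> W; rewrite inE; split.
    case/orP=> [/imsetP[Y]|]; last first.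
      by move/set1P->; split; [rewrite /canon15 genmx_id | exists None].
    rewrite !inE => /andP[YX /(sp_onto R)[[m|] EY]]; last by rewrite EY eqxx in YX.
    by rewrite EY => ->; split; [rewrite /canon15 genmx_id | exists (Some (h m))].
  move=> [cW [[s|] HW]]; apply/orP; [left|right].
    have [h' _ hK] := injF_bij hi; apply/imsetP; exists (sp R (Some (h' s))).
      by rewrite !inE sp_in andbT; apply/eqP => /sp_inj.
    apply: canon_inj => //; first by rewrite /canon15 genmx_id.
    by move=> v; rewrite WY HW hK.
  apply/set1P; apply: canon_inj => //; first by rewrite /canon15 genmx_id.
  by move=> v; rewrite WT HW.
Qed.

End Desarguesian.

(* Incidence of the point spanned by [u] with the line whose equation has coefficients [n]. *)
Definition dot3 (K : nzRingType) (u n : 'rV[K]_3) : K := \sum_i u 0 i * n 0 i.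

Lemma dot3E (K : nzRingType) (a b c a' b' c' : K) :
  dot3 (row3 a b c) (row3 a' b' c') = a * a' + b * b' + c * c'.
Proof. by rewrite /dot3 !big_ord_recr big_ord0 /= !mxE /= add0r. Qed.

Definition PG2_line (K : finFieldType) (n : 'rV[K]_3) : {set 'M[K]_3} :=
  [set p in PG2_points K | (p <= kermx n^T)%MS].

Lemma sub_ker_dot (K : finFieldType) (u n : 'rV[K]_3) : (u <= kermx n^T)%MS = (dot3 u n == 0).
Proof.
rewrite sub_kermx; apply/eqP/eqP => [/matrixP/(_ 0 0)|E].
  by rewrite !mxE => E; rewrite -[RHS]E; apply: eq_bigr => i _; rewrite !mxE.
by apply/matrixP => i j; rewrite !ord1 mxE [RHS]mxE -[RHS]E; apply: eq_bigr => k _; rewrite !mxE.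
Qed.

Lemma PG2_linesP (K : finFieldType) (l : {set 'M[K]_3}) :
  reflect (exists2 n : 'rV[K]_3, n != 0 & l = PG2_line n) (l \in PG2_lines K).
Proof.
apply: (iffP imsetP) => [[L]|[n n0 ->]].
  rewrite inE => /andP[/eqP gL /eqP rL] ->.
  have ck : \rank (cokermx L) = 1%N by rewrite mxrank_coker rL.
  pose n := nz_row (cokermx L)^T.
  have n0 : n != 0 by rewrite nz_row_eq0 -trmx0 (inj_eq trmx_inj) -mxrank_eq0 ck.
  exists n => //.
  have Ln : (L <= kermx n^T)%MS.
    rewrite sub_kermx; have : (n <= (cokermx L)^T)%MS := nz_row_sub _.
    case/submxP => D ->; rewrite trmx_mul trmxK mulmxA mulmx_coker mul0mx //.
  have E : (L :=: kermx n^T)%MS.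
    apply/eqmxP; rewrite -(geq_leqif (mxrank_leqif_eq Ln)) rL mxrank_ker mxrank_tr.
    by rewrite rank_rV n0.
  by apply/setP => p; rewrite !inE E.
exists <<kermx n^T>>%MS.
  by rewrite inE genmx_id eqxx genmxE mxrank_ker mxrank_tr rank_rV n0.
by apply/setP => p; rewrite !inE genmxE.
Qed.

Lemma PG2_line_gen (K : finFieldType) (u n : 'rV[K]_3) : u != 0 ->
  (<<u>>%MS \in PG2_line n) = (dot3 u n == 0).
Proof.
move=> u0; rewrite inE genmxE sub_ker_dot (_ : _ \in _) //.
by apply/PG2_pointsP; exists u.
Qed.

Lemma row3_eq0 (K : nzRingType) (a b c : K) : (row3 a b c == 0) = [&& a == 0, b == 0 & c == 0].
Proof.
apply/eqP/and3P => [|[/eqP-> /eqP-> /eqP->]]; last exact: row3_0.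
by rewrite -row3_0 => /row3_inj[-> -> ->]; rewrite !eqxx.
Qed.

(* A point of PG(2,K) in affine form: (1 : w : y), or the point at infinity (0 : 1 : s) or (0 : 0 : 1). *)
Definition aff (K : finFieldType) (w y : K) : 'M[K]_3 := <<row3 1 w y>>%MS.
Definition inf (K : finFieldType) (o : option K) : 'M[K]_3 :=
  if o is Some s then <<row3 0 1 s>>%MS else <<row3 0 0 1>>%MS.

Lemma gen_row_eq (K : finFieldType) (u v : 'rV[K]_3) : u != 0 ->
  <<u>>%MS = <<v>>%MS -> exists2 k, k != 0 & u = k *: v.
Proof.
move=> u0 /genmxP/andP[/sub_rVP[k E] _]; exists k => //.
by apply: contra_neq u0 => k0; rewrite E k0 scale0r.
Qed.

Lemma aff_inj (K : finFieldType) (w y w' y' : K) : aff w y = aff w' y' -> w = w' /\ y = y'.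
Proof.
case/gen_row_eq; first by rewrite row3_eq0 oner_eq0.
by move=> k _; rewrite row3Z => /row3_inj[]; rewrite mulr1 => <-; rewrite !mul1r.
Qed.

Lemma aff_inf (K : finFieldType) (w y : K) o : aff w y <> inf o.
Proof.
case: o => [s|] /gen_row_eq[]; rewrite ?row3_eq0 ?oner_eq0 // => k _;
  by rewrite row3Z => /row3_inj[/eqP]; rewrite mulr0 oner_eq0.
Qed.

Lemma inf_inj (K : finFieldType) : injective (@inf K).
Proof.
move=> [s|] [s'|] // /gen_row_eq[]; rewrite ?row3_eq0 ?oner_eq0 ?andbF // => k k0; rewrite row3Z.
- by move/row3_inj=> [_]; rewrite mulr1 => <-; rewrite mul1r => ->.
- by move/row3_inj=> [_ /eqP]; rewrite mulr0 oner_eq0.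
- by move/row3_inj=> [_ /esym/eqP]; rewrite mulr1 (negPf k0).
Qed.

Lemma PG2_nf (K : finFieldType) (p : 'M[K]_3) : p \in PG2_points K ->
  (exists w y, p = aff w y) \/ exists o, p = inf o.
Proof.
case/PG2_pointsP => u; rewrite (row3E u); move: (u 0 0) (u 0 1) (u 0 2) => a b c u0 ->.
have sc k (v : 'rV[K]_3) : k != 0 -> <<k *: v>>%MS = <<v>>%MS.
  by move=> k0; apply/genmxP/eqmxP/eqmx_scale.
have [a0|a0] := eqVneq a 0; last first.
  by left; exists (b / a), (c / a); rewrite /aff -[RHS](sc a) // row3Z mulr1 ![a * (_ / a)]mulrC !divfK.
have [b0|b0] := eqVneq b 0; last first.
  by right; exists (Some (c / b)); rewrite /inf -[RHS](sc b) // row3Z mulr1 mulr0 [b * (_ / b)]mulrC divfK // a0.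
right; exists None; rewrite a0 b0 in u0 *; rewrite row3_eq0 !eqxx /= in u0.
by rewrite /inf -[RHS](sc c _ u0) row3Z mulr1 !mulr0.
Qed.

Lemma aff_in (K : finFieldType) (w y : K) : aff w y \in PG2_points K.
Proof. by apply/PG2_pointsP; exists (row3 1 w y); rewrite ?row3_eq0 ?oner_eq0. Qed.

Lemma inf_in (K : finFieldType) (o : option K) : inf o \in PG2_points K.
Proof.
apply/PG2_pointsP; case: o => [s|].
  by exists (row3 0 1 s); rewrite // row3_eq0 oner_eq0 andbF.
by exists (row3 0 0 1); rewrite // row3_eq0 oner_eq0 !andbF.
Qed.

Lemma aff_line (K : finFieldType) (w y a b c : K) :
  (aff w y \in PG2_line (row3 a b c)) = (a + w * b + y * c == 0).
Proof. by rewrite PG2_line_gen ?row3_eq0 ?oner_eq0 // dot3E mul1r. Qed.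

Lemma inf_line (K : finFieldType) (o : option K) (a b c : K) :
  (inf o \in PG2_line (row3 a b c)) = (if o is Some s then b + s * c == 0 else c == 0).
Proof.
by case: o => [s|]; rewrite PG2_line_gen ?row3_eq0 ?oner_eq0 ?andbF // dot3E !mul0r !add0r mul1r.
Qed.

Lemma realizes_desarguesian phi O h : realizes phi O h -> opoly h ->
  exists2 X, X \in O & desarguesian_at O X.
Proof.
move=> R oh; exists (sp R None); first exact: sp_in.
have [T [S [tT rS rXS HS HW]]] := desarguesian_data R oh.
exists T, S; do 3!split=> //; exists gf32; split; first exact: card_gf32.
set spr := induced_spread _ _ _ _ in HW *; clearbody spr; have [g K gK] := real_bij R.
pose slope (W : sub15) : option gf32 := [pick s | (g (1, 0, s) <= W)%MS].
have slopeE W o : (forall v : vec15, (v <= W)%MS = dirS o (phi v)) -> slope W = o.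
  move=> H; rewrite /slope; case: pickP => [s|N]; rewrite ?H ?gK.
    by case: o {H} => [s'|]; rewrite /dirS /= ?eqxx ?oner_eq0 // mul1r => /eqP ->.
  by case: o H => [s'|//] H; have := N s'; rewrite H gK /= mul1r !eqxx.
pose f (p : ptype) : 'M[gf32]_3 :=
  match p with inl v => aff (phi v).1.1 (phi v).2 | inr W => inf (slope W) end.
have slope_inj W W' : W \in spr -> W' \in spr -> slope W = slope W' -> W = W'.
  move=> /HW[cW [o Ho]] /HW[cW' [o' Ho']]; rewrite (slopeE _ _ Ho) (slopeE _ _ Ho') => E.
  by apply: canon_inj => // v; rewrite Ho Ho' E.
have slope_onto o : exists2 W, W \in spr & forall v : vec15, (v <= W)%MS = dirS o (phi v).
  have [||W cW HW'] := @subspace_of _ _ _ R (dirS o).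
  - by case: o => [s|] /=; rewrite ?mul0r !eqxx.
  - move=> [[a b] c] [[a' b'] c'] /=; case: o => [s|] /andP[/eqP-> /eqP->] /andP[/eqP-> /eqP->].
      by rewrite addr0 mulrDl !eqxx.
    by rewrite !addr0 !eqxx.
  by exists W => //; apply/HW; split=> //; exists o.
have fI : {in tp_points S spr &, injective f}.
  move=> [v|W] [v'|W'] /=; rewrite !inE.
  - rewrite !HS => /eqP e1 /eqP e2 /aff_inj[e3 e4]; congr inl; apply: (can_inj K).
    by move: e1 e2 e3 e4; case: (phi v) => -[a b] c; case: (phi v') => -[a' b'] c' /= -> -> -> ->.
  - by move=> _ _ /aff_inf.
  - by move=> _ _ /esym/aff_inf.
  - by move=> HW1 HW2 /inf_inj E; rewrite (slope_inj _ _ HW1 HW2 E).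
have fim : f @: tp_points S spr = PG2_points gf32.
  apply/setP => p; apply/imsetP/idP => [[[v|W] _ ->]|/PG2_nf[[w [y ->]]|[o ->]]].
  - exact: aff_in.
  - exact: inf_in.
  - by exists (inl (g (w, 0, y))); rewrite /= ?inE ?HS gK.
  - have [W HW1 HW2] := slope_onto o; exists (inr W); first by rewrite inE.
    by rewrite /f (slopeE _ _ HW2).
exists f; split=> //; split=> //.
have im_line (l : {set ptype}) n : l \subset tp_points S spr ->
    (forall q, q \in tp_points S spr -> (q \in l) = (f q \in PG2_line n)) ->
    f @: l = PG2_line n.
  move=> /subsetP ls H; apply/setP => p; apply/imsetP/idP => [[q ql ->]|pn].
    by rewrite -H // ls.
  have : p \in PG2_points gf32 by move: pn; rewrite inE => /andP[].
  rewrite -fim => /imsetP[q qp E]; exists q => //.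
  by rewrite H // -E.
have Hinf : f @: tp_line_at_infinity spr = PG2_line (row3 1 0 0).
  apply: im_line; first by apply/subsetP => -[v|W]; rewrite !inE.
  move=> [v|W]; rewrite [_ \in tp_points _ _]inE [_ \in tp_line_at_infinity _]inE => Hq.
    by rewrite /f aff_line !mulr0 !addr0 oner_eq0.
  by rewrite /f inf_line Hq; case: (slope W) => [s|]; rewrite ?mulr0 ?addr0 eqxx.
(* In characteristic 2 the line of slope s through (w0, y0) is (y0 + w0 s) + s w + y = 0, and the
   vertical one is w0 + w = 0. *)
have Haff v W o : (v <= S)%MS -> W \in spr -> (forall u : vec15, (u <= W)%MS = dirS o (phi u)) ->
    f @: tp_affine_line S v W = PG2_line (if o is Some s
       then row3 ((phi v).2 + (phi v).1.1 * s) s 1 else row3 (phi v).1.1 1 0).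
  move=> vS WS Ho; set n := (if _ is Some _ then _ else _).
  apply: im_line.
    by apply/subsetP => -[u|W']; rewrite !inE; [case/andP | move/eqP->].
  move=> [u|W']; rewrite [_ \in tp_points _ _]inE [_ \in tp_affine_line _ _ _]inE => Hq.
    have -> : u - v = u + v by congr (_ + _); apply: vec_opp.
    rewrite Hq Ho andTb.
    rewrite (realD R); move: Hq vS; rewrite !HS /f /n.
    case: (phi u) (phi v) => [[a b] c] [[a' b'] c'] /= /eqP-> /eqP->; rewrite addr0 eqxx /=.
    case: o {Ho n} => [s|]; rewrite aff_line ?mulr0 ?addr0 !mulr1.
      by rewrite -addf_eq0; congr (_ == 0); gfring.
    by rewrite addrC.
  rewrite /f /n -(slopeE _ _ Ho); have -> : (W' == W) = (slope W' == slope W).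
    by apply/eqP/eqP => [->//|/(slope_inj _ _ Hq WS)].
  case: (slope W) (slope W') => [s|] [s'|]; rewrite inf_line ?mulr1 ?mulr0 ?addr0 ?oner_eq0 ?eqxx //.
  by rewrite addf_eq0 eq_sym.
apply/setP => l; apply/imsetP/PG2_linesP => [[l']|[n n0 ->]].
  rewrite inE => /orP[/imset2P[v W]|/set1P ->]; last first.
    by move=> ->; exists (row3 1 0 0); rewrite ?row3_eq0 ?oner_eq0.
  rewrite !inE => vS WS -> ->; have [_ [o Ho]] := (HW W).1 WS.
  rewrite (Haff v W o) //; eexists; last by [].
  by case: o {Ho} => [s|]; rewrite row3_eq0 oner_eq0 ?andbF.
rewrite (row3E n) in n0 *; move: (n 0 0) (n 0 1) (n 0 2) n0 => a b c n0.
have sc (k a' b' c' : gf32) : k != 0 -> PG2_line (row3 (k * a') (k * b') (k * c')) = PG2_line (row3 a' b' c').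
  move=> k0; apply/setP => p; case: (boolP (p \in PG2_points gf32)); last first.
    by rewrite ![p \in PG2_line _]inE => /negPf ->.
  case/PG2_pointsP => u u0 ->; rewrite !PG2_line_gen // (row3E u) !dot3E.
  by rewrite ![_ * (k * _)]mulrCA -!mulrDr mulf_eq0 (negPf k0).
(* The line a + b w + c y = 0 with c <> 0 has slope b / c and contains (0, a / c); with c = 0 and b
   <> 0 it is w = a / b; otherwise it is the line at infinity. *)
have [c0|c0] := eqVneq c 0; last first.
  have [W WS Ho] := slope_onto (Some (b / c)).
  exists (tp_affine_line S (g (0, 0, a / c)) W).
    rewrite inE; apply/orP; left; apply/imset2P; exists (g (0, 0, a / c)) W => //.
    by rewrite inE HS gK.
  rewrite (Haff _ _ (Some (b / c)) _ WS Ho); last by rewrite HS gK.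
  rewrite gK -[(_, _, _).1.1]/(0 : gf32) mul0r addr0 -[(_, _, _).2]/(a / c).
  by rewrite -[RHS](sc c _ _ _ c0) mulr1 ![c * (_ / c)]mulrC !(divfK c0).
have [b0|b0] := eqVneq b 0; last first.
  have [W WS Ho] := slope_onto None.
  exists (tp_affine_line S (g (a / b, 0, 0)) W).
    rewrite inE; apply/orP; left; apply/imset2P; exists (g (a / b, 0, 0)) W => //.
    by rewrite inE HS gK.
  rewrite (Haff _ _ None _ WS Ho); last by rewrite HS gK.
  rewrite gK -[RHS](sc b _ _ _ b0) mulr1 mulr0 -[(_, _, _).1.1]/(a / b).
  by rewrite [b * _]mulrC (divfK b0) c0.
exists (tp_line_at_infinity spr); first by rewrite inE set11 orbT.
rewrite Hinf; rewrite b0 c0 in n0 *; rewrite row3_eq0 !eqxx !andbT in n0.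
by rewrite -(sc a 1 0 0 n0) mulr1 !mulr0.
Qed.

(** * Inequivalence of the 35 classes *)

Definition scal (k : gf32) (v : G3) : G3 := let: (w, x, y) := v in (k * w, k * x, k * y).

Lemma scalD k : {morph scal k : u v / u + v}.
Proof. by move=> [[a b] c] [[a' b'] c']; congr (_, _, _) => /=; rewrite mulrDr. Qed.

Lemma scal_ptv h i k a : scal k (ptv h i a) = ptv h i (k * a).
Proof. by case: i => [m|] /=; rewrite ?mulr0 ?mulrA. Qed.

Lemma ptvD h i a b : ptv h i (a + b) = ptv h i a + ptv h i b.
Proof. by case: i => [m|]; congr (_, _, _); rewrite /= ?mulrDl ?addr0. Qed.

Lemma iter_fsqD t : {morph iter t fsq : x y / x + y}.
Proof. by elim: t => [//|t IH] x y; rewrite !iterS IH !fsqE sqrD2. Qed.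

Lemma iter_fsqM t : {morph iter t fsq : x y / x * y}.
Proof. by elim: t => [//|t IH] x y; rewrite !iterS IH !fsqE exprMn. Qed.

(** The image of [g2] is a root of X^5 + X^2 + 1, so it is a conjugate of [g2], and the powers of
    [g2] span the field. *)
Lemma frobenius_iter (rho : gf32 -> gf32) : {morph rho : x y / x + y} ->
  {morph rho : x y / x * y} -> rho 1 = 1 -> exists2 t, (t < 5)%N & rho =1 iter t fsq.
Proof.
move=> rD rM r1.
have : rho g2 * rho g2 * rho g2 * rho g2 * rho g2 + rho g2 * rho g2 + 1 = 0.
  by rewrite -r1 -!rM -!rD; apply: (additive0 rD).
have agree z t : rho g2 = z -> iter t fsq g2 = z -> (t < 5)%N -> exists2 t, (t < 5)%N & rho =1 iter t fsq.
  move=> E1 E2 t5; exists t => // x; elim/gf_span: x => [|x y Ex Ey|g].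
  - by rewrite (additive0 rD) (additive0 (iter_fsqD t)).
  - by rewrite rD iter_fsqD Ex Ey.
  have E4 : rho g4 = iter t fsq g4 by rewrite -[g4]/(g2 * g2) rM iter_fsqM E1 E2.
  rewrite !inE => /or4P[/eqP->|/eqP->|/eqP->|/orP[]/eqP->].
  - by rewrite -[g1]/(1 : gf32) r1 iter_fsq1.
  - by rewrite E1 E2.
  - exact: E4.
  - by rewrite -[g8]/(g2 * g4) rM iter_fsqM E1 E2 E4.
  - by rewrite -[g16]/(g4 * g4) rM iter_fsqM E4.
(* The roots that remain are [g2], [g4], [g13], [g16], [g27], in this order; hence the exponents 0,
   1, 3, 2, 4. *)
case E : (rho g2) => // _; move: E.
- by move/(agree _ 0%N); apply.
- by move/(agree _ 1%N); apply.
- by move/(agree _ 3%N); apply.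
- by move/(agree _ 2%N); apply.
- by move/(agree _ 4%N); apply.
Qed.

Record pt_map (psi : G3 -> G3) (h h' : gf32 -> gf32) : Prop := PtMap {
  pt_mapD : {morph psi : x y / x + y};
  pt_map_bij : bijective psi;
  pt_map_pt : forall i, exists j, forall v, pt h' j (psi v) = pt h i v }.

Lemma pt_map_onto psi h h' : pt_map psi h h' ->
  exists2 s : option gf32 -> option gf32, bijective s & forall i v, pt h' (s i) (psi v) = pt h i v.
Proof.
move=> [_ _ /fin_all_exists[s Hs]]; exists s => //; apply: injF_bij => i j E.
by apply: (@pt_ptv h i j 1 (oner_neq0 _)); rewrite -Hs -E Hs; apply/ptP; exists 1.
Qed.

Lemma proj_equiv_map h h' : proj_equiv (oval_spaces h) (oval_spaces h') ->
  exists psi, pt_map psi h h'.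
Proof.
move=> [A [uA EO]]; have [g K gK] := phi0_bij.
exists (fun v => phi0 (g v *m A)); split.
- move=> x y; rewrite -phi0D -mulmxDl; congr (phi0 (_ *m _)).
  by apply: (can_inj K); rewrite phi0D !gK.
- exists (fun v => phi0 (g v *m invmx A)) => v; rewrite K.
    by rewrite mulmxK // gK.
  by rewrite mulmxKV // gK.
move=> i; have [X XO HX] := real_ex (oval_spacesP h) i.
have : <<X *m A>>%MS \in oval_spaces h' by rewrite EO imset_f.
case/(real_pt (oval_spacesP h')) => j Hj; exists j => v.
by rewrite -Hj genmxE submxMfree ?row_free_unit // HX gK.
Qed.

(** * Additive maps between ovals are semilinear *)

Definition pt_coord (i : option gf32) (v : G3) : gf32 := if i is Some _ then v.1.1 else v.1.2.

Lemma pt_coordK h i v : pt h i v -> ptv h i (pt_coord i v) = v.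
Proof. by case/ptP => a ->; case: i. Qed.

Lemma pt_coordD i v w : pt_coord i (v + w) = pt_coord i v + pt_coord i w.
Proof. by case: v w i => [[a b] c] [[a' b'] c'] [m|]. Qed.

Section Semilinear.
Variables (psi : G3 -> G3) (h h' : gf32 -> gf32) (s : option gf32 -> option gf32).
Hypotheses (oh : opoly h) (oh' : opoly h') (M : pt_map psi h h') (s_bij : bijective s).
Hypothesis sE : forall i v, pt h' (s i) (psi v) = pt h i v.

Let psiD := pt_mapD M.
Let h1 : h 1 != 0. Proof. exact: opoly_neq0 oh (oner_neq0 _). Qed.

(** The additive map that [psi] induces from the coordinate on the point i to the coordinate on its
    image. *)
Let al i a := pt_coord (s i) (psi (ptv h i a)).

Let alE i a : psi (ptv h i a) = ptv h' (s i) (al i a).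
Proof. by rewrite pt_coordK // sE; apply/ptP; exists a. Qed.

Let alD i : {morph al i : a b / a + b}.
Proof. by move=> a b; rewrite /al ptvD psiD pt_coordD. Qed.

Let al_inj i : injective (al i).
Proof.
move=> a b E; apply: (@ptv_inj h i); apply: (bij_inj (pt_map_bij M)).
by rewrite !alE E.
Qed.

Let al_neq0 i a : a != 0 -> al i a != 0.
Proof. by apply: contra_neq => E; apply: (@al_inj i); rewrite E (additive0 (@alD i)). Qed.

(* The point [m] expressed in the frame formed by the points [0], [oo] and [1]. *)
Let frame m a : h m != 0 -> let k := h m / h 1 in
  ptv h (Some 0) (a * (1 + k)) + ptv h None (a * (m + k)) + ptv h (Some 1) (a * k)
  = ptv h (Some m) a.
Proof.
have [h0 _ _] := oh; move=> _ k; congr (_, _, _); rewrite /= ?h0 ?mulr0 ?mulr1 ?addr0 ?add0r.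
- by rewrite -mulrDr -addrA addff addr0 mulr1.
- by rewrite -mulrDr -addrA addff addr0.
- by rewrite -mulrA divfK.
Qed.

(** The images under [psi] of the vectors with coordinates a and 1 on the point m are proportional.
    Both are expanded in the frame; the images of the three frame points are independent, so the
    coefficients can be compared one by one and the factor belonging to m eliminated. *)
Let frame_al m : m != 0 -> m != 1 -> let k := h m / h 1 in forall a,
  al (Some 0) (a * (1 + k)) * al (Some 1) k = al (Some 1) (a * k) * al (Some 0) (1 + k) /\
  al None (a * (m + k)) * al (Some 1) k = al (Some 1) (a * k) * al None (m + k).
Proof.
move=> m0 m1 k a; have hm : h m != 0 by apply: opoly_neq0 oh m0.
have E b : ptv h' (s (Some 0)) (al (Some 0) (b * (1 + k))) + ptv h' (s None) (al None (b * (m + k)))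
    + ptv h' (s (Some 1)) (al (Some 1) (b * k)) = ptv h' (s (Some m)) (al (Some m) b).
  by rewrite -!alE -!psiD frame.
have wm1 : al (Some m) 1 != 0 by rewrite al_neq0 ?oner_neq0.
move: (E a) (E 1); rewrite !mul1r; set w := al (Some m) a; set w1 := al (Some m) 1 in wm1 *.
set x := al _ (a * (1 + k)); set y := al _ (a * (m + k)); set z := al _ (a * k).
set x1 := al _ (1 + k); set y1 := al _ (m + k); set z1 := al _ k => Ea E1.
have : scal w1 (ptv h' (s (Some m)) w) + scal w (ptv h' (s (Some m)) w1) = 0.
  by rewrite !scal_ptv [w * _]mulrC -ptvD addff ptv0.
rewrite -{1}Ea -E1 !scalD !scal_ptv.
rewrite (addrACA (_ + _)) (addrACA (ptv _ _ _)) -!ptvD => /(ptv_indep oh').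
case; rewrite ?(bij_eq s_bij) //.
move=> /add_eq0P ex /add_eq0P ey /add_eq0P ez.
split; apply: (mulfI wm1).
  by rewrite !mulrA ex ez mulrAC.
by rewrite !mulrA ey ez mulrAC.
Qed.

Let al01 r : r != 0 -> r != 1 -> exists2 g, g != 0 & forall b, al (Some 1) b = g * al (Some 0) (b * r).
Proof.
move=> r0 r1; have [h0 hi _] := oh; have [h'' _ hK] := injF_bij hi.
have r1' : 1 + r != 0 by rewrite addf_eq0 eq_sym.
pose k := (1 + r)^-1; pose m := h'' (k * h 1); have hm : h m = k * h 1 by rewrite hK.
have k0 : k != 0 by rewrite invr_eq0.
have k1 : k != 1 by rewrite invr_eq1 -subr_eq0 foppE addrAC addff add0r.
have m0 : m != 0 by apply: contra_neq (mulf_neq0 k0 h1) => E; rewrite -hm E h0.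
have m1 : m != 1 by apply: contra_neq k1 => E; apply: (mulIf h1); rewrite -hm E mul1r.
have Ek : h m / h 1 = k by rewrite hm mulfK.
have kk : 1 + k != 0 by rewrite addf_eq0 eq_sym.
have := frame_al m0 m1; rewrite Ek /= => F.
exists (al (Some 1) k / al (Some 0) (1 + k)).
  by rewrite mulf_neq0 ?invr_eq0 ?al_neq0.
move=> b; have [] := F (b / k); rewrite divfK // => E _.
have -> : b * r = b / k * (1 + k).
  by rewrite mulrDr mulr1 divfK // /k invrK mulrDr mulr1 addrAC addff add0r.
by apply: (mulIf (al_neq0 (Some 0) kk)); rewrite mulrAC divfK ?al_neq0 // -E mulrC.
Qed.

Let pick_r (u : gf32) : exists r, [/\ r != 0, r != 1 & u * r != 1].
Proof.
have [E|E] := eqVneq (u * g2) 1; last by exists g2.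
by exists g3; split=> //; case: u E.
Qed.

Let rho u := al (Some 0) u / al (Some 0) 1.
Let a1_neq0 : al (Some 0) 1 != 0. Proof. by rewrite al_neq0 ?oner_neq0. Qed.

(** For u <> 0, [al01] at r and at u r expresses the same map on the point 1 in two ways; comparing
    them gives the claim. [pick_r] keeps both arguments away from 1. *)
Let rhoP u a : al (Some 0) (u * a) = rho u * al (Some 0) a.
Proof.
have [->|u0] := eqVneq u 0; first by rewrite /rho !mul0r (additive0 (@alD _)) !mul0r.
have [r' [r0 r1 ur1]] := pick_r u.
have [g g0 Hg] := al01 r0 r1; have [g' g0' Hg'] := al01 (mulf_neq0 u0 r0) ur1.
have E b : al (Some 0) (u * b) = g'^-1 * g * al (Some 0) b.
  by rewrite -mulrA; have := Hg (b / r'); rewrite Hg' divfK // => <-;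
    rewrite mulKf // mulrCA divfK.
have Eu := E 1; rewrite mulr1 in Eu.
by rewrite E /rho Eu mulfK.
Qed.

Lemma pt_map_semilinear : exists2 t, (t < 5)%N &
  forall k v, psi (scal k v) = scal (iter t fsq k) (psi v).
Proof.
have [h0 hi /arcfunP ha] := oh.
have [|||t t5 Ht] := @frobenius_iter rho.
- by move=> x y; rewrite /rho alD mulrDl.
- by move=> x y; rewrite {1}/rho rhoP mulrA.
- by rewrite /rho divff.
exists t => // k v.
have R1 u a : al (Some 1) (u * a) = rho u * al (Some 1) a.
  have [g _ Hg] := @al01 g2 isT isT.
  by rewrite !Hg -mulrA rhoP mulrCA.
(* The second relation of [frame_al] at m = [g2] is used; its coefficient [g2 + c] is nonzero
   because the points 0, 1 and [g2] are not collinear. *)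
have Ri u a : al None (u * a) = rho u * al None a.
  have := @frame_al g2 isT isT; set c := h g2 / h 1 => /= F.
  have c0 : c != 0 by rewrite mulf_neq0 ?invr_eq0 // (opoly_neq0 oh).
  have mc : g2 + c != 0.
    have := ha 0 1 g2 isT isT isT; rewrite /det3 h0 mul0r !add0r; apply: contra_neq.
    move=> /add_eq0P E; rewrite -[h g2](divfK h1) -/c -E.
    by rewrite mulr1 [g2 * _]mulrC addff.
  have G b : al None (b * (g2 + c)) = rho b * al None (g2 + c).
    have [_] := F b; rewrite (R1 b c) [RHS]mulrAC => E.
    by apply: (mulIf (al_neq0 (Some 1) c0)).
  have rM x y : rho (x * y) = rho x * rho y by rewrite {1}/rho rhoP mulrA.
  by rewrite -[a](divfK mc) mulrA !G rM mulrA.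
pose d (v : G3) := ptv h (Some 0) (v.1.1 + v.2 / h 1) + ptv h None (v.1.2 + v.2 / h 1)
                     + ptv h (Some 1) (v.2 / h 1).
have dE u : u = d u.
  case: u => -[w x] y; congr (_, _, _); rewrite /= ?h0 ?mulr0 ?mulr1 ?addr0 ?add0r ?divfK //.
    by rewrite -addrA addff addr0.
  by rewrite -addrA addff addr0.
have dZ : scal k v = d (scal k v) by apply: dE.
rewrite dZ [in RHS](dE v) /d !psiD !scalD !alE !scal_ptv -Ht.
case: v {dZ} => -[w x] y; rewrite -[scal _ _]/(k * w, k * x, k * y) /fst /snd.
by rewrite -(mulrA k y) -!mulrDr (rhoP k) (Ri k) (R1 k).
Qed.

End Semilinear.

(** Precomposition with the coordinatewise square root lowers t by one and replaces [h] by
    [T4 h]. *)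
Lemma linear_of_semilinear t psi h h' : pt_map psi h h' ->
  (forall k v, psi (scal k v) = scal (iter t fsq k) (psi v)) ->
  exists2 psi', pt_map psi' (iter t T4 h) h' & forall k v, psi' (scal k v) = scal k (psi' v).
Proof.
elim: t psi h => [|t IH] psi h M L; first by exists psi.
pose rt (v : G3) : G3 := let: (w, x, y) := v in (froot w, froot x, froot y).
rewrite iterSr; apply: (IH (fun v => psi (rt v))); last first.
  move=> k [[w x] y]; rewrite /= !frootM.
  by have := L (froot k) (froot w, froot x, froot y); rewrite iterSr frootK.
have [D B P] := M; split.
- by move=> [[w x] y] [[w' x'] y']; rewrite -D /= !frootD.
- apply: (bij_comp B); exists (fun v : G3 => let: (w, x, y) := v in (fsq w, fsq x, fsq y));
    by move=> [[w x] y] /=; rewrite ?frootK ?fsqK.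
move=> i; have [j Hj] := P (omap froot i); exists j => v; rewrite Hj.
case: i v {Hj} => [m|] [[w x] y] /=; last by rewrite !froot_eq0.
rewrite -frootM (inj_eq froot_inj); congr (_ && _).
by rewrite /T4 -[in RHS](froot_sq w) -[y in RHS]froot_sq -exprMn (inj_eq sqr_inj).
Qed.

(** * Linear equivalences: the nucleus and the point at infinity *)

Section Linear.
Variables (psi : G3 -> G3) (h h' : gf32 -> gf32).
Hypotheses (oh : opoly h) (oh' : opoly h') (M : pt_map psi h h').
Hypothesis L : forall k v, psi (scal k v) = scal k (psi v).

Let psiD := pt_mapD M.

(** The nucleus is the only point on no secant. A point with n1 <> 0 is on a secant through (0 : 1 :
    0), since [h'] is onto; one with n1 = 0 and n2 <> 0 is on a secant through the point 0, since
    the slopes there fill the field. *)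
Lemma linear_nucleus : exists2 n, n != 0 & psi (0, 0, 1) = (0, 0, n).
Proof.
have [s [s' sK s'K] sE] := pt_map_onto M; have [g K gK] := pt_map_bij M.
have psi0 : psi 0 = 0 by apply: (additive0 psiD).
have key j j' a b c : j != j' ->
    ptv h' j a + ptv h' j' b + psi (0, 0, c) = 0 -> c = 0.
  have onto l d : exists e, ptv h' l d = psi (ptv h (s' l) e).
    have /ptP[e E] : pt h (s' l) (g (ptv h' l d)).
      by rewrite -sE s'K gK; apply/ptP; exists d.
    by exists e; rewrite -E gK.
  move=> jj'; have [e ->] := onto j a; have [e' ->] := onto j' b.
  rewrite -!psiD -psi0 => /(can_inj K).
  have : s' j != s' j' by rewrite (can_eq s'K).
  case: (s' j) (s' j') => [m|] [m'|] //= mm' [].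
  - move=> /eqP; rewrite addr0 addf_eq0 => /eqP <- /eqP.
    rewrite addr0 -mulrDr mulf_eq0 addf_eq0 => /orP[/eqP->|/eqP E]; first by rewrite !mul0r !add0r.
    by rewrite E eqxx in mm'.
  - by rewrite !addr0 => -> _; rewrite mul0r !add0r.
  - by rewrite add0r addr0 => -> _; rewrite mul0r !add0r.
have [h0 hi _] := oh'; have := key; case E : (psi (0, 0, 1)) => [[n1 n2] n3] {}key.
have {}key j j' a b c : j != j' -> ptv h' j a + ptv h' j' b + (c * n1, c * n2, c * n3) = 0 -> c = 0.
  move=> jj' Z; apply: (key j j' a b c jj'); rewrite -Z; congr (_ + _).
  by rewrite -[RHS]/(scal c (n1, n2, n3)) -E -L /= mulr0 mulr1.
have n10 : n1 = 0.
  have [//|n0] := eqVneq n1 0; have [h'' _ hK] := injF_bij hi.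
  suff : (1 : gf32) = 0 by move/eqP; rewrite oner_eq0.
  apply: (key None (Some (h'' (n3 / n1))) (n1 * h'' (n3 / n1) + n2) n1) => //.
  congr (_, _, _); rewrite /= ?mul1r ?add0r ?addff // ?hK.
    by rewrite -addrA addff.
  by rewrite [n1 * _]mulrC divfK // addff.
have n20 : n2 = 0.
  have [//|n0] := eqVneq n2 0.
  suff : (1 : gf32) = 0 by move/eqP; rewrite oner_eq0.
  have [n30|n30] := eqVneq n3 0.
    apply: (key None (Some 0) n2 0) => //.
    by congr (_, _, _); rewrite /= ?mul1r ?mul0r ?addr0 ?addff // n30.
  have [q _ qK] := injF_bij (@slope_inj _ oh' 0); set m := q (n3 / n2).
  have := qK (n3 / n2); rewrite -/m h0 !addr0 => Em.
  have m0 : m != 0.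
    apply: contra_neq (mulf_neq0 n30 (finv_neq0 n0)) => m0.
    by rewrite -Em m0 invr0 mulr0.
  apply: (key (Some m) (Some 0) (n2 / m) (n2 / m)) => //.
  congr (_, _, _); rewrite /= ?mul1r ?n10 ?addr0 ?addff // ?mulr0 ?addr0 ?divfK ?addff // h0 mulr0 addr0.
  by rewrite -mulrA [m^-1 * _]mulrC Em mulrC divfK // addff.
exists n3; last by rewrite n10 n20.
apply/eqP => n30; have : (0, 0, 1) = 0 :> G3.
  by apply: (can_inj K); rewrite psi0 E n10 n20 n30.
by move=> [/eqP]; rewrite oner_eq0.
Qed.

(** The only point of the oval with first coordinate 0 is (0 : 1 : 0), so it is fixed, as is the
    nucleus. The images of the vectors (1, m, h m) then give the relation between [h] and [h']. *)
Lemma linear_fixing_infinity : (psi (0, 1, 0)).1.1 = 0 ->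
  exists a b e, [/\ a != 0, b != 0 & h =1 T2 a b (T1 e h')].
Proof.
move=> v10; have [h0 hi _] := oh; have [h0' hi' _] := oh'.
have [n n0 En] := linear_nucleus; have [s _ sE] := pt_map_onto M.
have [g K gK] := pt_map_bij M; have psi0 : psi 0 = 0 by apply: (additive0 psiD).
have E v : psi v = scal v.1.1 (psi (1, 0, 0)) + scal v.1.2 (psi (0, 1, 0)) + scal v.2 (psi (0, 0, 1)).
  case: v => -[w x] y; rewrite -!L -!psiD; congr psi.
  by congr (_, _, _); rewrite /= ?mulr1 ?mulr0 ?addr0 ?add0r.
move: E v10; rewrite En; case Eu : (psi (1, 0, 0)) => [[u1 u2] u3].
case Ev : (psi (0, 1, 0)) => [[v1 v2] v3] E /= v10; rewrite {}v10 in Ev E.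
have : pt h' (s None) (0, v2, v3) by rewrite -Ev sE /= !eqxx.
have v20 : v2 != 0 \/ v3 != 0.
  case: (eqVneq v2 0) => [E2|]; last by left.
  right; apply/eqP => E3; have : (0, 1, 0) = 0 :> G3.
    by apply: (can_inj K); rewrite psi0 Ev E2 E3.
  by move=> [/eqP]; rewrite oner_eq0.
case: (s None) => [m|] /=.
  by rewrite !mul0r => /andP[/eqP E2 /eqP E3]; move: v20; rewrite E2 E3 eqxx => -[].
move=> /eqP E3; have {}v20 : v2 != 0 by case: v20 => //; rewrite E3 eqxx.
have u10 : u1 != 0.
  apply/eqP => u10; have : (v2, u2, u3 * v2 / n) = 0 :> G3.
    apply: (can_inj K); rewrite psi0 E /=; congr (_, _, _); rewrite /= ?u10 ?mulr0 ?addr0 //.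
      by rewrite [u2 * _]mulrC addff.
    by rewrite E3 mulr0 addr0 divfK // [v2 * _]mulrC addff.
  by case=> /eqP; rewrite (negPf v20).
have key m : u3 + h m * n = u1 * h' (u2 / u1 + m * v2 / u1).
  have : pt h' (s (Some m)) (psi (1, m, h m)) by rewrite sE /= !mul1r !eqxx.
  rewrite E /= !mul1r !mulr0 !addr0 E3 mulr0 addr0; case: (s _) => [m'|] /=.
    move=> /andP[/eqP Em /eqP ->]; congr (_ * h' _).
    by apply: (mulfI u10); rewrite -Em -mulrDl [RHS]mulrC divfK.
  by rewrite (negPf u10).
exists (u1 / n), (v2 / u1), (u2 / u1); rewrite !mulf_neq0 ?invr_eq0 //; split=> // m.
have := key 0; rewrite h0 !mul0r !addr0 => Eu3.
have := key m; rewrite Eu3 => /(canRL (addKr _)); rewrite foppE => Em.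
apply: (mulIf n0); rewrite Em /T2 /T1 [RHS]mulrAC divfK // -mulrDr addrC.
by congr (_ * (h' _ + _)); rewrite [RHS]addrC [v2 / u1 * m]mulrC mulrA.
Qed.

End Linear.

(** [chi] brings the point of abscissa e to (0 : 1 : 0), which reduces an arbitrary image of
    infinity to [linear_fixing_infinity]. *)
Lemma linear_T1T3 psi (h h' : gf32 -> gf32) (e : gf32) : h' 0 = 0 -> pt_map psi h h' -> (forall k v, psi (scal k v) = scal k (psi v)) ->
  let chi (v : G3) : G3 := let: (w, x, y) := v in (x + e * w, w, y + h' e * w) in
  pt_map (fun v => chi (psi v)) h (T3 (T1 e h')) /\
  forall k v, chi (psi (scal k v)) = scal k (chi (psi v)).
Proof.
move=> h0 [D B P] L chi; split; last first.
  by move=> k v; rewrite L; case: (psi v) => -[w x] y /=; rewrite !mulrDr !(mulrCA k).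
split.
- move=> v w; rewrite D; case: (psi v) (psi w) => [[a b] c] [[a' b'] c'].
  by congr (_, _, _); rewrite /= ?mulrDr addrACA.
- apply: bij_comp B; exists (fun v : G3 => let: (w, x, y) := v in (x, w + e * x, y + h' e * x));
    by move=> [[w x] y] /=; rewrite -!addrA !addff !addr0.
move=> i; have [j Hj] := P i.
exists (if j is Some m then (if m == e then None else Some (m + e)^-1) else Some 0).
move=> v; rewrite -Hj; case: (psi v) j {Hj} => -[w x] y [m|] /=; last first.
  have -> : T3 (T1 e h') 0 = 0 by rewrite /T3 mul0r.
  rewrite !mulr0.
  by case: eqP => //= ->; rewrite mulr0 addr0.
have [->|me] := eqVneq m e; rewrite /= ?addf_eq0.
  by rewrite [e * w]mulrC [h' e * w]mulrC.
have me0 : m + e != 0 by rewrite addf_eq0.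
rewrite /T3 /T1 invrK -addrA addff addr0; apply/andP/andP => -[/eqP e1 /eqP e2]; split; apply/eqP.
- by apply: add_eq0P; move: (congr1 (fun z => z * (m + e)) e1); rewrite divfK // => /eqP;
    rewrite -addf_eq0 => /eqP <-; gfring.
- apply: add_eq0P; apply: (addIr (h' e * w)); rewrite add0r addrAC e2 mulrA -e1.
  by move: (h' m) (h' e) => p q; gfring.
- by apply: (mulIf me0); rewrite divfK // e1; gfring.
- have -> : x + e * w = w * (m + e) by rewrite e1; gfring.
  by rewrite mulrA mulfK // e2; move: (h' m) (h' e) => p q; gfring.
Qed.

Lemma proj_equiv_opoly h h' : opoly h -> opoly h' ->
  proj_equiv (oval_spaces h) (oval_spaces h') ->
  exists t a b e g, [/\ (t < 5)%N, a != 0, b != 0, g = h' \/ (exists e', g = T3 (T1 e' h')) &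
    iter t T4 h =1 T2 a b (T1 e g)].
Proof.
move=> oh oh' /proj_equiv_map[psi M]; have [s sB sE] := pt_map_onto M.
have [t t5 S] := pt_map_semilinear oh oh' M sB sE.
have [psi' M' L] := linear_of_semilinear M S; have [_ oth _] := iter_T4 t oh.
have [v0|v0] := eqVneq (psi' (0, 1, 0)).1.1 0.
  have [a [b [e [a0 b0 E]]]] := linear_fixing_infinity oth oh' M' L v0.
  by exists t, a, b, e, h'; split=> //; left.
have [h0' _ _] := oh'; pose e' := (psi' (0, 1, 0)).1.2 / (psi' (0, 1, 0)).1.1.
have [M'' L''] := linear_T1T3 e' h0' M' L.
have oh'' : opoly (T3 (T1 e' h')) by apply/opoly_T3/opoly_T1.
have [|a [b [e [a0 b0 E]]]] := linear_fixing_infinity oth oh'' M'' L''.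
  by move: v0; rewrite /e'; case: (psi' (0, 1, 0)) => -[v1 v2] v3 /= v0; rewrite divfK // addff.
by exists t, a, b, e, (T3 (T1 e' h')); split=> //; right; exists e'.
Qed.

(** * Separating the listed polynomials *)

Definition coef_list (g : gf32 -> gf32) : seq gf32 :=
  [seq fsum (fun x => fmul (g x) (x ^+ (31 - 2 * u))) | u <- iota 1 15].

(* Does [t] equal the coefficient list of [T2 a b g], where [l] is that of [g] and [y = b ^ 2]? *)
Fixpoint scaled_eq (t l : seq gf32) (a y : gf32) : bool :=
  match t, l with
  | c :: t', x :: l' => let a' := fmul a y in if feq c (fmul a' x) then scaled_eq t' l' a' y else false
  | _, _ => true
  end.

(** Translation and scaling do not affect whether coefficient 15 vanishes. If it is nonzero, the
    normal form of the lists in [ts] forces e and a = d b, so only b is searched. If it is zero,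
    only [ms] can match; its members are multiplicative, so b is absorbed in the constant factor. *)
Definition avoids (ts : seq (seq gf32)) (ms : seq (gf32 -> gf32)) (g : gf32 -> gf32) : bool :=
  let d := finv (fmom id g) in
  if fzero d then
    allg (fun e => let k := memo (T1 e g) in
      if hasf (fun m => allg (fun x => feq (k x) (fmul (k g1) (m x)))) ms then false else true)
  else
    let e := froot (froot (fmul (fmom fpow5 g) d)) in
    let l := coef_list (memo (T1 e g)) in
    allg (fun b => if fzero b then true else
      let a := fmul d b in let y := fsq b in
      if hasf (fun t => scaled_eq t l a y) ts then false else true).

Definition frobs (c : seq gf32) : seq (seq gf32) := [seq [seq iter t fsq b | b <- c] | t <- iota 0 5].

(** Conjugates are formed for indices below 32 only, the three other monomials being fixed by [T4].
    The two cases, [h] and [T3 (T1 e h)], are those of [proj_equiv_opoly]. *)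
Definition distinct (j : nat) : bool :=
  let h := memo (hpoly (nth [::] oval_coefs j)) in
  let ts := flatten [seq frobs (nth [::] oval_coefs i) | i <- iota 0 32 & i != j] in
  let ms := [seq memo (hpoly (nth [::] oval_coefs i)) | i <- iota 32 3 & i != j] in
  if avoids ts ms h then allg (fun e => avoids ts ms (memo (T3 (memo (T1 e h))))) else false.

Lemma ovals_distinct : allf distinct (iota 0 35).
Proof. vm_cast_no_check (erefl true). Qed.

Lemma fmom_bc p g u : (forall x, p x = x ^+ (31 - 2 * u)) -> fmom p g = bc g u.
Proof.
by move=> H; rewrite /fmom /fsum -sum_gfE; apply: eq_bigr => x _; rewrite -H.
Qed.

Lemma coef_listE g u : (0 < u < 16)%N -> vec (coef_list g) u = bc g u.
Proof.
case: u => // u /andP[_ u15]; rewrite /vec /coef_list (nth_map 0%N) ?size_iota // nth_iota //.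
by rewrite /fsum -sum_gfE.
Qed.

Lemma scaled_eqP t l a y : size t = size l ->
  (forall u, (u < size t)%N -> nth g0 t u = a * y ^+ u.+1 * nth g0 l u) -> scaled_eq t l a y.
Proof.
elim: t l a => [|c t IH] [|x l] a //= [st] H.
have := H 0%N isT; rewrite /= expr1 => E.
rewrite (introT (feqP c (fmul (fmul a y) x)) E).
apply: IH => // u ut; have := H u.+1; rewrite /= ltnS => ->//.
by rewrite exprS mulrA.
Qed.

Section Avoids.
Variables (ts : seq (seq gf32)) (r : seq nat) (g : gf32 -> gf32) (a b e : gf32).
Let ms := [seq memo (hpoly (nth [::] oval_coefs i)) | i <- r].
Hypotheses (av : avoids ts ms g) (og : opoly g) (a0 : a != 0) (b0 : b != 0).

Let b15 : bc (T2 a b (T1 e g)) 15 = a * b ^+ 30 * bc g 15.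
Proof. by rewrite bc_T2 // bc_T1_15. Qed.

Let fmom15 : fmom id g = bc g 15. Proof. by apply: fmom_bc => x. Qed.

Lemma avoids_coefs t : t \in ts -> size t = 15%N ->
  (forall u, (0 < u < 16)%N -> vec t u = bc (T2 a b (T1 e g)) u) ->
  vec t 15 = 1 -> vec t 13 = 0 -> False.
Proof.
move=> tts st Ht t15 t13; have := Ht 15%N isT; rewrite b15 t15 => E15.
have B0 : bc g 15 != 0 by apply/eqP => Z; move/eqP: E15; rewrite Z mulr0 oner_eq0.
have Ea : a = finv (bc g 15) * b.
  apply: (mulIf (mulf_neq0 (expf_neq0 30 b0) B0)); rewrite [LHS]mulrA -E15.
  have eb : b * b ^+ 30 = 1 by rewrite -exprS gf_expr31.
  by rewrite -[finv _]/((bc g 15)^-1) [RHS]mulrA -(mulrA _ b) eb mulr1 mulVf.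
have := Ht 13%N isT; rewrite t13 bc_T2 // => /esym/eqP.
rewrite mulf_eq0 (negPf (mulf_neq0 a0 (expf_neq0 _ b0))) /= bc_T1_13 // addf_eq0 => /eqP E13.
have Ee : e = froot (froot (bc g 13 * finv (bc g 15))).
  rewrite E13 -mulrA -[finv _]/((bc g 15)^-1) divff // mulr1.
  by rewrite (exprM e 2 2) !sqr_froot.
move: av; rewrite /avoids fmom15 (@fmom_bc fpow5 g 13); last first.
  by case.
case: (fzeroP (finv (bc g 15))) => [Z|_].
  by move: (finv_neq0 B0); rewrite -[_^-1]/(finv (bc g 15)) Z eqxx.
rewrite -[fmul (bc g 13) _]/(bc g 13 * finv (bc g 15)) -Ee => /allgP/(_ b).
case: (fzeroP b) => [Z|_]; first by move: b0; rewrite Z eqxx.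
rewrite -[fmul (finv _) b]/(finv (bc g 15) * b) -Ea (_ : hasf _ _) //.
rewrite hasfE; apply/hasP; exists t => //; apply: scaled_eqP; rewrite st; first by [].
move=> u u15; have Hu : (0 < u.+1 < 16)%N by [].
rewrite -[nth g0 t u]/(vec t u.+1) -[nth g0 _ u]/(vec (coef_list (memo (T1 e g))) u.+1).
rewrite Ht // bc_T2 // coef_listE // fsqE -exprM; congr (_ * _).
by apply: eq_bc => x; rewrite memoE.
Qed.

Lemma avoids_mono i : i \in r -> let m := hpoly (nth [::] oval_coefs i) in
  (forall x y, m (x * y) = m x * m y) -> m =1 T2 a b (T1 e g) -> bc m 15 = 0 -> False.
Proof.
move=> ir m mM Em; rewrite (eq_bc _ Em) b15 => /eqP.
rewrite mulf_eq0 (negPf (mulf_neq0 a0 (expf_neq0 _ b0))) /= => /eqP B0.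
move: av; rewrite /avoids fmom15 B0 -[finv 0]/g0 -[fzero g0]/true => /allgP/(_ e).
rewrite (_ : hasf _ _) //; rewrite hasfE has_map; apply/hasP; exists i => //=.
have T x : T1 e g x = a^-1 * m (x / b).
  by rewrite Em /T2 mulKf // mulrCA divff // mulr1.
apply/allgP => x; apply/feqP; rewrite !memoE -[fmul _ _]/(T1 e g 1 * m x) !T.
by rewrite mul1r -mulrA -mM [_ * x]mulrC.
Qed.

End Avoids.

Definition mono_ok : bool := allf (fun c => let m := memo (hpoly c) in
  if fzero (vec c 15) then
  allg (fun x => if feq (fsq (m (froot x))) (m x) then
    allg (fun y => feq (m (fmul x y)) (fmul (m x) (m y))) else false) else false) (drop 32 oval_coefs).

Lemma mono_okT : mono_ok. Proof. by vm_compute. Qed.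

Lemma norm_coefs : all (fun c => feq (vec c 15) g1 && fzero (vec c 13)) (take 32 oval_coefs).
Proof. by vm_compute. Qed.

Lemma size_oval_coefs : size oval_coefs = 35%N. Proof. by []. Qed.

Lemma nth_mono_coefs i : (32 <= i < 35)%N -> let m := hpoly (nth [::] oval_coefs i) in
  [/\ bc m 15 = 0, T4 m =1 m & forall x y, m (x * y) = m x * m y].
Proof.
move=> /andP[i32 i35] m; have ci : nth [::] oval_coefs i \in oval_coefs.
  by rewrite mem_nth ?size_oval_coefs.
have [_ _ Hc] := coefsP ci.
have : nth [::] oval_coefs i \in drop 32 oval_coefs.
  by rewrite -(subnKC i32) -nth_drop mem_nth // size_drop size_oval_coefs ltn_sub2r.
have := mono_okT; rewrite /mono_ok allfE => /allP H /H{H}.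
case: (fzeroP (vec _ 15)) => // b15 /allgP H; split; first by rewrite Hc.
  move=> x; have := H x; case: feqP => // E _.
  by move: E; rewrite !memoE fsqE.
by move=> x y; have := H x; case: feqP => // _ /allgP/(_ y)/feqP; rewrite !memoE.
Qed.

Lemma oval_spaces_inequivalent i j : (i < 35)%N -> (j < 35)%N ->
  proj_equiv (oval_spaces (hpoly (nth [::] oval_coefs i)))
             (oval_spaces (hpoly (nth [::] oval_coefs j))) -> i = j.
Proof.
move=> i35 j35; have [//|ij] := eqVneq i j.
have ci : nth [::] oval_coefs i \in oval_coefs by rewrite mem_nth ?size_oval_coefs.
have cj : nth [::] oval_coefs j \in oval_coefs by rewrite mem_nth ?size_oval_coefs.
have [si oi Hi] := coefsP ci; have [sj oj Hj] := coefsP cj.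
case/(proj_equiv_opoly oi oj) => t [a [b [e [g [t5 a0 b0 Hg E]]]]]; exfalso.
set ts := flatten [seq frobs (nth [::] oval_coefs i) | i <- iota 0 32 & i != j].
set r := [seq i <- iota 32 3 | i != j].
have [g' [av og E']] : exists g', [/\ avoids ts [seq memo (hpoly (nth [::] oval_coefs i)) | i <- r] g',
    opoly g' & iter t T4 (hpoly (nth [::] oval_coefs i)) =1 T2 a b (T1 e g')].
  have := ovals_distinct; rewrite allfE => /allP/(_ j); rewrite mem_iota j35 => /(_ isT).
  rewrite /distinct -/ts -/r.
  set A := avoids _ _ _; case EA : A => // /allgP D.
  case: Hg => [Eg|[e' Eg]].
    exists (memo (hpoly (nth [::] oval_coefs j))); split=> //.
      by apply: eq_opoly oj => x; rewrite memoE.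
    by move=> x; rewrite E Eg /T2 /T1 !memoE.
  exists (memo (T3 (memo (T1 e' (memo (hpoly (nth [::] oval_coefs j))))))); split.
  - exact: D.
  - apply: (@eq_opoly (T3 (T1 e' (hpoly (nth [::] oval_coefs j))))); last by apply/opoly_T3/opoly_T1.
    by move=> x; rewrite memoE /T3 memoE /T1 !memoE.
  - by move=> x; rewrite E Eg /T2 {1 3}/T1 !memoE /T3 !memoE /T1 !memoE.
have [i32|i32] := ltnP i 32.
  have [_ _ Ht] := iter_T4 t oi.
  have Hv u : (0 < u < 16)%N ->
      vec [seq iter t fsq b | b <- nth [::] oval_coefs i] u = iter t fsq (vec (nth [::] oval_coefs i) u).
    by case: u => // u /andP[_ u15]; rewrite /vec (nth_map g0) ?si.
  apply: (avoids_coefs av og a0 b0 (t := [seq iter t fsq b | b <- nth [::] oval_coefs i]) (e := e)).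
  - apply/flattenP; exists (frobs (nth [::] oval_coefs i)).
      by apply: map_f; rewrite mem_filter ij mem_iota.
    by apply/mapP; exists t; rewrite ?mem_iota.
  - by rewrite size_map si.
  - by move=> u Hu; rewrite -(eq_bc _ E') Ht Hi // Hv.
  - rewrite Hv //; have /allP/(_ (nth [::] oval_coefs i)) := norm_coefs.
    rewrite -{1}(nth_take [::] i32) mem_nth ?size_take ?size_oval_coefs // => /(_ isT)/andP[/feqP -> _].
    exact: iter_fsq1.
  - rewrite Hv //; have /allP/(_ (nth [::] oval_coefs i)) := norm_coefs.
    rewrite -{1}(nth_take [::] i32) mem_nth ?size_take ?size_oval_coefs // => /(_ isT)/andP[_ /fzeroP ->].
    exact: iter_fsq0.
have [B15 Tm mM] : let m := hpoly (nth [::] oval_coefs i) in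
  [/\ bc m 15 = 0, T4 m =1 m & forall x y, m (x * y) = m x * m y].
  by apply: nth_mono_coefs; rewrite i32.
apply: (avoids_mono av og a0 b0 (i := i) (e := e)) => //.
  by rewrite mem_filter ij mem_iota i32.
move=> x; rewrite -E'; elim: t {t5 E E'} x => // t IH x.
by rewrite iterS /T4 -IH -[LHS]Tm.
Qed.

(** * Trace duality and nuclei *)

Definition ftr (x : gf32) : gf32 := \sum_(i <- iota 0 5) iter i fsq x.

Lemma ftrD : {morph ftr : x y / x + y}.
Proof. by move=> x y; rewrite /ftr -big_split; apply: eq_bigr => i _; rewrite iter_fsqD. Qed.

Lemma ftr0 : ftr 0 = 0. Proof. exact: additive0 ftrD. Qed.

Definition ftr_tab (x : gf32) : gf32 := foldr (fun i s => fadd (iter i fsq x) s) g0 (iota 0 5).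

Lemma ftrE x : ftr x = ftr_tab x. Proof. by rewrite /ftr -foldr_sum. Qed.

Lemma ftrZ z y : ftr (ftr z * y) = ftr z * ftr y.
Proof.
have H : ftr z = 0 \/ ftr z = 1 by rewrite ftrE; case: z; vm_compute; auto.
by case: H => ->; rewrite ?mul1r // !mul0r ftr0.
Qed.

Definition dual_basis : seq gf32 := [:: g23; g25; g9; g22; g11].

Lemma dual_basisP (i j : 'I_5) : ftr (nth 0 dual_basis i * nth 0 gf_basis j) = (i == j)%:R.
Proof.
rewrite ftrE; apply/feqP; move: i j.
by do 2![case=> -[|[|[|[|[|//]]]]] ?]; vm_compute.
Qed.

Lemma ftr_nondegenerate u : (forall a, ftr (u * a) = 0) -> u = 0.
Proof.
move=> H; have : allg (fun u => if fzero u then true else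
    hasf (fun a => if fzero (ftr_tab (fmul u a)) then false else true) gf_enum) by vm_compute.
move=> /allgP/(_ u); case: fzeroP => // _; rewrite hasfE => /hasP[a _].
by rewrite -ftrE -[fmul u a]/(u * a) H.
Qed.

(** The adjoint for the trace form: an element is recovered from its traces against [gf_basis] by
    means of the dual basis. *)
Definition adj (L : gf32 -> gf32) (x : gf32) : gf32 :=
  \sum_(i < 5) ftr (x * L (nth 0 gf_basis i)) * nth 0 dual_basis i.

Lemma adjD L : {morph adj L : x y / x + y}.
Proof.
move=> x y; rewrite /adj -big_split; apply: eq_bigr => i _.
by rewrite mulrDl ftrD mulrDl.
Qed.

Lemma adjP L x a : {morph L : x y / x + y} -> ftr (adj L x * a) = ftr (x * L a).
Proof.
move=> LD; elim/gf_span: a => [|a b Ea Eb|g gB].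
- by rewrite (additive0 LD) !mulr0.
- by rewrite LD !mulrDr !ftrD Ea Eb.
have j5 : (index g gf_basis < 5)%N by rewrite -[5%N]/(size gf_basis) index_mem.
have -> : g = nth 0 gf_basis (Ordinal j5) by rewrite nth_index.
move: (Ordinal j5) => j; rewrite /adj mulr_suml (big_morph _ ftrD ftr0) (bigD1 j) //= big1 => [|i ij].
  by rewrite addr0 -mulrA ftrZ dual_basisP eqxx mulr1.
by rewrite -mulrA ftrZ dual_basisP (negPf ij) mulr0.
Qed.

Lemma adj_bij L : {morph L : x y / x + y} -> injective L -> bijective (adj L).
Proof.
move=> LD LI; have [L' _ LK] := injF_bij LI.
apply: injF_bij => x y E; apply: add_eq0P; apply: ftr_nondegenerate => a.
by rewrite -(LK a) -adjP // adjD E addff mul0r ftr0.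
Qed.

Lemma divP (a b c : gf32) : b != 0 -> a / b = c <-> a = c * b.
Proof. by move=> b0; split=> [<-|->]; rewrite ?divfK ?mulfK. Qed.

(** * The nucleus of an arc that is the graph of a function *)

Section Nucleus.
Variable g : gf32 -> gf32.
Hypothesis ga : arcfun g.

Definition slope (r y : gf32) : gf32 := (g r + g y) / (r + y).

(** The slope of the tangent at r: the secants there have 31 of the 32 slopes, and all elements of
    the field sum to 0, so the absent one equals the sum of the others. *)
Definition miss (r : gf32) : gf32 := \sum_(y | y != r) slope r y.

Lemma slopeC r y : slope r y = slope y r.
Proof. by rewrite /slope addrC [r + y]addrC. Qed.

Lemma slopeP r y v : y != r -> slope r y = v <-> g r + g y = v * (r + y).
Proof. by move=> yr; apply: divP; rewrite addf_eq0 eq_sym. Qed.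

Lemma slope_arc r y y' : y != r -> y' != r -> slope r y = slope r y' -> y = y'.
Proof.
move=> yr y'r /(slopeP _ yr) E; have [//|yy'] := eqVneq y y'.
have := ga yy' y'r yr; rewrite ![_ + g r]addrC E /slope ![_ + r]addrC.
have y'r0 : r + y' != 0 by rewrite addf_eq0 eq_sym.
by rewrite mulrAC divfK // eqxx.
Qed.

Lemma miss_inj r : injective (fun y => if y == r then miss r else slope r y).
Proof.
have [v0 Hv] : exists v, v \notin [set slope r y | y in ~: [set r]].
  apply/existsP; rewrite -negb_forall; apply/negP => /forallP H.
  have : (#|gf32| <= #|[set slope r y | y in ~: [set r]]|)%N.
    by rewrite -cardsT; apply: subset_leq_card; apply/subsetP => v _; apply: H.
  rewrite card_gf32 leqNgt ltnS (leq_trans (leq_imset_card _ _)) //.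
  by have := cardsC [set r]; rewrite cards1 card_gf32 add1n => -[->].
pose Q y := if y == r then v0 else slope r y.
have HQ y : y != r -> v0 <> slope r y.
  by move=> yr E; move: Hv; rewrite E imset_f // !inE.
have QI : injective Q.
  move=> y y'; rewrite /Q; have [->|yr] := eqVneq y r; have [->|y'r] := eqVneq y' r => //.
  - by move/(HQ _ y'r).
  - by move/esym/(HQ _ yr).
  - exact: slope_arc.
suff E : v0 = miss r by move: QI; rewrite /Q E.
apply: add_eq0P; have := @psum0 1 isT; rewrite (reindex_inj QI) (bigD1 r) //= {1}/Q eqxx expr1 => <-.
by congr (_ + _); apply: eq_bigr => y /negPf yr; rewrite /Q yr expr1.
Qed.

Lemma miss_not r y : y != r -> slope r y != miss r.
Proof.
move=> yr; apply: contra_neq yr => E; apply: (@miss_inj r); rewrite eqxx.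
by case: eqP.
Qed.

Lemma miss_onto r v : v != miss r -> exists2 y, y != r & slope r y = v.
Proof.
move=> vr; have [q _ qK] := injF_bij (@miss_inj r); have := qK v.
have [_ E|qr E] := eqVneq (q v) r; first by rewrite E eqxx in vr.
by exists (q v).
Qed.

(* On a secant of slope [v] the 30 affine points off the arc each lie on a tangent at one of the
   30 remaining points of the arc; as a tangent meets the secant once, none of them is parallel to
   it. *)
Lemma secant_not_tangent (s t r : gf32) : s != t -> slope s t != miss r.
Proof.
move=> st; set v := slope s t; have [->|rs] := eqVneq r s.
  by rewrite miss_not // eq_sym.
have [->|rt] := eqVneq r t; first by rewrite /v slopeC miss_not.
have ts : t != s by rewrite eq_sym.
pose P u := g s + v * (u + s).
have Ps : P s = g s by rewrite /P addff mulr0 addr0.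
have vE : v * (t + s) = g s + g t by rewrite [t + s]addrC; apply/esym/(slopeP _ ts).
have Pt : P t = g t by rewrite /P vE addrA addff add0r.
have off u : u != s -> u != t -> P u != g u.
  move=> us ut; apply: contra_neq ut => E; apply: (@slope_arc s) => //.
  by apply/(slopeP _ us); rewrite -E /P addrA addff add0r [s + u]addrC.
have PD u u' : P u + P u' = v * (u + u').
  by rewrite /P; move: (g s) => x; gfring.
pose tau u r := (g r + P u) / (r + u).
have tauP u r' w : r' != u -> tau u r' = w <-> g r' + P u = w * (r' + u).
  by move=> ru; apply: divP; rewrite addf_eq0.
(* Without such a tangent, the lines through (u, P u) would pair off the points of the arc whose
   abscissa is not u, the points s and t being paired by the given secant. But there are 31 of them,
   an odd number. *)
have tan (u : gf32) : u != s -> u != t -> exists r : gf32, [&& r != u, r != s, r != t & tau u r == miss r].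
  move=> us ut; apply/existsP; apply: contraT; rewrite negb_exists => /forallP H; exfalso.
  have partner r' : r' != u -> exists y, [/\ y != u, y != r' & tau u y = tau u r'].
    move=> ru; have [E|rs'] := eqVneq r' s.
      exists t; rewrite E; split=> //; first by rewrite eq_sym.
      have -> : tau u s = v by apply/tauP; [rewrite eq_sym | rewrite -Ps PD].
      by apply/tauP; [rewrite eq_sym | rewrite -Pt PD].
    have [E|rt'] := eqVneq r' t.
      exists s; rewrite E; split=> //; first by rewrite eq_sym.
      have -> : tau u t = v by apply/tauP; [rewrite eq_sym | rewrite -Pt PD].
      by apply/tauP; [rewrite eq_sym | rewrite -Ps PD].
    have := H r'; rewrite ru rs' rt' /= => /miss_onto[y yr Ey].
    have yu : y != u.
      apply/eqP => yu; have /eqP := off _ us ut; apply.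
      move: Ey; rewrite yu => /slopeP; rewrite eq_sym => /(_ ru) E1.
      have /(tauP _ _ _ ru) E2 : tau u r' = tau u r' by [].
      by apply: (addrI (g r')); rewrite E1 E2.
    exists y; split=> //; apply/tauP => //.
    move/slopeP: Ey => /(_ yr) E1; have /(tauP _ _ _ ru) E2 : tau u r' = tau u r' by [].
    have -> : g y + P u = (g r' + g y) + (g r' + P u).
      by rewrite addrACA addff add0r.
    by rewrite E1 E2 -mulrDr addrACA addff add0r.
  suff : \sum_(r' | r' != u) (1 : gf32) = 0.
    rewrite sumr_const (_ : #|_| = 31%N); last by rewrite cardC1 card_gf32.
    by move/eqP; rewrite -[1 *+ 31]/(1 : gf32) oner_eq0.
  rewrite (partition_big (tau u) predT) //= big1 // => w _.
  case: (pickP (fun r' => (r' != u) && (tau u r' == w))) => [r0 /andP[ru /eqP Er]|N]; last first.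
    by rewrite big_pred0.
  have [y [yu yr Ey]] := partner _ ru.
  rewrite (bigD1 r0) ?ru ?Er ?eqxx //= (bigD1 y) ?yu ?Ey ?Er ?eqxx ?yr //= big1 ?addr0 ?addff // => z.
  move=> /andP[/andP[/andP[zu /eqP Ez] zr] zy]; case/eqP: zy; apply: (@slope_arc r0) => //.
  have line z' : z' != u -> z' != r0 -> tau u z' = w -> slope r0 z' = w.
    move=> zu' zr' /(tauP _ _ _ zu') E1; apply/(slopeP _ zr').
    move/tauP: Er => /(_ ru) E2; have -> : g r0 + g z' = (g r0 + P u) + (g z' + P u).
      by rewrite addrACA addff addr0.
    by rewrite E1 E2 -mulrDr addrACA addff addr0.
  by rewrite !line // Ey.
(* [rho] maps a point of the secant to a point of tangency. Fixing s and t makes it a map of the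
   field to itself, onto as soon as it is injective; so every r is reached. *)
have /fin_all_exists[rho Hrho] u : exists r, if u == s then r == s else if u == t then r == t else
    [&& r != u, r != s, r != t & tau u r == miss r].
  case: eqP => [_|/eqP us]; first by exists s.
  by case: eqP => [_|/eqP ut]; [exists t | apply: tan].
have rhoE u : u != s -> u != t ->
    [/\ rho u != s, rho u != t & g (rho u) + P u = miss (rho u) * (rho u + u)].
  move=> us ut; have := Hrho u; rewrite (negPf us) (negPf ut) => /and4P[ru rs' rt' /eqP E].
  by split=> //; apply/tauP.
have rhos : rho s = s by have := Hrho s; rewrite eqxx => /eqP.
have rhot : rho t = t by have := Hrho t; rewrite (negPf ts) eqxx => /eqP.
(* With slope v this tangent would coincide with the secant and put r' on it. *)
have nv r' u : r' != s -> r' != t -> g r' + P u = miss r' * (r' + u) -> miss r' != v.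
  move=> rs' rt' E; apply: contra_neq (off _ rs' rt') => Em.
  by move: E; rewrite Em -PD => /addIr.
have rhoI : injective rho.
  move=> u u' E; have [us|us] := eqVneq u s; have [us'|us'] := eqVneq u' s.
  - by rewrite us us'.
  - have [ut'|ut'] := eqVneq u' t; first by move: E; rewrite us ut' rhos rhot.
    by have [] := rhoE _ us' ut'; rewrite -E us rhos eqxx.
  - have [ut|ut] := eqVneq u t; first by move: E; rewrite us' ut rhos rhot.
    by have [] := rhoE _ us ut; rewrite E us' rhos eqxx.
  have [ut|ut] := eqVneq u t; have [ut'|ut'] := eqVneq u' t.
  - by rewrite ut ut'.
  - by have [_] := rhoE _ us' ut'; rewrite -E ut rhot eqxx.
  - by have [_] := rhoE _ us ut; rewrite E ut' rhot eqxx.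
  have [r1 r2 E1] := rhoE _ us ut; have [_ _ E2] := rhoE _ us' ut'.
  have := nv _ _ r1 r2 E1; rewrite -E in E2; move: (rho u) E1 E2 => r' E1 E2 Hn.
  have : (miss r' + v) * (u + u') = 0.
    transitivity ((g r' + P u) + (g r' + P u') + (P u + P u')).
      by rewrite E1 E2 PD; move: (miss r') => n; gfring.
    by move: (g r') (P u) (P u') => x y z; gfring.
  by move/eqP; rewrite mulf_eq0 !addf_eq0 (negPf Hn) => /eqP.
have [rho' _ rK] := injF_bij rhoI; have Er := rK r.
have us : rho' r != s by apply: contra_neq rs => E; rewrite -Er E rhos.
have ut : rho' r != t by apply: contra_neq rt => E; rewrite -Er E rhot.
have [r1 r2 E1] := rhoE _ us ut; rewrite Er in r1 r2 E1.
by rewrite eq_sym; apply: nv E1.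
Qed.

(** No secant has slope [miss 0], so after the shear no secant is horizontal, which is
    injectivity. *)
Lemma arcfun_opoly : opoly (fun x => g x + miss 0 * x + g 0).
Proof.
split; first by rewrite mulr0 addr0 addff.
  move=> x y /addIr E; have [//|xy] := eqVneq x y.
  have /eqP[] := secant_not_tangent 0 xy; apply/slopeP; first by rewrite eq_sym.
  rewrite mulrDr; move: E; move: (g x) (g y) (miss 0 * x) (miss 0 * y) => a b c d /eqP.
  by rewrite -addf_eq0 => /eqP E; apply: add_eq0P; rewrite -E; gfring.
move=> x y z xy yz xz; have := ga xy yz xz; apply: contra_neq => E.
apply: add_eq0P; move/eqP: E; rewrite -addf_eq0 => /eqP <-.
by move: (g x) (g y) (g z) (g 0) (miss 0) => a b c d e; gfring.
Qed.

End Nucleus.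

Lemma opoly_inv f h : opoly f -> cancel f h -> cancel h f -> opoly h.
Proof.
move=> [f0 fi fa] fK hK; split.
- by apply: fi; rewrite hK f0.
- exact: can_inj hK.
move=> x y z xy yz xz; have inj2 u v : u != v -> h u != h v by rewrite (can_eq hK).
by have := fa _ _ _ (inj2 _ _ xy) (inj2 _ _ yz) (inj2 _ _ xz); rewrite !hK eq_sym ![(h _ + _) * _]mulrC.
Qed.

(* [F m] is the map whose graph is the element of slope [m] of the pseudo-oval. *)
Lemma dual_arc_form (F : gf32 -> gf32 -> gf32) :
  (forall m, {morph F m : x y / x + y}) ->
  (forall m1 m2 m3 c, m1 != m2 -> m2 != m3 -> m1 != m3 ->
     F m1 ((m2 + m3) * c) + F m2 ((m1 + m3) * c) + F m3 ((m1 + m2) * c) = 0 -> c = 0) ->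
  exists f k n d, [/\ opoly f, bijective k, {morph k : x y / x + y},
    {morph n : x y / x + y} & {morph d : x y / x + y}] /\
    forall m s, F m s = k (f m * s) + n (m * s) + d s.
Proof.
move=> FD Fnd; pose g a m := adj (F m) a.
have gD a b m : g (a + b) m = g a m + g b m by apply: adjD.
(* The hypothesis makes the additive map [E] below injective, hence onto. Its trace pairing with a
   equals that of c with the determinant of [g a] at the three points; if the determinant vanished,
   a would be orthogonal to everything. *)
have ga a : a != 0 -> arcfun (g a).
  move=> a0; apply/arcfunP => m1 m2 m3 m12 m23 m13; apply: contra_neq a0 => D.
  pose E c := F m1 ((m2 + m3) * c) + F m2 ((m1 + m3) * c) + F m3 ((m1 + m2) * c).
  have ED : {morph E : x y / x + y}.
    move=> x y; rewrite /E !mulrDr !FD.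
    by move: (F m1 _) (F m1 _) (F m2 _) (F m2 _) (F m3 _) (F m3 _) => x1 x2 x3 x4 x5 x6; gfring.
  have EI : injective E.
    move=> x y Exy; apply: add_eq0P; apply: (Fnd m1 m2 m3) => //.
    by rewrite -/(E (x + y)) ED Exy addff.
  have [E' _ EK] := injF_bij EI.
  apply: ftr_nondegenerate => u; rewrite -(EK u); move: (E' u) => c.
  rewrite /E !mulrDr !ftrD -!(adjP _ _ (FD _)) -!ftrD -/(g a m1) -/(g a m2) -/(g a m3).
  have -> : g a m1 * ((m2 + m3) * c) + g a m2 * ((m1 + m3) * c) + g a m3 * ((m1 + m2) * c)
      = det3 (g a) m1 m2 m3 * c.
    by rewrite /det3; move: (g a m1) (g a m2) (g a m3) => x y z; gfring.
  by rewrite D mul0r ftr0.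
(* [miss] is a sum of slopes, hence additive in a: removing all the nuclei at once keeps the family
   additive. *)
pose n a := miss (g a) 0; pose d a := g a 0.
have nD : {morph n : x y / x + y}.
  move=> a b; rewrite /n /miss -big_split; apply: eq_bigr => y _.
  by rewrite /slope !gD addrACA mulrDl.
have dD : {morph d : x y / x + y} by move=> a b; apply: gD.
pose H a m := g a m + n a * m + d a.
have AH : additive_family H.
  split=> [a b m|a a0]; last by apply: arcfun_opoly; apply: ga.
  rewrite /H gD nD dD; move: (g a m) (g b m) (n a) (n b) (d a) (d b) => x1 x2 x3 x4 x5 x6.
  by gfring.
have oH1 := family_opoly AH (oner_neq0 _); have H11 : H 1 1 != 0 by apply: opoly_neq0 oH1 (oner_neq0 _).
pose k a := H a 1 / H 1 1.
have kE a m : H a m = k a * H 1 m.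
  have [c Hc] := family_scalar AH a; rewrite Hc; congr (_ * _).
  by rewrite /k Hc mulfK.
have kD : {morph k : x y / x + y} by move=> a b; rewrite /k (familyD AH) mulrDl.
have kI : injective k.
  move=> a b E; apply: add_eq0P; have [//|ab] := eqVneq (a + b) 0.
  have := opoly_neq0 (family_opoly AH ab) (oner_neq0 _).
  by rewrite kE kD E addff mul0r eqxx.
exists (H 1), (adj k), (adj n), (adj d); split.
  by split=> //; [exact: adj_bij | exact: adjD..].
move=> m s; apply: add_eq0P; apply: ftr_nondegenerate => a.
have A1 : ftr (a * F m s) = ftr (g a m * s) by rewrite /g adjP.
have A2 L x : {morph L : x y / x + y} -> ftr (a * adj L x) = ftr (L a * x).
  by move=> LD; rewrite mulrC adjP // mulrC.
rewrite mulrC !mulrDr !ftrD A1 !A2 // -!ftrD.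
have -> : g a m = k a * H 1 m + n a * m + d a.
  by rewrite -kE /H; move: (g a m) (n a) (d a) => x y z; gfring.
move: (k a) (H 1 m) (n a) (d a) => x1 x2 x3 x4; rewrite -[RHS]ftr0; congr ftr.
by gfring.
Qed.

(** * Uniqueness of GF(32) *)

Section Char2.
Variable A : comNzRingType.
Hypothesis two0 : 1 + 1 = 0 :> A.

Lemma add_self (x : A) : x + x = 0.
Proof. by rewrite -[x]mul1r -mulrDl two0 mul0r. Qed.

(** Named operations on which [ring] in characteristic 2 is declared for an arbitrary commutative
    ring; it is needed both in a field and in its polynomial ring. *)
Definition cadd (x y : A) : A := x + y.
Definition cmul (x y : A) : A := x * y.
Definition czero : A := 0.
Definition cone : A := 1.
Definition F2coef_in (b : bool) : A := if b then cone else czero.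

Lemma char2_ring_theory : Ring_theory.ring_theory czero cone cadd cmul cadd id (@eq A).
Proof.
split=> //; [exact: add0r | exact: addrC | exact: addrA | exact: mul1r | exact: mulrC
            | exact: mulrA | exact: mulrDl | exact: add_self].
Qed.

Lemma char2_ring_morph : Ring_theory.ring_morph czero cone cadd cmul cadd id (@eq A)
  false true addb andb addb id eqb F2coef_in.
Proof.
by split=> //; do ?[case]; rewrite /= /cadd /cmul /czero /cone ?add0r ?addr0 ?mul0r ?mulr0 ?mul1r ?two0.
Qed.

Ltac char2_cst t := match t with czero => constr:(false) | cone => constr:(true)
  | _ => constr:(InitialRing.NotConstant) end.
Add Ring char2_ring : char2_ring_theory (morphism char2_ring_morph, constants [char2_cst]).

Lemma caddE (x y : A) : x + y = cadd x y. Proof. by []. Qed.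
Lemma cmulE (x y : A) : x * y = cmul x y. Proof. by []. Qed.
Lemma czeroE : 0 = czero. Proof. by []. Qed.
Lemma coneE : 1 = cone. Proof. by []. Qed.

Ltac char2ring := rewrite ?exprS ?expr0 ?mulr1 ?caddE ?cmulE ?czeroE ?coneE;
  match goal with |- @eq _ ?a ?b => change (@eq A a b) end; ring.

(** The quintic is irreducible of degree 5 over GF(2), so it divides X^32 + X. The cofactor, of
    degree 27, is written compactly in terms of the quintic itself. *)
Lemma quintic_factor (x : A) : x ^+ 32 + x = (x ^+ 5 + x ^+ 2 + 1) *
  ((x ^+ 3 + 1) ^+ 4 * (x ^+ 5 + x ^+ 2 + 1) ^+ 3 + (x ^+ 7 + x ^+ 4 + x ^+ 3 + x ^+ 2 + x + 1)).
Proof. by char2ring. Qed.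

Variable z : A.
Hypothesis z5 : z ^+ 5 + z ^+ 2 + 1 = 0.

Definition gf_embed (x : gf32) : A :=
  let b i := F2coef_in (nth false (fbits x) i) in
  b 0 + b 1 * z + b 2 * z ^+ 2 + b 3 * z ^+ 3 + b 4 * z ^+ 4.

Lemma gf_embedD : {morph gf_embed : x y / x + y}.
Proof.
move=> x y; rewrite /gf_embed fbitsD.
have E i : (i < 5)%N ->
    F2coef_in (nth false [seq p.1 (+) p.2 | p <- zip (fbits x) (fbits y)] i)
    = F2coef_in (nth false (fbits x) i) + F2coef_in (nth false (fbits y) i).
  move=> i5; rewrite (nth_map (false, false)) ?size_zip ?size_fbits // nth_zip ?size_fbits //=.
  by case: (nth _ _ i) (nth _ _ i) => [] []; rewrite /= /czero /cone ?addr0 ?add0r ?two0.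
rewrite !E //; move: (F2coef_in _) (F2coef_in _) (F2coef_in _) (F2coef_in _) (F2coef_in _)
  (F2coef_in _) (F2coef_in _) (F2coef_in _) (F2coef_in _) (F2coef_in _).
by move=> *; char2ring.
Qed.

Lemma gf_embed_basis : [/\ gf_embed g1 = 1, gf_embed g2 = z, gf_embed g4 = z ^+ 2,
  gf_embed g8 = z ^+ 3 & gf_embed g16 = z ^+ 4].
Proof. by split; rewrite /gf_embed /=; char2ring. Qed.

(** Multiplication by [g2] is enough, the other basis elements being powers of it; there only the
    product with [g16] uses the quintic equation. *)
Lemma gf_embedM : {morph gf_embed : x y / x * y}.
Proof.
have [e1 e2 e4 e8 e16] := gf_embed_basis.
have e0 := additive0 gf_embedD.
pose M x := forall y, gf_embed (x * y) = gf_embed x * gf_embed y.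
have MM x x' : M x -> M x' -> M (x * x') by move=> Hx Hx' y; rewrite -mulrA !Hx Hx' mulrA.
have M2 : M g2.
  move=> y; elim/gf_span: y => [|a b Ha Hb|g].
  - by rewrite mulr0 e0 mulr0.
  - by rewrite [g2 * (a + b)]mulrDr (gf_embedD (g2 * a)) Ha Hb (gf_embedD a b) [RHS]mulrDr.
  rewrite !inE e2 => /or4P[/eqP->|/eqP->|/eqP->|/orP[]/eqP->].
  - by rewrite e1 mulr1 -[g2 * g1]/g2.
  - by rewrite e2 -[g2 * g2]/g4 e4.
  - by rewrite e4 -[g2 * g4]/g8 e8 -exprS.
  - by rewrite e8 -[g2 * g8]/g16 e16 -exprS.
  - rewrite e16 -[g2 * g16]/(g4 + g1) gf_embedD e4 e1 -exprS; apply: (addrI (z ^+ 5)).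
    by rewrite addrA z5 add_self.
move=> x; rewrite -/(M x); elim/gf_span: x => [|a b Ha Hb|g].
- by move=> y; rewrite mul0r e0 mul0r.
- by move=> y; rewrite [(a + b) * y]mulrDl (gf_embedD (a * y)) Ha Hb (gf_embedD a b) [RHS]mulrDl.
rewrite !inE => /or4P[/eqP->|/eqP->|/eqP->|/orP[]/eqP->].
- by move=> y; rewrite e1 mul1r.
- exact: M2.
- exact: (MM g2 g2).
- exact: (MM g2 g4 M2 (MM g2 g2 M2 M2)).
- exact: (MM g4 g4 (MM g2 g2 M2 M2) (MM g2 g2 M2 M2)).
Qed.

End Char2.

Lemma two_eq0 (K : finFieldType) : #|K| = 32%N -> 1 + 1 = 0 :> K.
Proof.
move=> cK; have : 2%N \in [pchar K] by apply: (@card_finPcharP _ 2 5).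
by move/pcharf0; rewrite mulr2n.
Qed.

(** Otherwise all 32 elements would be roots of the cofactor of degree 27. *)
Lemma quintic_root (K : finFieldType) : #|K| = 32%N -> exists z : K, z ^+ 5 + z ^+ 2 + 1 = 0.
Proof.
move=> cK; have two0 := two_eq0 cK.
have [/existsP[z /eqP Hz]|] := boolP [exists z : K, z ^+ 5 + z ^+ 2 + 1 == 0]; first by exists z.
rewrite negb_exists => /forallP N; exfalso.
have two0p : 1 + 1 = 0 :> {poly K} by rewrite -polyC1 -polyCD two0.
pose p : {poly K} := 'X^5 + 'X^2 + 1.
pose q := ('X^3 + 1) ^+ 4 * p ^+ 3 + ('X^7 + 'X^4 + 'X^3 + 'X^2 + 'X + 1).
have E : 'X^32 + 'X = p * q := quintic_factor two0p 'X.
have sE : size ('X^32 + 'X : {poly K}) = 33%N by rewrite size_polyDl size_polyXn // size_polyX.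
have sp : size p = 6%N.
  rewrite /p -addrA size_polyDl size_polyXn //.
  by rewrite (leq_ltn_trans (size_polyD _ _)) // size_polyXn size_poly1.
have q0 : q != 0 by apply/eqP => q0; move: sE; rewrite E q0 mulr0 size_poly0.
have p0 : p != 0 by rewrite -size_poly_eq0 sp.
have sq : size q = 28%N.
  by move: sE; rewrite E size_mul // sp => /eqP; rewrite addSn /= -[33%N]/(5 + 28)%N eqn_add2l => /eqP.
have : all (root q) (enum K).
  apply/allP => x _; apply/rootP; have /(congr1 (horner^~ x)) := E.
  rewrite hornerM hornerD hornerXn hornerX -{1}cK expf_card (add_self two0) => /esym/eqP.
  rewrite mulf_eq0 => /orP[|/eqP//]; rewrite /p !hornerE.
  by rewrite (negPf (N x)).
move/(max_poly_roots q0) => /(_ (enum_uniq K)).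
by rewrite sq -cardE cK.
Qed.

Lemma gf32_unique (K : finFieldType) : #|K| = 32%N ->
  exists lam : K -> gf32, [/\ {morph lam : x y / x + y}, {morph lam : x y / x * y} & bijective lam].
Proof.
move=> cK; have two0 := two_eq0 cK; have [z Hz] := quintic_root cK.
pose k := gf_embed z; have kD : {morph k : x y / x + y} := gf_embedD two0 z.
have kM : {morph k : x y / x * y} := gf_embedM two0 Hz.
have k1 : k 1 = 1 by have [] := gf_embed_basis two0 z.
have kI : injective k.
  move=> x y E; apply: add_eq0P; have [//|xy] := eqVneq (x + y) 0.
  have : k ((x + y) / (x + y)) = 0 by rewrite kM kD E (add_self two0) mul0r.
  by rewrite divff // k1 => /eqP; rewrite oner_eq0.
have [|l kK lK] := inj_card_bij kI; first by rewrite cK card_gf32.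
exists l; split; last by exists k.
- by move=> x y; apply: kI; rewrite kD !lK.
- by move=> x y; apply: kI; rewrite kM !lK.
Qed.

(** * Coordinates from a Desarguesian spread *)

Lemma dot3_mul (K : finFieldType) (u n : 'rV[K]_3) (B C : 'M[K]_3) : C *m B = 1%:M ->
  dot3 (u *m C) (n *m B^T) = dot3 u n.
Proof.
have dotE (x y : 'rV[K]_3) : dot3 x y = (x *m y^T) 0 0.
  by rewrite /dot3 [RHS]mxE; apply: eq_bigr => i _; rewrite !mxE.
by move=> CB; rewrite !dotE trmx_mul trmxK mulmxA -(mulmxA u) CB mulmx1.
Qed.

Lemma PG2_change_frame (P : finType) (PS : {set P}) (LP : {set {set P}}) (K : finFieldType)
    (f : P -> 'M[K]_3) (C : 'M[K]_3) : C \in unitmx ->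
  {in PS &, injective f} -> f @: PS = PG2_points K ->
  (forall l, l \in LP -> l \subset PS) -> [set f @: l | l : {set P} in LP] = PG2_lines K ->
  let f' p := <<f p *m C>>%MS in
  [/\ {in PS &, injective f'}, f' @: PS = PG2_points K &
      forall l, l \in LP -> exists2 n, n != 0 & f' @: l = PG2_line n].
Proof.
move=> uC fI fS LS fL f'.
have f'E p (u : 'rV[K]_3) : f p = <<u>>%MS -> f' p = <<u *m C>>%MS.
  by move=> E; apply/genmxP/eqmxP; rewrite E; apply: eqmxMr; apply: genmxE.
have pt p : p \in PS -> exists2 u : 'rV[K]_3, u != 0 & f p = <<u>>%MS.
  by move=> pP; apply/PG2_pointsP; rewrite -fS imset_f.
have uC0 (u : 'rV[K]_3) : u != 0 -> u *m C != 0.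
  by apply: contra_neq => E; rewrite -[u](mulmxK uC) E mul0mx.
have f'I : {in PS &, injective f'}.
  move=> p p' pP pP' E; apply: fI => //; have [u u0 Ep] := pt _ pP; have [u' u0' Ep'] := pt _ pP'.
  move: E; rewrite (f'E _ _ Ep) (f'E _ _ Ep') => /genmxP/andP[].
  rewrite !submxMfree ?row_free_unit // => s1 s2.
  by rewrite Ep Ep'; apply/genmxP/andP.
split=> //.
  apply/eqP; rewrite eqEcard; apply/andP; split.
    apply/subsetP => q /imsetP[p pP ->]; have [u u0 E] := pt _ pP.
    by apply/PG2_pointsP; exists (u *m C); rewrite ?uC0 ?(f'E _ _ E).
  by rewrite card_in_imset // -fS card_in_imset.
move=> l lL; have /subsetP lS := LS _ lL.
have : f @: l \in PG2_lines K by rewrite -fL imset_f.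
case/PG2_linesP => n n0 En; exists (n *m (invmx C)^T).
  by apply: contra_neq n0 => E; rewrite -[n]mulmx1 -trmx1 -(mulmxV uC) trmx_mul mulmxA E mul0mx.
have key p : p \in PS -> (f' p \in PG2_line (n *m (invmx C)^T)) = (p \in l).
  move=> pP; have [u u0 E] := pt _ pP.
  rewrite (f'E _ _ E) PG2_line_gen ?uC0 // dot3_mul ?mulmxV // -PG2_line_gen // -E -En.
  apply/imsetP/idP => [[p' pl' Ep]|]; last by exists p.
  by rewrite (fI _ _ pP (lS _ pl') Ep).
have f'S : f' @: PS = PG2_points K.
  apply/eqP; rewrite eqEcard; apply/andP; split.
    apply/subsetP => q /imsetP[p pP ->]; have [u u0 E] := pt _ pP.
    by apply/PG2_pointsP; exists (u *m C); rewrite ?uC0 ?(f'E _ _ E).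
  by rewrite card_in_imset // -fS card_in_imset.
apply/setP => q; apply/imsetP/idP => [[p pl ->]|ql]; first by rewrite key ?lS.
have : q \in PG2_points K by move: ql; rewrite inE => /andP[].
rewrite -f'S => /imsetP[p pP Eq]; exists p => //.
by rewrite -key // -Eq.
Qed.

(** Geometrically, p1 and p2 are distinct points of the line n, and p0 is a point off it. *)
Lemma frame_unit (K : finFieldType) (p0 p1 p2 n : 'rV[K]_3) :
  dot3 p0 n != 0 -> dot3 p1 n = 0 -> dot3 p2 n = 0 -> p1 != 0 -> p2 != 0 ->
  <<p1>>%MS <> <<p2>>%MS -> (\matrix_(i < 3) nth 0 [:: p0; p1; p2] i) \in unitmx.
Proof.
move=> d0 d1 d2 p10 p20 p12; rewrite -row_free_unit; apply: inj_row_free => v.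
rewrite mulmx_sum_row !big_ord_recl big_ord0 !rowK /= addr0 addrA => E.
have dotD (x y : 'rV[K]_3) : dot3 (x + y) n = dot3 x n + dot3 y n.
  by rewrite /dot3 -big_split; apply: eq_bigr => i _; rewrite mxE mulrDl.
have dotZ k (x : 'rV[K]_3) : dot3 (k *: x) n = k * dot3 x n.
  by rewrite /dot3 mulr_sumr; apply: eq_bigr => i _; rewrite mxE mulrA.
rewrite (row3E v); move: E; have -> : lift ord0 ord0 = 1 :> 'I_3 by apply: val_inj.
have -> : lift ord0 (lift ord0 ord0) = 2 :> 'I_3 by apply: val_inj.
move: (v 0 0) (v 0 1) (v 0 2) => a b c E.
have a0 : a = 0.
  move/(congr1 (fun u => dot3 u n)): E; rewrite !dotD !dotZ d1 d2 !mulr0 !addr0.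
  rewrite {2}/dot3 big1 => [/eqP|i _]; last by rewrite mxE mul0r.
  by rewrite mulf_eq0 (negPf d0) orbF => /eqP.
move: E; rewrite a0 scale0r add0r => E.
have [b0|b0] := eqVneq b 0.
  move: E; rewrite b0 scale0r add0r => /eqP; rewrite scaler_eq0 (negPf p20) orbF => /eqP ->.
  exact: row3_0.
case: p12; have E1 : p1 = (- (c / b)) *: p2.
  apply: (scalerI b0); rewrite scalerA mulrN [b * _]mulrC divfK // scaleNr.
  by apply/eqP; rewrite -addr_eq0 E.
rewrite E1; apply/genmxP/eqmxP/eqmx_scale; apply: contra_neq p10 => Z.
by rewrite E1 Z scale0r.
Qed.

Definition dir2 (K : finFieldType) (o : option K) (a b : K) : bool :=
  if o is Some s then b == s * a else a == 0.

(** A linear change of frame sends the zero vector to (1 : 0 : 0), [WT] to (0 : 0 : 1) and another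
    spread element to (0 : 1 : 0). At this stage the coordinates respect parallelism, but nothing is
    known about addition. *)
Lemma spread_coordinates (S WT : sub15) (spr : {set sub15}) (K : finFieldType) :
  incidence_iso (tp_points S spr) (tp_lines S spr) (PG2_points K) (PG2_lines K) ->
  WT \in spr -> (1 < #|spr|)%N ->
  exists (c : vec15 -> K * K) (o : sub15 -> option K),
  [/\ c 0 = (0, 0), o WT = None, forall t, exists2 W, W \in spr & o W = t,
      forall u v : vec15, (u <= S)%MS -> (v <= S)%MS -> c u = c v -> u = v &
      forall (W : sub15) (u v : vec15), W \in spr -> (u <= S)%MS -> (v <= S)%MS ->
        (u - v <= W)%MS = dir2 (o W) ((c u).1 - (c v).1) ((c u).2 - (c v).2)].
Proof.
move=> [f [fI [fS fL]]] WTs s2; set PS := tp_points S spr in fI fS.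
have [W1 W1s W1T] : exists2 W1, W1 \in spr & W1 != WT.
  move: s2; rewrite (cardsD1 WT) WTs ltnS => /card_gt0P[W].
  by rewrite !inE => /andP[]; exists W.
have inS v : (v <= S)%MS -> inl v \in PS by rewrite inE.
have inW W : W \in spr -> inr W \in PS by rewrite inE.
have LS l : l \in tp_lines S spr -> l \subset PS.
  rewrite inE => /orP[/imset2P[v W _ Ws ->]|/set1P->]; apply/subsetP => -[u|W']; rewrite !inE //.
    by case/andP.
  by move/eqP->.
have Linf : tp_line_at_infinity spr \in tp_lines S spr by rewrite inE set11 orbT.
have S0 : ((0 : vec15) <= S)%MS := sub0mx _ _.
have rep p : p \in PS -> exists2 u : 'rV[K]_3, u != 0 & f p = <<u>>%MS.
  by move=> pP; apply/PG2_pointsP; rewrite -fS imset_f.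
have [p0 p00 E0] := rep _ (inS _ S0); have [p1 p10 E1] := rep _ (inW _ W1s).
have [p2 p20 E2] := rep _ (inW _ WTs).
have : f @: tp_line_at_infinity spr \in PG2_lines K by rewrite -fL imset_f.
case/PG2_linesP => n n0 En.
have mem p : p \in PS -> (f p \in PG2_line n) = (p \in tp_line_at_infinity spr).
  move=> pP; rewrite -En; apply/imsetP/idP => [[p' pl Ep]|]; last by exists p.
  by rewrite (fI _ _ pP (subsetP (LS _ Linf) _ pl) Ep).
have uB := @frame_unit K p0 p1 p2 n.
have {}uB : (\matrix_(i < 3) nth 0 [:: p0; p1; p2] i) \in unitmx.
  apply: uB => //.
  - by rewrite -PG2_line_gen // -E0 mem ?inS // inE.
  - by apply/eqP; rewrite -PG2_line_gen // -E1 mem ?inW // inE.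
  - by apply/eqP; rewrite -PG2_line_gen // -E2 mem ?inW // inE.
  - rewrite -E1 -E2 => /fI; rewrite !inW // => /(_ isT isT)[] E.
    by rewrite E eqxx in W1T.
set B := (\matrix_(i < 3) _) in uB.
have uC : invmx B \in unitmx by rewrite unitmx_inv.
have := PG2_change_frame uC fI fS LS fL.
set f' := fun p => _; move=> /= [f'I f'S f'L].
have rowC i u : nth 0 [:: p0; p1; p2] i = u -> (i < 3)%N -> u *m invmx B = delta_mx 0 (inord i).
  move=> <- i3; have -> : nth 0 [:: p0; p1; p2] i = row (inord i) B by rewrite rowK inordK.
  by rewrite -row_mul mulmxV // row1.
have fE p (u : 'rV[K]_3) : f p = <<u>>%MS -> f' p = <<u *m invmx B>>%MS.
  by move=> E; apply/genmxP/eqmxP; rewrite E; apply: eqmxMr; apply: genmxE.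
have F0 : f' (inl 0) = aff 0 0.
  rewrite (fE _ _ E0) (rowC 0%N p0) //; congr (<<_>>%MS); apply/rowP => i; rewrite !mxE.
  by case: i => -[|[|[|//]]] Hi; rewrite /= -val_eqE /= inordK.
have F2 : f' (inr WT) = inf None.
  rewrite (fE _ _ E2) (rowC 2%N p2) //; congr (<<_>>%MS); apply/rowP => i; rewrite !mxE.
  by case: i => -[|[|[|//]]] Hi; rewrite /= -val_eqE /= inordK.
have F1 : f' (inr W1) = inf (Some 0).
  rewrite (fE _ _ E1) (rowC 1%N p1) //; congr (<<_>>%MS); apply/rowP => i; rewrite !mxE.
  by case: i => -[|[|[|//]]] Hi; rewrite /= -val_eqE /= inordK.
have mem' p l n' : p \in PS -> l \in tp_lines S spr -> f' @: l = PG2_line n' ->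
    (f' p \in PG2_line n') = (p \in l).
  move=> pP lL <-; apply/imsetP/idP => [[p' pl Ep]|]; last by exists p.
  by rewrite (f'I _ _ pP (subsetP (LS _ lL) _ pl) Ep).
have [n' n0' Ln'] := f'L _ Linf.
have [a a0 Ea] : exists2 a, a != 0 & n' = row3 a 0 0.
  have := mem' _ _ _ (inW _ WTs) Linf Ln'; rewrite F2 [_ \in tp_line_at_infinity _]inE WTs.
  have := mem' _ _ _ (inW _ W1s) Linf Ln'; rewrite F1 [_ \in tp_line_at_infinity _]inE W1s.
  move: n0'; rewrite (row3E n') !inf_line mul0r addr0; move: (n' 0 0) (n' 0 1) (n' 0 2) => a b c n0' /eqP Eb /eqP Ec.
  by exists a; rewrite ?Eb ?Ec //; move: n0'; rewrite Eb Ec row3_eq0 eqxx !andbT.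
have fv v : (v <= S)%MS -> exists t : K * K, f' (inl v) == aff t.1 t.2.
  move=> vS; have := mem' _ _ _ (inS _ vS) Linf Ln'; rewrite [_ \in tp_line_at_infinity _]inE Ea.
  have : f' (inl v) \in PG2_points K by rewrite -f'S imset_f ?inS.
  case/PG2_nf => [[w [y ->]]|[o ->]]; first by exists (w, y).
  by rewrite inf_line; case: o => [s|]; rewrite ?mulr0 ?addr0 eqxx.
have fW W : W \in spr -> exists t, f' (inr W) == inf t.
  move=> Ws; have := mem' _ _ _ (inW _ Ws) Linf Ln'; rewrite [_ \in tp_line_at_infinity _]inE Ws Ea.
  have : f' (inr W) \in PG2_points K by rewrite -f'S imset_f ?inW.
  case/PG2_nf => [[w [y ->]]|[o ->]]; last by exists o.
  by rewrite aff_line !mulr0 !addr0 (negPf a0).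
pose c (v : vec15) : K * K := odflt (0, 0) [pick t | f' (inl v) == aff t.1 t.2].
pose o (W : sub15) : option K := odflt None [pick t | f' (inr W) == inf t].
have cE v : (v <= S)%MS -> f' (inl v) = aff (c v).1 (c v).2.
  by move=> /fv[t Ht]; rewrite /c; case: pickP => [t' /eqP//|/(_ t)]; rewrite Ht.
have oE W : W \in spr -> f' (inr W) = inf (o W).
  by move=> /fW[t Ht]; rewrite /o; case: pickP => [t' /eqP//|/(_ t)]; rewrite Ht.
exists c, o; split.
- have := cE _ S0; rewrite F0 => /aff_inj[]; case: (c 0) => c1 c2 /= <- <- //.
- by have := oE _ WTs; rewrite F2 => /inf_inj.
- move=> t; have : inf t \in PG2_points K by apply: inf_in.
  rewrite -f'S => /imsetP[[v|W]]; rewrite inE => H.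
    by rewrite (cE _ H) => /esym/aff_inf.
  by rewrite (oE _ H) => /inf_inj ->; exists W.
- move=> u v uS vS E; have /f'I : f' (inl u) = f' (inl v) by rewrite !cE // E.
  by rewrite !inS // => /(_ isT isT)[].
move=> W u v Ws uS vS; pose l := tp_affine_line S v W.
have lL : l \in tp_lines S spr.
  by rewrite inE; apply/orP; left; apply/imset2P; exists v W; rewrite ?inE.
have [n1 n10 El] := f'L _ lL.
have := mem' _ _ _ (inS _ uS) lL El; rewrite [_ \in l]inE uS cE //.
have := mem' _ _ _ (inS _ vS) lL El; rewrite [_ \in l]inE vS subrr sub0mx cE //.
have := mem' _ _ _ (inW _ Ws) lL El; rewrite [_ \in l]inE eqxx oE //.
rewrite (row3E n1) in n10 *; move: (n1 0 0) (n1 0 1) (n1 0 2) n10 => x y z xyz.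
rewrite inf_line !aff_line; move: (c u) (c v) => [w1 y1] [w2 y2] /=.
move=> Ho /eqP Ev <-; have {Ev}Ex : x = - (w2 * y + y2 * z).
  by apply/eqP; rewrite -addr_eq0 addrA Ev.
have -> : x + w1 * y + y1 * z = (w1 - w2) * y + (y1 - y2) * z.
  by rewrite Ex opprD !mulrBl -addrA addrACA ![- _ + _]addrC.
case: (o W) Ho => [s|] /eqP Ho /=.
  have z0 : z != 0.
    apply: contraNneq xyz => z0; rewrite row3_eq0 Ex; move: Ho; rewrite z0 !mulr0 !addr0 => ->.
    by rewrite mulr0 oppr0 eqxx.
  have -> : y = - (s * z) by apply/eqP; rewrite -addr_eq0 Ho.
  rewrite mulrN addrC mulrA -mulrBl mulf_eq0 (negPf z0) orbF subr_eq0.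
  by rewrite mulrC.
have y0 : y != 0.
  apply: contraNneq xyz => y0; rewrite row3_eq0 Ex y0 Ho.
  by rewrite !mulr0 addr0 oppr0 eqxx.
by rewrite Ho mulr0 addr0 mulf_eq0 (negPf y0) orbF.
Qed.

Lemma dir2D (K : finFieldType) (o : option K) a b a' b' :
  dir2 o a b -> dir2 o a' b' -> dir2 o (a + a') (b + b').
Proof.
by case: o => [s|] /= /eqP-> /eqP->; rewrite ?mulrDr ?addr0.
Qed.

Lemma dir2_disjoint (K : finFieldType) (o o' : option K) a b :
  o != o' -> dir2 o a b -> dir2 o' a b -> a = 0 /\ b = 0.
Proof.
case: o o' => [s|] [s'|] //= ss' /eqP e1 /eqP e2.
- have /eqP : (s - s') * a = 0 by rewrite mulrBl -e1 -e2 subrr.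
  rewrite mulf_eq0 subr_eq0 => /orP[/eqP E|/eqP a0]; first by rewrite E eqxx in ss'.
  by rewrite e1 a0 mulr0.
- by rewrite e1 e2 mulr0.
- by rewrite e2 e1 mulr0.
Qed.

Lemma dir2_ex (K : finFieldType) (a b : K) : exists o, dir2 o a b.
Proof.
have [->|a0] := eqVneq a 0; first by exists None; rewrite /= eqxx.
by exists (Some (b / a)); rewrite /= divfK.
Qed.

(** For u and v in different spread elements, u + v is the intersection of two parallels, so
    coordinates add. Within one spread element, an auxiliary vector outside it reduces to that
    case. *)
Lemma spread_linear (S WT : sub15) (spr : {set sub15}) (K : finFieldType) :
  #|K| = 32%N -> \rank S = 10%N ->
  incidence_iso (tp_points S spr) (tp_lines S spr) (PG2_points K) (PG2_lines K) ->
  WT \in spr -> (1 < #|spr|)%N ->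
  exists (w y : vec15 -> gf32) (o : sub15 -> option gf32),
  [/\ forall u v : vec15, (u <= S)%MS -> (v <= S)%MS ->
        w (u + v) = w u + w v /\ y (u + v) = y u + y v,
      o WT = None, forall t, exists2 W, W \in spr & o W = t,
      forall v : vec15, (v <= S)%MS -> w v = 0 -> y v = 0 -> v = 0 &
      forall (W : sub15) (v : vec15), W \in spr -> (v <= S)%MS ->
        (v <= W)%MS = dir2 (o W) (w v) (y v)].
Proof.
move=> cK rS iso WTs s2; have two0 := two_eq0 cK.
have [c [o [c0 oT oS cI cD]]] := spread_coordinates iso WTs s2.
have opK (x : K) : - x = x by apply: (addrI x); rewrite addrN (add_self two0).
have S0 : ((0 : vec15) <= S)%MS := sub0mx _ _.
have SD (u v : vec15) : (u <= S)%MS -> (v <= S)%MS -> ((u + v)%R <= S)%MS.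
  by move=> uS vS; exact: addmx_sub.
have {}cD (W : sub15) (u v : vec15) : W \in spr -> (u <= S)%MS -> (v <= S)%MS ->
    ((u + v)%R <= W)%MS = dir2 (o W) ((c u).1 + (c v).1) ((c u).2 + (c v).2).
  by move=> Ws uS vS; rewrite -[in LHS](vec_opp v) cD // !opK.
have cD0 (W : sub15) (v : vec15) : W \in spr -> (v <= S)%MS -> (v <= W)%MS = dir2 (o W) (c v).1 (c v).2.
  by move=> Ws vS; rewrite -{1}[v]addr0 cD // c0 !addr0.
(* Injectivity suffices by counting: 2^10 vectors of [S] and 32^2 pairs. *)
have cS p : exists2 v : vec15, (v <= S)%MS & c v = p.
  have : p \in [set c v | v in [set v : vec15 | (v <= S)%MS]].
    suff -> : [set c v | v in [set v : vec15 | (v <= S)%MS]] = setT by rewrite inE.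
    apply/eqP; rewrite eqEcard subsetT cardsT card_prod cK.
    rewrite card_in_imset ?card_rowspace ?rS // => u v; rewrite !inE; exact: cI.
  by case/imsetP => v; rewrite inE => vS ->; exists v.
have A1 (u v : vec15) t t' : (u <= S)%MS -> (v <= S)%MS -> t != t' ->
    dir2 t (c u).1 (c u).2 -> dir2 t' (c v).1 (c v).2 -> c (u + v) = c u + c v.
  move=> uS vS tt' du dv; have [W Ws Wt] := oS t; have [W' Ws' Wt'] := oS t'.
  have := cD W (u + v) v Ws (SD _ _ uS vS) vS; rewrite -addrA vec_addvv addr0 cD0 // Wt du.
  have := cD W' (u + v) u Ws' (SD _ _ uS vS) uS; rewrite addrAC vec_addvv add0r cD0 // Wt' dv.
  move=> /esym e1 /esym e2; move: (dir2D e1 dv) (dir2D e2 du) tt' => d1 d2 tt'.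
  have := dir2_disjoint tt' d2; rewrite -!addrA [_ + (c u).1]addrC [_ + (c u).2]addrC !addrA.
  rewrite -!addrA in d1 *; case/(_ d1) => z1 z2.
  have E (x z : K) : x + z = 0 -> x = z.
    by move=> xz; apply: (addIr z); rewrite xz (add_self two0).
  by move: (E _ _ z1) (E _ _ z2); case: (c (u + v)) (c u) (c v) => [a b] [a' b'] [a'' b''] /= -> ->.
have A2 (u v : vec15) : (u <= S)%MS -> (v <= S)%MS -> c (u + v) = c u + c v.
  move=> uS vS; have [t dt] := dir2_ex (c u).1 (c u).2; have [t' dt'] := dir2_ex (c v).1 (c v).2.
  have [tt'|] := eqVneq t t'; last by move=> tt'; apply: A1 dt dt'.
  rewrite -{}tt' in dt'; have [W Ws Wt] := oS t.
  have uW : (u <= W)%MS by rewrite cD0 // Wt.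
  have vW : (v <= W)%MS by rewrite cD0 // Wt.
  pose p : K * K := if t is None then (1, 0) else (0, 1).
  pose t1 : option K := if t is None then Some 0 else None.
  have [s sS cs] := cS p.
  have t1t : t1 != t by rewrite /t1; case: (t).
  have ds : dir2 t1 (c s).1 (c s).2 by rewrite cs /t1 /p; case: (t) => [z|] /=; rewrite ?mul0r.
  have nds : ~~ (s <= W)%MS.
    by rewrite cD0 // Wt cs /p; case: (t) => [z|] /=; rewrite ?mulr0 oner_eq0.
  have tt1 : t != t1 by rewrite eq_sym.
  have e1 : c (u + v + s) = c (u + v) + c s.
    by apply: (A1 _ _ t t1) => //; [exact: SD | rewrite -Wt -cD0 ?SD // addmx_sub].
  have e2 : c (v + s) = c v + c s by apply: (A1 _ _ t t1).
  have [t3 d3] := dir2_ex (c (v + s)).1 (c (v + s)).2.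
  have t3t : t != t3.
    apply: contraNneq nds => E; rewrite -E -Wt -cD0 ?SD // in d3.
    by rewrite -[s]add0r -(vec_addvv v) -addrA addmx_sub.
  have e3 : c (u + (v + s)) = c u + c (v + s) by apply: (A1 _ _ t t3) => //; exact: SD.
  by apply: (addIr (c s)); rewrite -e1 -addrA e3 e2 addrA.
have [lam [lD lM lB]] := gf32_unique cK.
have lI := bij_inj lB; have l0 : lam 0 = 0 := additive0 lD.
have ld t a b : dir2 (omap lam t) (lam a) (lam b) = dir2 t a b.
  by case: t => [s|] /=; rewrite -?lM -?l0 (inj_eq lI).
exists (fun v => lam (c v).1), (fun v => lam (c v).2), (fun W => omap lam (o W)); split.
- by move=> u v uS vS; rewrite A2 //= !lD.
- by rewrite oT.
- move=> t; have [l' _ lK'] := lB; have [W Ws Wt] := oS (omap l' t); exists W => //.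
  by rewrite Wt; case: t {Wt} => //= s; rewrite lK'.
- move=> v vS e1 e2; apply: cI => //; rewrite c0; move: e1 e2.
  by rewrite -l0; case: (c v) => a b /= /lI -> /lI ->.
- by move=> W v Ws vS; rewrite ld cD0.
Qed.

Definition of_bits (b : 'rV['F_2]_5) : gf32 :=
  \sum_(i < 5) (if b 0 i == 0 then 0 else nth 0 gf_basis i).

Lemma of_bitsD : {morph of_bits : x y / x + y}.
Proof.
move=> x y; rewrite /of_bits -big_split; apply: eq_bigr => i _; rewrite mxE.
by have [->|->] := F2P (x 0 i); have [->|->] := F2P (y 0 i);
  rewrite ?addr0 ?add0r ?F2_addbb ?eqxx ?oner_eq0 /= ?addr0 ?add0r ?addff.
Qed.

Lemma of_bits_bij : bijective of_bits.
Proof.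
apply: surj_bij; first by rewrite card_gf32 card_mx card_Fp.
move=> y; suff [v <-] : exists v, of_bits v = y by exists v.
elim/gf_span: y => [|a b [u <-] [v <-]|g gB].
- by exists 0; apply: (additive0 of_bitsD).
- by exists (u + v); rewrite of_bitsD.
have j5 : (index g gf_basis < 5)%N by rewrite -[5%N]/(size gf_basis) index_mem.
exists (delta_mx 0 (Ordinal j5)); rewrite /of_bits (bigD1 (Ordinal j5)) //= big1 => [|i ij].
  by rewrite mxE !eqxx oner_eq0 addr0 nth_index.
by rewrite mxE (negPf ij) andbF eqxx.
Qed.

(** * From a pseudo-oval with a Desarguesian plane to an oval *)

Section PseudoOval.
Variable O : {set sub15}.
Hypothesis pO : pseudo_oval O.

Lemma oval_rank3 X Y Z : X \in O -> Y \in O -> Z \in O -> X != Y -> Y != Z -> X != Z ->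
  \rank (X + Y)%MS = 10%N /\ \rank ((X + Y) :&: Z)%MS = 0%N.
Proof.
have [rk [_ sp]] := pO; move=> XO YO ZO XY YZ XZ.
have [_ rX] := rk _ XO; have [_ rY] := rk _ YO; have [_ rZ] := rk _ ZO.
have := mxrank_sum_cap (X + Y)%MS Z; rewrite sp // rZ.
have := mxrank_sum_cap X Y; rewrite rX rY.
move: (\rank (X + Y)%MS) (\rank (X :&: Y)%MS) (\rank ((X + Y) :&: Z)%MS) => a b c e1 e2.
have ab : (a <= 10)%N by rewrite -[10%N]e1 leq_addr.
have E : a = (10 + c)%N by apply/eqP; rewrite -(eqn_add2r 5) -e2 -addnA (addnC c) addnA.
have c0 : c = 0%N by apply/eqP; move: ab; rewrite E -{2}[10%N]addn0 leq_add2l leqn0.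
by rewrite E c0.
Qed.

Lemma oval_third X Y : exists2 Z, Z \in O & (X != Z) && (Y != Z).
Proof.
have [_ [cO _]] := pO; have : (0 < #|O :\ X :\ Y|)%N.
  have := cardsD1 X O; have := cardsD1 Y (O :\ X); rewrite cO => e1.
  rewrite e1; case: (Y \in _) (X \in _) => [] [] /=; rewrite ?add0n ?add1n => E; first [by case: E => <- | by rewrite -E].
by case/card_gt0P => Z; rewrite !inE => /and3P[ZY ZX ZO]; exists Z; rewrite // ![_ == Z]eq_sym ZX.
Qed.

Lemma oval_cap X Y (v : vec15) : X \in O -> Y \in O -> X != Y -> (v <= X)%MS -> (v <= Y)%MS -> v = 0.
Proof.
move=> XO YO XY vX vY; have [Z ZO /andP[XZ YZ]] := oval_third X Y.
have YX : Y != X by rewrite eq_sym.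
have ZY : Z != Y by rewrite eq_sym.
have ZX : Z != X by rewrite eq_sym.
have [_] := oval_rank3 ZO YO XO ZY YX ZX => /eqP; rewrite mxrank_eq0 => /eqP E.
apply/eqP; rewrite -submx0 -E sub_capmx vX andbT.
by rewrite (submx_trans vY) // addsmxSr.
Qed.

Lemma oval_indep X Y Z (x y z : vec15) : X \in O -> Y \in O -> Z \in O -> X != Y -> Y != Z -> X != Z ->
  (x <= X)%MS -> (y <= Y)%MS -> (z <= Z)%MS -> x + y + z = 0 -> [/\ x = 0, y = 0 & z = 0].
Proof.
move=> XO YO ZO XY YZ XZ xX yY zZ E.
have vadd (u v : vec15) : u + v = 0 -> u = v by move=> e; rewrite -[v]add0r -e -addrA vec_addvv addr0.
have [_] := oval_rank3 XO YO ZO XY YZ XZ => /eqP; rewrite mxrank_eq0 => /eqP C.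
have z0 : z = 0.
  by apply/eqP; rewrite -submx0 -C sub_capmx zZ andbT -(vadd _ _ E) addmx_sub_adds.
move: E; rewrite z0 addr0 => /vadd xy.
have x0 : x = 0 by apply: (oval_cap XO YO) => //; rewrite xy.
by rewrite -xy x0.
Qed.

Variables (X : sub15).
Hypotheses (XO : X \in O) (dX : desarguesian_at O X).

Lemma desarguesian_realized : exists phi h, opoly h /\ realizes phi O h.
Proof.
have [rk [cO _]] := pO; have [T [S [[rT [XT TY]] [rS [XS [K [cK iso]]]]]]] := dX.
have [_ rX] := rk _ XO.
have XS0 (v : vec15) : (v <= X)%MS -> (v <= S)%MS -> v = 0.
  move=> vX vS; apply/eqP; rewrite -submx0; move/eqP: XS; rewrite mxrank_eq0 => /eqP <-.
  by rewrite sub_capmx vX.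
set spr := induced_spread O X T S in iso.
pose WT : sub15 := <<(T :&: S)%MS>>%MS; pose W_ (Y : sub15) : sub15 := <<((X + Y) :&: S)%MS>>%MS.
have WTs : WT \in spr by rewrite inE set11 orbT.
have W_s Y : Y \in O -> Y != X -> W_ Y \in spr.
  by move=> YO YX; rewrite inE; apply/orP; left; apply: imset_f; rewrite !inE YX.
(* The join of X and Y meets [S] because 10 + 10 > 15. A vector of T in that join lies in X, as T
   misses Y, and X misses [S]; so T and the join cut [S] differently. *)
have s2 : (1 < #|spr|)%N.
  have [Y YO /andP[XY _]] := oval_third X X; have YX : Y != X by rewrite eq_sym.
  suff WY : W_ Y != WT.
    have sub : [set W_ Y; WT] \subset spr by rewrite subUset !sub1set W_s // WTs.
    by have := subset_leq_card sub; rewrite cards2 WY.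
  apply/eqP => E; have [Z ZO /andP[XZ YZ]] := oval_third X Y.
  have [rXY _] := oval_rank3 XO YO ZO XY YZ XZ.
  have : (0 < \rank (W_ Y))%N.
    have := mxrank_sum_cap (X + Y)%MS S; rewrite rXY rS /W_ genmxE.
    have := rank_leq_row (X + Y + S)%MS.
    by case: (\rank ((X + Y) :&: S)%MS) => // le15; rewrite addn0 => E'; rewrite E' in le15.
  rewrite lt0n mxrank_eq0 => /eqP[]; apply/eqP; rewrite -mxrank_eq0; apply/eqP; apply: rank0P => v.
  move=> vW; have := vW; rewrite {1}E !genmxE !sub_capmx => /andP[vT vS].
  move: vW; rewrite genmxE sub_capmx => /andP[/sub_addsmxP[[a b] /= Ev] _].
  have aX : (a *m X <= X)%MS by apply: submxMl.
  have b0 : b *m Y = 0.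
    apply/eqP; rewrite -submx0; have /eqP := TY _ YO YX; rewrite mxrank_eq0 => /eqP <-.
    rewrite sub_capmx submxMl andbT; have -> : b *m Y = v - a *m X by rewrite Ev addrC addKr.
    by rewrite addmx_sub // eqmx_opp (submx_trans aX).
  by apply: XS0 => //; rewrite Ev b0 addr0.
have [w [y [o [wyD oT oS wy0 wyE]]]] := spread_linear cK rS iso WTs s2.
have cap0 : (X :&: S = 0)%MS by apply/eqP; rewrite -mxrank_eq0 XS.
have cap0' : (S :&: X = 0)%MS by rewrite capmxC.
have full (v : vec15) : (v <= X + S)%MS.
  apply: submx_trans (submx1 _) _; rewrite sub1mx /row_full.
  by have := mxrank_sum_cap X S; rewrite XS rX rS addn0 => ->.
pose px (v : vec15) := v *m proj_mx X S; pose ps (v : vec15) := v *m proj_mx S X.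
have pxX v : (px v <= X)%MS by apply: proj_mx_sub.
have psS v : (ps v <= S)%MS by apply: proj_mx_sub.
have pE v : px v + ps v = v by apply: add_proj_mx.
have pxD : {morph px : u v / u + v} by move=> u v; apply: mulmxDl.
have psD : {morph ps : u v / u + v} by move=> u v; apply: mulmxDl.
have psX v : (v <= X)%MS -> ps v = 0 by move=> vX; apply: proj_mx_0.
(* The coordinate on X is an arbitrary additive one; the bijection [k'] corrects it at the end. *)
have [xi xiD xi0] : exists2 xi : vec15 -> gf32, {morph xi : u v / u + v} &
    forall v : vec15, (v <= X)%MS -> xi v = 0 -> v = 0.
  move: (row_base X) (eq_row_base X) => R0 eR; move: R0 eR; rewrite rX => R eR.
  exists (fun v => of_bits (v *m pinvmx R)); first by move=> u v; rewrite mulmxDl of_bitsD.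
  move=> v vX /esym; rewrite -[X in X = _](additive0 of_bitsD) => /(bij_inj of_bits_bij) E.
  by rewrite -[v](@mulmxKpV _ _ _ _ v R) ?eR // -E mul0mx.
pose Phi (v : vec15) : G3 := (xi (px v), w (ps v), y (ps v)).
have PhiD : {morph Phi : u v / u + v}.
  move=> u v; have [ew ey] := wyD _ _ (psS u) (psS v).
  by rewrite /Phi pxD psD xiD ew ey.
have Phi0 v : Phi v = 0 -> v = 0.
  move=> [] e1 e2 e3; rewrite -[v]pE (xi0 _ (pxX v) e1) (wy0 _ (psS v) e2 e3).
  exact: addr0.
have vadd (u v : vec15) : u + v = 0 -> u = v by move=> e; rewrite -[v]add0r -e -addrA vec_addvv addr0.
have PhiI : injective Phi.
  by move=> u v E; apply: vadd; apply: Phi0; rewrite PhiD E G3_addvv.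
have YW (Y : sub15) (v : vec15) : (v <= Y)%MS -> (ps v <= W_ Y)%MS.
  move=> vY; rewrite genmxE sub_capmx psS andbT.
  have -> : ps v = px v + v by rewrite -{3}[v]pE addrA vec_addvv add0r.
  by rewrite addmx_sub_adds.
(* Finite slopes label the elements other than X, since the infinite slope was reserved for the
   trace of T on [S]. *)
have /fin_all_exists[Yf HYf] (m : gf32) : exists Y : sub15, [/\ Y \in O, Y != X & o (W_ Y) = Some m].
  have [W Ws Wm] := oS (Some m); move: Ws; rewrite inE => /orP[/imsetP[Y]|/set1P E].
    by rewrite !inE => /andP[YX YO] E; exists Y; rewrite /W_ -E.
  by move: Wm; rewrite E -/WT oT.
have YfO m : Yf m \in O by have [] := HYf m.
have YfX m : Yf m != X by have [] := HYf m.
have XYf m : X != Yf m by rewrite eq_sym.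
have YfI : injective Yf.
  by move=> m m' E; have [_ _ e1] := HYf m; have [_ _ e2] := HYf m'; move: e1; rewrite E e2 => -[].
have YfS Y : Y \in O -> Y = X \/ exists m, Y = Yf m.
  move=> YO; have [->|YX] := eqVneq Y X; [by left | right].
  have : Y \in O :\ X by rewrite !inE YX.
  have -> : O :\ X = [set Yf m | m : gf32].
    apply/esym/eqP; rewrite eqEcard; apply/andP; split.
      by apply/subsetP => Z /imsetP[m _ ->]; rewrite !inE YfX YfO.
    rewrite card_imset // card_gf32; have := cardsD1 X O; rewrite cO XO add1n => -[<-] //.
  by case/imsetP => m _ ->; exists m.
have Yy m v : (v <= Yf m)%MS -> y (ps v) = m * w (ps v).
  move=> vY; have [YO YX om] := HYf m; have := YW _ _ vY.
  by rewrite wyE ?W_s // om => /eqP.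
have Y0 m v : (v <= Yf m)%MS -> w (ps v) = 0 -> v = 0.
  move=> vY e; have s0 : ps v = 0 by apply: wy0 => //; rewrite (Yy _ _ vY) e mulr0.
  by apply: (oval_cap (YfO m) XO) => //; rewrite -[v]pE s0 addr0.
have YI m u v : (u <= Yf m)%MS -> (v <= Yf m)%MS -> w (ps u) = w (ps v) -> u = v.
  move=> uY vY E; apply: vadd; apply: (Y0 m); first exact: addmx_sub.
  by rewrite psD; have [-> _] := wyD _ _ (psS u) (psS v); rewrite E addff.
(* On [Yf m] the coordinate w is injective, hence onto as both sides have 32 elements; so [Yf m] is
   a graph over w. *)
have /fin_all_exists[G HG] (p : gf32 * gf32) : exists v : vec15, (v <= Yf p.1)%MS /\ w (ps v) = p.2.
  have : p.2 \in [set w (ps v) | v in [set v : vec15 | (v <= Yf p.1)%MS]].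
    suff -> : [set w (ps v) | v in [set v : vec15 | (v <= Yf p.1)%MS]] = setT by rewrite inE.
    apply/eqP; rewrite eqEcard subsetT cardsT card_gf32.
    have [_ rY] := rk _ (YfO p.1).
    rewrite card_in_imset ?card_rowspace ?rY // => u v; rewrite !inE; exact: YI.
  by case/imsetP => v; rewrite inE => vY ->; exists v.
have GY m a : (G (m, a) <= Yf m)%MS by have [] := HG (m, a).
have Ga m a : w (ps (G (m, a))) = a by have [] := HG (m, a).
pose F m a := xi (px (G (m, a))).
have PG m a : Phi (G (m, a)) = (F m a, a, m * a) by rewrite /Phi Ga (Yy m) // Ga.
have GD m a b : G (m, a + b) = G (m, a) + G (m, b).
  apply: (YI m) => //; first exact: addmx_sub.
  by rewrite psD; have [-> _] := wyD _ _ (psS (G (m, a))) (psS (G (m, b))); rewrite !Ga.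
have FD m : {morph F m : a b / a + b} by move=> a b; rewrite /F GD pxD xiD.
have [] := @dual_arc_form F FD.
  move=> m1 m2 m3 c m12 m23 m13 E.
  have := @oval_indep (Yf m1) (Yf m2) (Yf m3) (G (m1, (m2 + m3) * c)) (G (m2, (m1 + m3) * c))
    (G (m3, (m1 + m2) * c)) (YfO _) (YfO _) (YfO _).
  rewrite !(inj_eq YfI) => /(_ m12 m23 m13 (GY _ _) (GY _ _) (GY _ _)) [].
    apply: Phi0; rewrite !PhiD !PG; congr (_, _, _) => //=; first by gfring.
    by gfring.
  move=> /(congr1 (fun v => w (ps v))) e _ _; move: e; rewrite Ga.
  have -> : w (ps 0) = 0.
    have [e _] := wyD _ _ (psS 0) (psS 0); move: e; rewrite -psD addr0 => e.
    by apply: (addrI (w (ps 0))); rewrite addr0 -e.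
  by move/eqP; rewrite mulf_eq0 addf_eq0 (negPf m23) => /eqP.
move=> f [k [n [d [[of_ [k' kK k'K] kD nD dD] FE]]]].
have k'D : {morph k' : a b / a + b} by move=> a b; apply: (can_inj kK); rewrite kD !k'K.
(* Removing n and d and undoing k turns the spaces into (s, f(m) s, m s). There f(m) is the abscissa
   and m the ordinate, so the o-polynomial of the oval is the inverse of f. *)
have [f0 fi fa] := of_; have [h fK hK] := injF_bij fi.
pose phi v : G3 := let: (x, s, s') := Phi v in (s, k' (x + n s' + d s), s').
exists phi, h.
split; first exact: opoly_inv of_ fK hK.
have HX (v : vec15) : (v <= X)%MS = (w (ps v) == 0) && (y (ps v) == 0).
  apply/idP/andP => [vX|[/eqP e1 /eqP e2]]; last by rewrite -[v]pE (wy0 _ (psS v) e1 e2) addr0.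
  have := PhiD 0 0; rewrite addr0 G3_addvv => -[_ e1 e2]; move: e1 e2.
  by rewrite (psX _ (sub0mx _ _)) (psX _ vX) => -> ->.
have HY m (v : vec15) : (v <= Yf m)%MS = (y (ps v) == m * w (ps v)) && (xi (px v) == F m (w (ps v))).
  apply/idP/andP => [vY|[/eqP e1 /eqP e2]].
    rewrite (Yy _ _ vY); split=> //; apply/eqP; congr (xi (px _)).
    by apply: (YI m) => //; rewrite Ga.
  suff -> : v = G (m, w (ps v)) by [].
  by apply: PhiI; rewrite PG -e2 -e1.
have key m (v : vec15) : (v <= Yf m)%MS = pt h (Some (f m)) (phi v).
  rewrite HY /phi /Phi /= fK FE andbC [m * _]mulrC.
  have [e|ne] := eqVneq (y (ps v)) (w (ps v) * m); rewrite ?andbF // !andbT e.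
  move: (xi (px v)) (w (ps v)) => x s; apply/eqP/eqP => [->|E].
    rewrite [f m * s]mulrC -[RHS]kK; congr k'.
    by move: (k _) (n _) (d _) => p q r; gfring.
  rewrite [f m * s]mulrC -E k'K.
  by move: (n _) (d _) => q r; gfring.
split.
- move=> u v; rewrite /phi PhiD; case: (Phi u) (Phi v) => [[x s] s'] [[x1 s1] s1'].
  congr (_, _, _) => //=; rewrite -k'D; congr k'; rewrite nD dD.
  by move: (n s') (n s1') (d s) (d s1) => p q p' q'; gfring.
- apply: inj_card_bij; last by rewrite card_G3.
  move=> u v; rewrite /phi => E; apply: PhiI; move: E; case: (Phi u) (Phi v) => [[x s] s'] [[x1 s1] s1'] [-> e1 e2].
  rewrite e2 in e1 *; have e := can_inj k'K e1.
  by rewrite (addIr _ (addIr _ e)).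
- by move=> Y /rk[].
- by move=> Y /YfS[->|[m ->]]; [exists None|exists (Some (f m))] => v; rewrite ?HX ?key.
- case=> [j|]; last by exists X => // v; rewrite HX.
  by exists (Yf (h j)) => // v; rewrite key hK.
Qed.

End PseudoOval.

Theorem theorem7 :
  (exists Os : 'I_35 -> {set 'M['F_2]_15},
     (forall i, pseudo_oval (Os i) /\ exists2 X, X \in Os i & desarguesian_at (Os i) X) /\
     (forall i j, proj_equiv (Os i) (Os j) -> i = j) /\
     (forall O, pseudo_oval O -> (exists2 X, X \in O & desarguesian_at O X) ->
        exists i, proj_equiv O (Os i))) /\
  (forall O, pseudo_oval O -> (exists2 X, X \in O & desarguesian_at O X) ->
     elementary O).
Proof.
split; last first.
  move=> O pO [X XO dX]; have [phi [h [oh R]]] := desarguesian_realized pO XO dX.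
  exact: realizes_elementary R oh.
exists (fun i => oval_spaces (hpoly (nth [::] oval_coefs i))); split; last split.
- move=> i; have R := oval_spacesP (hpoly (nth [::] oval_coefs i)).
  have [|_ oh _] := @coefsP (nth [::] oval_coefs i); first by rewrite mem_nth ?size_oval_coefs.
  by split; [exact: realizes_pseudo_oval R oh | exact: realizes_desarguesian R oh].
- by move=> i j /oval_spaces_inequivalent-/(_ (ltn_ord i) (ltn_ord j)) E; apply: val_inj.
move=> O pO [X XO dX]; have [phi [h [oh R]]] := desarguesian_realized pO XO dX.
have [h0 _ _] := oh; have [c cc hc] := oval_classification oh.
have [phi' R'] := realizes_tequiv h0 hc R.
have ci : (index c oval_coefs < 35)%N by rewrite -size_oval_coefs index_mem.
exists (Ordinal ci); rewrite /= nth_index //.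
exact: realizes_proj_equiv R' (oval_spacesP _).
Qed.
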